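(* Let $A,C\in\mathbb R^{m\times n}$ be non-zero matrices and $\beta\in\mathbb R^n$ a non-zero vector such that the polyhedra $P$ and $Q'$ are non-degenerate. Let $E$ be the set of edges of $\mathcal N$ and let $E'=\{\overrightarrow{u,u'},\overleftarrow{u,u'} : \overline{u,u'}\in E\}$ be the set of directed edges. Then there exists an efficiently computable function $\rightarrow:E\to E'$, assigning to each edge one of its two orientations, such that it maps a cycle of $\mathcal N$ to a directed cycle and the path $\mathcal P$ to a path oriented from $(v_s,\mathcal E_{v_s})$ to $(v_e,\mathcal E_{v_e})$.
   Context: Let $S_1=\{1,\dots,m\}$, $S_2=\{1,\dots,n\}$, $A=[a_{ij}]$. For a matrix $M$, $M_i$ is its $i$-th row and $M^j$ its $j$-th column. $P=\{(y,\pi_1)\in\mathbb R^{n+1}: A_iy-\pi_1\le0\ (i\in S_1);\ y_j\ge0\ (j\in S_2);\ \sum_j y_j=1\}$ (of dimension $n$). $Q'=\{(x,\lambda,\pi_2)\in\mathbb R^{m+2}: x_i\ge0\ (i\in S_1);\ x^TC^j+\beta_j\lambda-\pi_2\le0\ (j\in S_2);\ \sum_i x_i=1\}$ (of dimension $m+1$). In both polyhedra the inequalities indexed by $i\in S_1$ are numbered $1,\dots,m$ and those indexed by $j\in S_2$ are numbered $m+1,\dots,m+n$. The label $L(v)$ of a point is the set of numbers of inequalities tight at it. $\mathcal N=\{(v,w)\in P\times Q': L(v)\cup L(w)=\{1,\dots,m+n\}\}$. For $v\in P$, $\mathcal E_v=\{w\in Q': (v,w)\in\mathcal N\}$. Let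 $j_s,j_e\in S_2$ be indices with $\beta_{j_s}=\min_j\beta_j$ and $\beta_{j_e}=\max_j\beta_j$. Non-degeneracy: every point in the relative interior of a $d$-dimensional face of $P$ (resp. $Q'$) has exactly $n-d$ (resp. $m+1-d$) tight inequalities. Non-degeneracy of $Q'$ is understood to entail $j_s\ne j_e$. In this setting $\mathcal N$ is a disjoint union of connected components on the $1$-skeleton of $P\times Q'$: exactly one path $\mathcal P$ (homeomorphic to $\mathbb R$) and finitely many (possibly zero) cycles. Let $i_s=\arg\max_i a_{ij_s}$, $i_e=\arg\max_i a_{ij_e}$, $v_s=(e_{j_s},a_{i_sj_s})$, $v_e=(e_{j_e},a_{i_ej_e})$ (vertices of $P$, $e_j$ the $j$-th unit vector of $\mathbb R^n$). The two unbounded end edges of $\mathcal P$ are $(v_s,\mathcal E_{v_s})=\{v_s\}\times\mathcal E_{v_s}$ and $(v_e,\mathcal E_{v_e})=\{v_e\}\times\mathcal E_{v_e}$. ''Efficiently computable'' means that the orientation of a given edge of $\mathcal N$ is computable in polynomial time. *)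

(* Defs.v *)
From HB Require Import structures.
From mathcomp Require Import all_boot all_order all_algebra.
From mathcomp Require Import boolp classical_sets reals topology normedtype.

Set Implicit Arguments.
Unset Strict Implicit.
Unset Printing Implicit Defensive.

Import Order.TTheory GRing.Theory Num.Theory.
Import numFieldNormedType.Exports.
Local Open Scope classical_set_scope.
Local Open Scope ring_scope.

(** * Faces, dimension and relative interior of subsets of R^N *)

Section ConvexGeometry.
Context {R : realType} {V : vectType R}.
Implicit Types S F : set V.

(* [F] is cut out of [S] by a valid inequality [f z <= d]; the choice f = 0,
   d = 0 makes [S] a face of itself, and the empty face is excluded. *)
Definition face S F : Prop :=
  F !=set0 /\
  exists (f : {linear V -> R^o}) (d : R),
    (forall z, S z -> f z <= d) /\ F = [set z | S z /\ f z = d].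

(* [U] is the linear span of the differences of points of [S], that is, the
   direction space of the affine hull of [S]. *)
Definition direction_space S (U : {vspace V}) : Prop :=
  forall W : {vspace V},
    (U <= W)%VS <-> (forall p q, S p -> S q -> q - p \in W).

Definition affine_hull S : set V :=
  [set z | exists p U, [/\ S p, direction_space S U & z - p \in U]].

Definition has_dim S (d : nat) : Prop :=
  S !=set0 /\ exists2 U, direction_space S U & \dim U = d.

Definition vertex S (u : V) : Prop := face S [set u].

Definition edge S F : Prop := face S F /\ has_dim F 1.

(* An orientation of a 1-dimensional set [F] is encoded by a non-zero vector
   parallel to it; positive multiples encode the same orientation, so [F] has
   exactly two of them. *)
Definition orientation_of F (d : V) : Prop :=
  d != 0 /\ exists p q, [/\ F p, F q & d = q - p].

Definition leads (d p q : V) : Prop := exists2 t : R, 0 < t & q - p = t *: d.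

End ConvexGeometry.

Definition relint {R : realType} {N : nat} (S : set 'rV[R]_N) : set 'rV[R]_N :=
  [set z | S z /\ exists2 e : R, 0 < e & ball z e `&` affine_hull S `<=` S].

(** * The polyhedra P and Q' *)

Section Game.
Context {R : realType} {m n : nat}.
Variables (A C : 'M[R]_(m, n)) (beta : 'rV[R]_n).

Definition y_of (v : 'rV[R]_(n + 1)) : 'rV[R]_n := lsubmx v.
Definition pi1_of (v : 'rV[R]_(n + 1)) : R := rsubmx v 0 0.
Definition x_of (w : 'rV[R]_(m + 2)) : 'rV[R]_m := lsubmx w.
Definition lambda_of (w : 'rV[R]_(m + 2)) : R := rsubmx w 0 0.
Definition pi2_of (w : 'rV[R]_(m + 2)) : R := rsubmx w 0 1.

(* The numbers of the inequalities are the elements of ['I_(m + n)]: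
   [lshift n i] for i in S_1 and [rshift m j] for j in S_2.  The k-th entry of
   a slack vector is the nonnegative side of the k-th inequality. *)
Definition slackP (v : 'rV[R]_(n + 1)) : 'rV[R]_(m + n) :=
  row_mx (\row_i (pi1_of v - \sum_j A i j * y_of v 0 j)) (y_of v).

Definition slackQ (w : 'rV[R]_(m + 2)) : 'rV[R]_(m + n) :=
  row_mx (x_of w)
    (\row_j (pi2_of w
             - (\sum_i x_of w 0 i * C i j + beta 0 j * lambda_of w))).

Definition polyP : set 'rV[R]_(n + 1) :=
  [set v | (forall k, 0 <= slackP v 0 k) /\ \sum_j y_of v 0 j = 1].

Definition polyQ : set 'rV[R]_(m + 2) :=
  [set w | (forall k, 0 <= slackQ w 0 k) /\ \sum_i x_of w 0 i = 1].

Definition labelP (v : 'rV[R]_(n + 1)) : {set 'I_(m + n)} :=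
  [set k | slackP v 0 k == 0]%SET.

Definition labelQ (w : 'rV[R]_(m + 2)) : {set 'I_(m + n)} :=
  [set k | slackQ w 0 k == 0]%SET.

(* "Exactly n - d tight inequalities", without truncated subtraction. *)
Definition nondegenerateP : Prop :=
  forall F d v, face polyP F -> has_dim F d -> relint F v ->
    (#|labelP v| + d = n)%N.

Definition nondegenerateQ : Prop :=
  forall F d w, face polyQ F -> has_dim F d -> relint F w ->
    (#|labelQ w| + d = m + 1)%N.

(** * The set N, its edges, cycles and path *)

Definition NN : set ('rV[R]_(n + 1) * 'rV[R]_(m + 2)) :=
  [set z | [/\ polyP z.1, polyQ z.2 &
            (labelP z.1 :|: labelQ z.2)%SET = [set: 'I_(m + n)]%SET]].

Definition EE (v : 'rV[R]_(n + 1)) : set 'rV[R]_(m + 2) :=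
  [set w | NN (v, w)].

Notation pt := ('rV[R]_(n + 1) * 'rV[R]_(m + 2))%type.

Definition edgeN (F : set pt) : Prop := edge (polyP `*` polyQ) F /\ F `<=` NN.

Definition vertexN (u : pt) : Prop := vertex (polyP `*` polyQ) u /\ NN u.

Definition adjN : rel pt := fun u u' =>
  `[< [/\ vertexN u, vertexN u', u <> u' &
          exists F, [/\ edgeN F, F u & F u']] >].

(* A cycle as the cyclic sequence of its vertices; two vertices are joined by
   at most one edge, so that a cycle has at least three of them. *)
Definition cycleN (c : seq pt) : Prop :=
  (2 < size c)%N /\ ucycle adjN c.

(* A path of bounded edges through the vertices [u :: us], prolonged by the
   end edges [Fs], which has the endpoint [u], and [Fe], which has the endpoint
   [last u us]. *)
Definition pathN (Fs Fe : set pt) (u : pt) (us : seq pt) : Prop :=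
  [/\ vertexN u, path adjN u us, uniq (u :: us), Fs u & Fe (last u us)].

Definition arcN (orient : set pt -> pt) : rel pt := fun u u' =>
  `[< exists F, [/\ edgeN F, F u, F u' & leads (orient F) u u'] >].

Definition directed_cycleN (orient : set pt -> pt) (c : seq pt) : Prop :=
  cycle (arcN orient) c \/ cycle (arcN orient) (rev c).

(* The end edges may be unbounded, so their orientation is stated for all
   their points: [Fs] leads to its endpoint, [Fe] leads away from it. *)
Definition directed_pathN (orient : set pt -> pt) (Fs Fe : set pt)
    (u : pt) (us : seq pt) : Prop :=
  [/\ edgeN Fs /\ (forall p, Fs p -> p <> u -> leads (orient Fs) p u),
      path (arcN orient) u us &
      edgeN Fe /\
      (forall p, Fe p -> p <> last u us -> leads (orient Fe) (last u us) p)].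

End Game.

(* (e_j, a) as a point of R^(n+1). *)
Definition unit_point {R : realType} {n : nat} (j : 'I_n) (a : R) :
  'rV[R]_(n + 1) := row_mx (delta_mx 0 j) (const_mx a).

(** * Polynomial time over ordered fields

   A random access machine over an ordered field, in structured form.  It has
   counters holding natural numbers, on which it can only count, and numbers of
   the field in cells [(a, i, j)], where the array name [a] is fixed by the
   program and the indices i and j are read from counters.  There are no
   constants other than 0 and 1. *)

Record cell := Cell { c_arr : nat; c_row : nat; c_col : nat }.

Inductive arith := Add | Sub | Mul | Div.

Inductive test :=
  | TCounter of nat & nat
  | TNumber of cell & cell.

Inductive cmd :=
  | CZero of nat
  | CSucc of nat
  | CCopy of nat & nat
  | CConst of cell & bool
  | CArith of cell & arith & cell & cell
  | CSeq of cmd & cmd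
  | CIf of test & cmd & cmd
  | CWhile of test & cmd.

Section Machine.
Context {K : realFieldType}.

Record state := State {
  counter : nat -> nat;
  number : nat -> nat -> nat -> K }.

Definition get (s : state) (c : cell) : K :=
  number s (c_arr c) (counter s (c_row c)) (counter s (c_col c)).

Definition set_counter (s : state) (r k : nat) : state :=
  State (fun r' => if r' == r then k else counter s r') (number s).

Definition put (s : state) (c : cell) (x : K) : state :=
  State (counter s)
    (fun a i j =>
       if [&& a == c_arr c, i == counter s (c_row c)
            & j == counter s (c_col c)]
       then x else number s a i j).

Definition eval_arith (o : arith) (x y : K) : K :=
  match o with
  | Add => x + y
  | Sub => x - y
  | Mul => x * y
  | Div => x / y
  end.

Definition eval_test (t : test) (s : state) : bool :=
  match t with
  | TCounter r r' => (counter s r < counter s r')%N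
  | TNumber c c' => get s c < get s c'
  end.

(* [exec w c s t s']: started in state [s], the program [c] stops in state [s']
   at cost [t].  Every elementary step costs 1, except that writing the number
   [x] costs [w x]. *)
Inductive exec (w : K -> nat) : cmd -> state -> nat -> state -> Prop :=
  | ExecZero r s : exec w (CZero r) s 1 (set_counter s r 0)
  | ExecSucc r s : exec w (CSucc r) s 1 (set_counter s r (counter s r).+1)
  | ExecCopy r r' s : exec w (CCopy r r') s 1 (set_counter s r (counter s r'))
  | ExecConst c b s : exec w (CConst c b) s (w b%:R) (put s c b%:R)
  | ExecArith c o c1 c2 s x of x = eval_arith o (get s c1) (get s c2) :
      exec w (CArith c o c1 c2) s (w x) (put s c x)
  | ExecSeq c1 c2 s1 s2 s3 t1 t2
      of exec w c1 s1 t1 s2 & exec w c2 s2 t2 s3 :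
      exec w (CSeq c1 c2) s1 (t1 + t2) s3
  | ExecIf b c1 c2 s s' t
      of exec w (if eval_test b s then c1 else c2) s t s' :
      exec w (CIf b c1 c2) s t.+1 s'
  | ExecWhileStop b c s of ~~ eval_test b s : exec w (CWhile b c) s 1 s
  | ExecWhileLoop b c s1 s2 s3 t1 t2
      of eval_test b s1 & exec w c s1 t1 s2 & exec w (CWhile b c) s2 t2 s3 :
      exec w (CWhile b c) s1 (t1 + t2).+1 s3.

(* The entries of a matrix as an array, padded with 0. *)
Definition array {m n : nat} (M : 'M[K]_(m, n)) (i j : nat) : K :=
  if (insub i, insub j) is (Some i', Some j') then M i' j' else 0.

(* The input: the dimensions m and n, the data of the game, and an edge given
   by an ordered pair of points (for instance its endpoints). *)
Definition input {m n : nat} (A C : 'M[K]_(m, n)) (beta : 'rV[K]_n)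
    (p q : 'rV[K]_(n + 1) * 'rV[K]_(m + 2)) : state :=
  State (fun r => nth 0%N [:: m; n] r)
    (fun a => nth (fun _ _ => 0)
       [:: array A; array C; array beta;
           array p.1; array p.2; array q.1; array q.2] a).

(* The program answers the question [b] by 1 or 0 in counter 0, at cost at
   most [T]. *)
Definition decides (w : K -> nat) (prog : cmd) (s : state) (T : nat)
    (b : bool) : Prop :=
  exists t s', [/\ exec w prog s t s', (t <= T)%N & counter s' 0 = b].

End Machine.

Arguments state : clear implicits.

Definition bit_length (k : nat) : nat := (trunc_log 2 k).+1.

Definition bit_size (x : rat) : nat :=
  (bit_length `|numq x| + bit_length `|denq x|)%N.

Definition bits_mx {m n : nat} (M : 'M[rat]_(m, n)) : nat :=
  (\sum_i \sum_j bit_size (M i j))%N.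

Definition input_bits {m n : nat} (A C : 'M[rat]_(m, n)) (beta : 'rV[rat]_n)
    (p q : 'rV[rat]_(n + 1) * 'rV[rat]_(m + 2)) : nat :=
  (m + n + bits_mx A + bits_mx C + bits_mx beta
   + bits_mx p.1 + bits_mx p.2 + bits_mx q.1 + bits_mx q.2)%N.

Section Efficiency.
Context {R : realType} {m n : nat}.
Variables (prog : cmd) (T : {poly nat}).
Variables (A C : 'M[R]_(m, n)) (beta : 'rV[R]_n).
Notation pt K := ('rV[K]_(n + 1) * 'rV[K]_(m + 2))%type.
Variable orient : set (pt R) -> pt R.

(* Real data: the number of steps, each arithmetic operation and comparison of
   real numbers being one step, is polynomial in the number of data. *)
Definition computes_real : Prop :=
  forall (F : set (pt R)) (p q : pt R),
    edgeN A C beta F -> F p -> F q -> p <> q ->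
    decides (fun=> 1%N) prog (input A C beta p q) T.[(m + n)%N]
      `[< leads (orient F) p q >].

Definition ratr_pt (p : pt rat) : pt R := (map_mx ratr p.1, map_mx ratr p.2).

(* Rational data: the cost of the same program run on rationals, where writing
   a number costs its bit size, is polynomial in the bit size of the data. *)
Definition computes_rational : Prop :=
  forall (A' C' : 'M[rat]_(m, n)) (beta' : 'rV[rat]_n) (p q : pt rat)
         (F : set (pt R)),
    A = map_mx ratr A' -> C = map_mx ratr C' -> beta = map_mx ratr beta' ->
    edgeN A C beta F -> F (ratr_pt p) -> F (ratr_pt q) -> p <> q ->
    decides bit_size prog (input A' C' beta' p q)
      T.[input_bits A' C' beta' p q]
      `[< leads (orient F) (ratr_pt p) (ratr_pt q) >].

(* Polynomial time for arbitrary real data and, on rational data, also in bit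
   complexity. *)
Definition computes_orientation : Prop := computes_real /\ computes_rational.

End Efficiency.

(* Main.v *)
(* On an edge of N every number k = 1, ..., m+n is tight in exactly one of the
   two polyhedra, by non-degeneracy.  Take the square matrix whose row k is the
   gradient of that tight inequality and whose last three rows are the sums of
   x and y and a direction d of the edge, in a fixed order: the sign of its
   determinant orients the edge.  At a vertex exactly one number k is tight
   twice, and the two edges of N at the vertex relax one of the two
   inequalities each; passing from one edge to the other exchanges row k with
   the row of d, so that the determinants of the two directions leading away
   from the vertex have opposite signs, and the orientation continues through
   the vertex.  On the two unbounded edges the matrix is, up to two row
   exchanges, block triangular with determinant 1 for d dual to lambda, so that
   both are oriented by increasing lambda: the first one enters its endpoint,
   the last one leaves it.

   The determinant is computed by the Faddeev-LeVerrier recursion, whose only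
   divisions are by 1, ..., m+n+3, so that all intermediate rational numbers
   have a common denominator of polynomial bit length. *)
From HB Require Import structures.
Require Import Defs.
From mathcomp Require Import all_boot all_order all_algebra perm.
From mathcomp Require Import zify ring lra.
From mathcomp Require Import boolp classical_sets reals topology normedtype.
Import Order.TTheory GRing.Theory Num.Theory.
Import numFieldNormedType.Exports.
Local Open Scope classical_set_scope.
Local Open Scope ring_scope.

(** * Determinants by the Faddeev-LeVerrier recursion *)

(** The determinant can be handled because of a replacement principle. All rows other than that of
    [d] annihilate [d], so replacing the row of [d] by any row [r] with [r d > 0] multiplies the
    determinant by a positive factor. At a vertex, [r] is taken to be the gradient of the relaxed
    inequality, and comparing two edges becomes a literal exchange of two rows; on an end edge, [r]
    is the unit row of lambda. Non-vanishing holds because the other rows have exactly the line of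
    [d] as kernel and [d d > 0]. One case escapes: both directions relax the same inequality. They
    then span the same ray, which is excluded because a vertex is never interior to a segment of the
    polyhedron.

    Gaussian elimination would branch on pivots and divide by numbers that depend on the data, whose
    sizes need an analysis by minors. The recursion used instead is a fixed nest of loops: a
    bookkeeping of levels, additive under products, bounds every number written, and the real and
    rational claims become two instances of one statement. *)

Lemma deriv_prod {R : comNzRingType} (I : finType) (F : I -> {poly R}) :
  (\prod_i F i)^`() =
  \sum_i \prod_k (if k == i then (F k)^`() else F k).
Proof.
suff H r : uniq r -> (\prod_(i <- r) F i)^`() =
    \sum_(i <- r) \prod_(k <- r) (if k == i then (F k)^`() else F k).
  by have := H _ (index_enum_uniq I).
elim: r => [|a r IH] /=; first by rewrite !big_nil derivC.
case/andP=> ar ur; rewrite !big_cons derivM IH // eqxx.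
congr (_ + _).
  congr (_ * _); apply: eq_big_seq => k kr.
  by case: eqP => // E; rewrite -E kr in ar.
rewrite big_distrr /=; apply: eq_big_seq => i ir; rewrite big_cons.
by case: eqP => // E; rewrite E ir in ar.
Qed.

(** Jacobi's formula for the matrix ['X - A]. The determinant is differentiated row by row; the
    derivative of row [i] is the [i]-th unit row, and expanding along it leaves the [i]-th diagonal
    cofactor. *)
Lemma deriv_char_poly {R : comNzRingType} {N : nat} (A : 'M[R]_N) :
  (char_poly A)^`() = \tr (\adj (char_poly_mx A)).
Proof.
set P := char_poly_mx A.
transitivity (\sum_i \det (\matrix_(k, j) (if k == i then (P k j)^`() else P k j))).
  rewrite /char_poly /determinant raddf_sum /= exchange_big /=.
  have sgn b (p : {poly R}) : ((-1) ^+ b * p)^`() = (-1) ^+ b * p^`().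
    by elim: b => [|b IH]; rewrite ?expr0 ?mul1r // exprS !mulN1r !mulNr derivN IH.
  apply: eq_bigr => s _; rewrite sgn deriv_prod big_distrr /=.
  by apply: eq_bigr => i _; congr (_ * _); apply: eq_bigr => k _; rewrite !mxE.
apply: eq_bigr => i _; rewrite (expand_det_row _ i) (bigD1 i) //= big1 ?addr0.
  rewrite !mxE !eqxx derivB derivC derivX subr0 mul1r /cofactor.
  congr (_ * \det _); apply/matrixP=> k j; rewrite !mxE.
  by rewrite eq_sym (negbTE (neq_lift _ _)).
by move=> j ji; rewrite !mxE eqxx eq_sym (negbTE ji) mulr0n derivB !derivC subr0 mul0r.
Qed.

Fixpoint leverrier {K : fieldType} {N : nat} (M : 'M[K]_N) (l : nat) : 'M[K]_N :=
  if l is k.+1 then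
    (\tr (M *m leverrier M k) / k.+1%:R)%:M - M *m leverrier M k
  else 1%:M.

(* The matrices are the coefficients of the adjugate of ['X + M], from the
   leading one down: the coefficients of [('X + M) * adj = det] give the
   recursion, and [det^`() = \tr adj] gives the scalars. *)
Lemma det_leverrier {K : numFieldType} {N : nat} (M : 'M[K]_N.+1) :
  \det M = \tr (M *m leverrier M N) / N.+1%:R.
Proof.
pose p := char_poly (- M); pose Q := \adj (char_poly_mx (- M)).
pose q k := \matrix_(i, j) (Q i j)`_k.
have QE : ('X%:M + map_mx polyC M) *m Q = p%:M.
  rewrite -mul_mx_adj -/Q; congr mulmx.
  by apply/matrixP=> i j; rewrite !mxE rmorphN opprK.
have coefMQ k i j : ((map_mx polyC M *m Q) i j)`_k = (M *m q k) i j.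
  rewrite !mxE coef_sum; apply: eq_bigr => l _.
  by rewrite !mxE coefCM.
have recq k : q k = (p`_k.+1)%:M - M *m q k.+1.
  apply/matrixP=> i j; have /matrixP/(_ i j) := QE.
  rewrite mulmxDl mul_scalar_mx => /(congr1 (fun r : {poly K} => r`_k.+1)).
  rewrite mxE coefD coefMQ !mxE coefMn => <-.
  by rewrite addrK mulrC coefMX.
have rec0 : M *m q 0 = (p`_0)%:M.
  apply/matrixP=> i j; have /matrixP/(_ i j) := QE.
  rewrite mulmxDl mul_scalar_mx => /(congr1 (fun r : {poly K} => r`_0)).
  by rewrite mxE coefD coefMQ !mxE coefMn mulrC coefMX add0r.
have sp : size p = N.+2 by exact: size_char_poly.
(* Above the degree of [p] the recursion reads [q k = - M *m q k.+1], so the vanishing of the very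
   high coefficients descends to index [N.+1]. *)
have q_big : q N.+1 = 0.
  pose d := (\sum_i \sum_j size (Q i j))%N.
  have qd k : (d <= k)%N -> q k = 0.
    move=> dk; apply/matrixP=> i j; rewrite mxE [RHS]mxE nth_default //.
    apply: leq_trans dk; rewrite /d (bigD1 i) //= (bigD1 j) //=.
    by rewrite -addnA leq_addr.
  have qS k : (N < k)%N -> q k.+1 = 0 -> q k = 0.
    by move=> Nk E; rewrite recq E mulmx0 subr0 nth_default ?sp // raddf0.
  have [|Nd] := leqP d N.+1; first exact: qd.
  suff H j : (j <= d - N.+1)%N -> q (d - j)%N = 0.
    by have := H _ (leqnn _); rewrite subKn // ltnW.
  elim: j => [|j IH] jd; first by rewrite subn0 qd.
  apply: qS; first lia.
  by rewrite -IH 1?ltnW //; congr q; lia.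
have qN : q N = 1%:M.
  have := char_poly_monic (- M); rewrite monicE lead_coefE sp /= => /eqP pN.
  by rewrite recq q_big mulmx0 subr0 pN.
have trq k : \tr (q k) = p`_k.+1 *+ k.+1.
  rewrite -coef_deriv deriv_char_poly -/Q /mxtrace coef_sum.
  by apply: eq_bigr => i _; rewrite mxE.
(* The trace of [recq] counts the coefficient of degree [k.+1] of [p] with factor [N.+1], the
   derivative counts it with factor [k.+1]; the difference leaves [N - k]. *)
have cE k : (k < N)%N -> p`_k.+1 = \tr (M *m q k.+1) / (N - k)%:R.
  move=> kN; have := trq k; rewrite recq raddfB /= mxtrace_scalar.
  move/eqP; rewrite subr_eq addrC -subr_eq -mulrnBr 1?ltnW // subSS => /eqP <-.
  by rewrite -[X in X / _]mulr_natr mulfK // pnatr_eq0 -lt0n subn_gt0.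
have lE l : (l <= N)%N -> leverrier M l = q (N - l)%N.
  elim: l => [|l IH] lN /=; first by rewrite subn0.
  rewrite [RHS]recq cE; last lia.
  have -> : (N - l.+1).+1 = (N - l)%N by lia.
  have -> : (N - (N - l.+1))%N = l.+1 by lia.
  by rewrite IH 1?ltnW.
rewrite lE // subnn rec0 mxtrace_scalar -[X in _ = X / _]mulr_natr mulfK ?pnatr_eq0 //.
(* The sign in the constant coefficient of [char_poly (- M)] cancels against the sign of
   [\det (- M)]. *)
rewrite /p char_poly_det -[- M]scaleN1r detZ mulrA -exprD.
by rewrite -signr_odd addnn odd_double mul1r.
Qed.

(** * A structured language compiled to the machine *)

(* [SLet r1 r2 b s] runs [s] with a new counter holding [r1 + r2 + b], and
   [SFor r s] runs [s] with a new counter ranging over the numbers below [r].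
   Counters are de Bruijn levels: the new counter has the first free number. *)
Inductive src :=
  | SPut of cell & bool
  | SArith of cell & arith & cell & cell
  | SSeq of src & src
  | SIf of cell & cell & src & src
  | SFor of nat & src
  | SLet of nat & nat & bool & src.

(** In the code of [SLet], counter [d.+1] is scratch for the addition; the [CZero d.+1] executed
    when [b] is false is a dummy step. *)
Fixpoint compile (d : nat) (s : src) : cmd :=
  match s with
  | SPut c b => CConst c b
  | SArith c o c1 c2 => CArith c o c1 c2
  | SSeq s1 s2 => CSeq (compile d s1) (compile d s2)
  | SIf c1 c2 s1 s2 => CIf (TNumber c1 c2) (compile d s1) (compile d s2)
  | SFor r s => CSeq (CZero d)
      (CWhile (TCounter d r) (CSeq (compile d.+1 s) (CSucc d)))
  | SLet r1 r2 b s => CSeq (CCopy d r1) (CSeq (CZero d.+1)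
      (CSeq (CWhile (TCounter d.+1 r2) (CSeq (CSucc d) (CSucc d.+1)))
        (CSeq (if b then CSucc d else CZero d.+1) (compile d.+1 s))))
  end.

Definition scoped_cell (d : nat) (c : cell) : bool :=
  (c_row c < d)%N && (c_col c < d)%N.

Fixpoint scoped (d : nat) (s : src) : bool :=
  match s with
  | SPut c _ => scoped_cell d c
  | SArith c _ c1 c2 => [&& scoped_cell d c, scoped_cell d c1 & scoped_cell d c2]
  | SSeq s1 s2 => scoped d s1 && scoped d s2
  | SIf c1 c2 s1 s2 =>
      [&& scoped_cell d c1, scoped_cell d c2, scoped d s1 & scoped d s2]
  | SFor r s => (r < d)%N && scoped d.+1 s
  | SLet r1 r2 _ s => [&& (r1 < d)%N, (r2 < d)%N & scoped d.+1 s]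
  end.

(* An upper bound on the number of steps when all counters are at most [X];
   both branches of a conditional are counted. *)
Fixpoint src_time {S : pzSemiRingType} (X : S) (s : src) : S :=
  match s with
  | SPut _ _ => 1
  | SArith _ _ _ _ => 1
  | SSeq s1 s2 => src_time X s1 + src_time X s2
  | SIf _ _ s1 s2 => 1 + (src_time X s1 + src_time X s2)
  | SFor _ s => X * (src_time X s + 2%:R) + 2%:R
  | SLet _ _ _ s => X * 3%:R + 4%:R + src_time (X + X + 1) s
  end.

(** * Semantics of the structured language and correctness of its compilation *)

Section Denotation.
Context {K : realFieldType}.
Implicit Types (cs : seq nat) (f : nat -> nat -> nat -> K).

Definition fetch cs f (c : cell) : K :=
  f (c_arr c) (nth 0%N cs (c_row c)) (nth 0%N cs (c_col c)).

Definition store cs f (c : cell) (x : K) : nat -> nat -> nat -> K :=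
  fun a i j =>
    if [&& a == c_arr c, i == nth 0%N cs (c_row c)
         & j == nth 0%N cs (c_col c)] then x else f a i j.

Fixpoint den cs (s : src) f : nat -> nat -> nat -> K :=
  match s with
  | SPut c b => store cs f c b%:R
  | SArith c o c1 c2 =>
      store cs f c (eval_arith o (fetch cs f c1) (fetch cs f c2))
  | SSeq s1 s2 => den cs s2 (den cs s1 f)
  | SIf c1 c2 s1 s2 =>
      if fetch cs f c1 < fetch cs f c2 then den cs s1 f else den cs s2 f
  | SFor r s => iteri (nth 0%N cs r) (fun k => den (rcons cs k) s) f
  | SLet r1 r2 b s => den (rcons cs (nth 0 cs r1 + nth 0 cs r2 + b)%N) s f
  end.

(** The cost of a write depends on the number written, so the running time has to be controlled by a
    predicate on all numbers written along the execution, not just on the final store. *)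
Fixpoint safe (P : K -> Prop) cs (s : src) f : Prop :=
  match s with
  | SPut c b => P b%:R
  | SArith c o c1 c2 => P (eval_arith o (fetch cs f c1) (fetch cs f c2))
  | SSeq s1 s2 => safe P cs s1 f /\ safe P cs s2 (den cs s1 f)
  | SIf c1 c2 s1 s2 =>
      if fetch cs f c1 < fetch cs f c2 then safe P cs s1 f else safe P cs s2 f
  | SFor r s => forall k, (k < nth 0%N cs r)%N ->
      safe P (rcons cs k) s (iteri k (fun k => den (rcons cs k) s) f)
  | SLet r1 r2 b s => safe P (rcons cs (nth 0 cs r1 + nth 0 cs r2 + b)%N) s f
  end.

(** Counters from [size cs] on are unconstrained: they are free for loops and scratch. *)
Definition agree cs f (st : state K) : Prop :=
  (forall r, (r < size cs)%N -> counter st r = nth 0%N cs r) /\ Defs.number st = f.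

Definition runs (w : K -> nat) (c : cmd) (st : state K) (T : nat)
    (Q : state K -> Prop) : Prop :=
  exists t st', [/\ exec w c st t st', (t <= T)%N & Q st'].

Lemma runs_seq w c1 c2 st T1 T2 (Q1 Q2 : state K -> Prop) :
  runs w c1 st T1 Q1 -> (forall st', Q1 st' -> runs w c2 st' T2 Q2) ->
  runs w (CSeq c1 c2) st (T1 + T2) Q2.
Proof.
move=> [t1 [st1 [e1 l1 q1]]] /(_ _ q1) [t2 [st2 [e2 l2 q2]]].
exists (t1 + t2)%N, st2; split=> //; first exact: ExecSeq e1 e2.
exact: leq_add.
Qed.

Lemma runs_while w r b c st T (n : nat) (Inv : nat -> state K -> Prop) :
  (forall k st', Inv k st' -> counter st' r = k /\ counter st' b = n) ->
  (forall k st', (k < n)%N -> Inv k st' -> runs w c st' T (Inv k.+1)) ->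
  Inv 0%N st -> runs w (CWhile (TCounter r b) c) st (n * T.+1 + 1) (Inv n).
Proof.
move=> cnt step inv0.
suff H j : (j <= n)%N -> forall st', Inv (n - j)%N st' ->
    runs w (CWhile (TCounter r b) c) st' (j * T.+1 + 1) (Inv n).
  by apply: H (leqnn n) _ _; rewrite subnn.
elim: j => [|j IH] jn st' inv.
  rewrite subn0 in inv; exists 1%N, st'; split=> //.
  by apply: ExecWhileStop; rewrite /=; have [-> ->] := cnt _ _ inv; rewrite ltnn.
have ltn : (n - j.+1 < n)%N by lia.
have [t1 [st1 [e1 l1 q1]]] := step _ _ ltn inv.
have Ej : (n - j.+1).+1 = (n - j)%N by lia.
rewrite Ej in q1; have [t2 [st2 [e2 l2 q2]]] := IH (ltnW jn) _ q1.
exists (t1 + t2).+1, st2; split=> //; last lia.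
apply: ExecWhileLoop e1 e2 => /=.
by have [-> ->] := cnt _ _ inv.
Qed.

Lemma agree_set_counter cs f st r k :
  (size cs <= r)%N -> agree cs f st -> agree cs f (set_counter st r k).
Proof.
move=> ler [cnt num]; split=> // i li /=.
by rewrite ifN ?cnt // neq_ltn (leq_trans li ler).
Qed.

Lemma agree_rcons cs k f st :
  agree (rcons cs k) f st <-> agree cs f st /\ counter st (size cs) = k.
Proof.
split=> [[cnt num]|[[cnt num] ck]].
  split; first split=> // r lr.
    by rewrite cnt ?nth_rcons ?lr // size_rcons ltnS ltnW.
  by rewrite cnt ?size_rcons // nth_rcons ltnn eqxx.
split=> // r; rewrite size_rcons ltnS leq_eqVlt nth_rcons.
by case: ltngtP => [lr _|lr|-> _]; rewrite ?eqxx ?ck //; apply: cnt.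
Qed.

Lemma get_fetch cs f st c :
  agree cs f st -> scoped_cell (size cs) c -> Defs.get st c = fetch cs f c.
Proof. by case=> cnt num /andP[lr lc]; rewrite /Defs.get /fetch num !cnt. Qed.

Lemma put_store cs f st c x :
  agree cs f st -> scoped_cell (size cs) c ->
  agree cs (store cs f c x) (put st c x).
Proof.
by case=> cnt num /andP[lr lc]; split=> //=; rewrite /store num !cnt.
Qed.

(** A loop counter stays below a counter already in [cs], so the bound [X] survives [SFor]; only
    [SLet] enlarges it, to [X + X + 1]. Every elementary step is charged [W], which covers counter
    steps because [0 < W]. *)
Lemma compile_runs (w : K -> nat) (W : nat) (P : K -> Prop) :
  (forall x, P x -> (w x <= W)%N) -> (0 < W)%N ->
  forall s cs f st X, scoped (size cs) s -> all (fun k => (k <= X)%N) cs ->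
  agree cs f st -> safe P cs s f ->
  runs w (compile (size cs) s) st (src_time X s * W) (agree cs (den cs s f)).
Proof.
move=> wP W0; elim=> [c b|c o c1 c2|s1 IH1 s2 IH2|c1 c2 s1 IH1 s2 IH2|r s IH|
    r1 r2 b s IH] cs f st X /=.
- move=> sc _ ag /wP lw; exists (w b%:R), (put st c b%:R); split.
  + exact: ExecConst.
  + by rewrite mul1n.
  + exact: put_store.
- case/and3P=> sc sc1 sc2 _ ag /wP lw.
  set x := eval_arith _ _ _ in lw *.
  exists (w x), (put st c x); split.
  + by apply: ExecArith; rewrite !(get_fetch _ _ _ _ ag).
  + by rewrite mul1n.
  + exact: put_store.
- case/andP=> sc1 sc2 le ag [sf1 sf2]; rewrite mulnDl.
  apply: (runs_seq _ _ _ _ _ _ _ _ (IH1 _ _ _ _ sc1 le ag sf1)) => st' ag'.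
  exact: IH2.
- case/and4P=> sc1 sc2 ss1 ss2 le ag sf.
  have : runs w (if eval_test (TNumber c1 c2) st
                 then compile (size cs) s1 else compile (size cs) s2) st
          ((src_time X s1 + src_time X s2) * W)
          (agree cs (if fetch cs f c1 < fetch cs f c2
                     then den cs s1 f else den cs s2 f)).
    rewrite /= !(get_fetch _ _ _ _ ag) //; move: sf; rewrite mulnDl.
    case: ifP => _ sf.
      have [t [st' [e l q]]] := IH1 _ _ _ _ ss1 le ag sf.
      by exists t, st'; split=> //; apply: leq_trans l (leq_addr _ _).
    have [t [st' [e l q]]] := IH2 _ _ _ _ ss2 le ag sf.
    by exists t, st'; split=> //; apply: leq_trans l (leq_addl _ _).
  move=> [t [st' [e l q]]]; exists t.+1, st'; split=> //; last by nia.
  exact: ExecIf.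
- case/andP=> lr ss le ag sf.
  have Xr : (nth 0%N cs r <= X)%N by exact: (all_nthP 0%N le).
  set n := nth 0%N cs r in sf Xr *.
  set F := fun k => den (rcons cs k) s.
  pose Inv k st' := agree (rcons cs k) (iteri k F f) st'.
  have H : runs w (CWhile (TCounter (size cs) r)
      (CSeq (compile (size cs).+1 s) (CSucc (size cs)))) (set_counter st (size cs) 0)
      (n * (src_time X s * W + 1).+1 + 1) (Inv n).
    apply: runs_while => [k st' /agree_rcons[[cnt _] ->]|k st' kn inv|].
    + by split=> //; exact: cnt.
    + apply: (runs_seq _ _ _ _ _ _ (agree (rcons cs k) (iteri k.+1 F f))).
        rewrite -(size_rcons cs k) /=; apply: IH => //; last exact: sf.
          by rewrite size_rcons.
        by rewrite all_rcons le andbT (leq_trans (ltnW kn)).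
      move=> st1 /agree_rcons[ag1 ck]; eexists _, _; split; first exact: ExecSucc.
        by [].
      apply/agree_rcons; split; first exact: agree_set_counter.
      by rewrite /= eqxx ck.
    + by apply/agree_rcons; split; [exact: agree_set_counter|rewrite /= eqxx].
  case: H => [t [st' [e l /agree_rcons[q _]]]].
  exists (1 + t)%N, st'; split=> //; first by apply: ExecSeq e; apply: ExecZero.
  have : (n * (src_time X s * W + 2) <= X * (src_time X s * W + 2))%N.
    by rewrite leq_mul2r Xr orbT.
  have : (X * (src_time X s * W + 2) <= X * (src_time X s + 2) * W)%N.
    rewrite -mulnA leq_mul2l mulnDl leq_add2l; apply/orP; right; lia.
  by move: l W0; rewrite mulnDl; lia.
- case/and3P=> l1 l2 ss le ag sf.
  have X1 : (nth 0%N cs r1 <= X)%N by exact: (all_nthP 0%N le).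
  have X2 : (nth 0%N cs r2 <= X)%N by exact: (all_nthP 0%N le).
  set n1 := nth 0%N cs r1 in sf X1 *; set n2 := nth 0%N cs r2 in sf X2 *.
  have [cnt num] := ag; set d := size cs in l1 l2 cnt ss *.
  (* The summands pay in turn for the copy, the reset of the scratch counter, the adding loop, the
     correction by [b] and the body. *)
  have -> : ((X * 3%:R + 4%:R + src_time (X + X + 1) s)%R * W)%N =
    (W + (W + ((X * 3 + 1) * W + (W + src_time (X + X + 1) s * W))))%N by nia.
  apply: (runs_seq _ _ _ _ _ _ (agree (rcons cs n1) f)).
    exists 1%N; eexists; split; [exact: ExecCopy|by []|].
    apply/agree_rcons; split; first exact: agree_set_counter.
    by rewrite /= eqxx cnt.
  move=> st1 /agree_rcons[ag1 c1].
  apply: (runs_seq _ _ _ _ _ _ (agree (rcons (rcons cs n1) 0) f)).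
    exists 1%N; eexists; split; [exact: ExecZero|by []|].
    apply/agree_rcons; rewrite size_rcons; split; last by rewrite /= eqxx.
    apply: agree_set_counter; first by rewrite size_rcons.
    exact/agree_rcons.
  move=> st2 ag2.
  apply: (runs_seq _ _ _ _ _ _ (agree (rcons (rcons cs (n1 + n2)%N) n2) f)).
    pose Inv k := agree (rcons (rcons cs (n1 + k)%N) k) f.
    have [k st' inv|k st' kn||t [st' [e l q]]] :=
        runs_while w d.+1 r2 (CSeq (CSucc d) (CSucc d.+1)) st2 2 n2 Inv.
    + move/agree_rcons: inv; rewrite size_rcons => -[/agree_rcons[[cnt' _] _] ->].
      by rewrite cnt'.
    + move/agree_rcons; rewrite size_rcons => -[/agree_rcons[ag' c'] c''].
      do 2!eexists; split; [apply: ExecSeq; [exact: ExecSucc|exact: ExecSucc]|by []|].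
      apply/agree_rcons; rewrite size_rcons; split; last first.
        by rewrite /= eqxx gtn_eqF ?c''.
      apply: agree_set_counter; rewrite ?size_rcons //.
      apply/agree_rcons; split; first exact: agree_set_counter.
      by rewrite /= eqxx c' addnS.
    + by rewrite /Inv addn0.
    + exists t, st'; split=> //; apply: leq_trans l _.
      have := leq_mul X2 (leqnn 3); nia.
  move=> st3 /agree_rcons; rewrite size_rcons => -[/agree_rcons[ag3 c3] c3'].
  apply: (runs_seq _ _ _ _ _ _ (agree (rcons cs (n1 + n2 + b)%N) f)).
    case: (b).
      exists 1%N; eexists; split; [exact: ExecSucc|by []|].
      apply/agree_rcons; split; first exact: agree_set_counter.
      by rewrite /= eqxx c3 addn1.
    exists 1%N; eexists; split; [exact: ExecZero|by []|].
    apply/agree_rcons; split; first exact: agree_set_counter.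
    by rewrite /= ltn_eqF // c3 addn0.
  move=> st4 ag4.
  have ss' : scoped (size (rcons cs (n1 + n2 + b)%N)) s by rewrite size_rcons.
  have le' : all (fun k => (k <= X + X + 1)%N) (rcons cs (n1 + n2 + b)%N).
    rewrite all_rcons; apply/andP; split; first by case: (b); lia.
    by apply: sub_all le => k; lia.
  have := IH _ _ _ _ ss' le' ag4 sf; rewrite size_rcons.
  move=> [t [st5 [e l /agree_rcons[q _]]]].
  by exists t, st5.
Qed.

End Denotation.

(* The program never writes counter 2, which holds 0. *)
Definition slot (a : nat) : cell := Cell a 2 2.
Definition tmp_array := 10%N.

(* [c := \sum_k c1 * c2], where [c1] and [c2] may use the counter [d] for [k]. *)
Definition sum_src (r : nat) (c c1 c2 : cell) : src :=
  SSeq (SPut c false) (SFor r (SSeq (SArith (slot tmp_array) Mul c1 c2)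
                                    (SArith c Add c (slot tmp_array)))).

(* Writes [c1 o c2] to the columns [off + k] of the given row of the array [a];
   [c1] and [c2] may use the counter [d] for [k]. *)
Definition fill_src (d r a row off : nat) (o : arith) (c1 c2 : cell) : src :=
  SFor r (SLet off d false (SArith (Cell a row d.+1) o c1 c2)).

(** * Program logic for the structured language *)

Section Sat.
Context {K : realFieldType}.
Variable P : K -> Prop.
Implicit Types (cs : seq nat) (f g : nat -> nat -> nat -> K).
Implicit Type Q : (nat -> nat -> nat -> K) -> Prop.

(** A total-correctness assertion; termination needs no clause because [den] is a total function. *)
Definition sat cs (s : src) f (Q : (nat -> nat -> nat -> K) -> Prop) : Prop :=
  safe P cs s f /\ Q (den cs s f).

Lemma sat_put cs c (b : bool) f Q :
  P b%:R -> Q (store cs f c b%:R) -> sat cs (SPut c b) f Q.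
Proof. by []. Qed.

Lemma sat_arith cs c o c1 c2 f Q x :
  eval_arith o (fetch cs f c1) (fetch cs f c2) = x ->
  P x -> Q (store cs f c x) -> sat cs (SArith c o c1 c2) f Q.
Proof. by move=> <-. Qed.

Lemma sat_seq cs s1 s2 f Q :
  sat cs s1 f (fun g => sat cs s2 g Q) -> sat cs (SSeq s1 s2) f Q.
Proof. by case=> ? []. Qed.

Lemma sat_weak cs s f Q Q' :
  sat cs s f Q -> (forall g, Q g -> Q' g) -> sat cs s f Q'.
Proof. by case=> ? q H; split=> //; exact: H. Qed.

Lemma sat_if cs c1 c2 s1 s2 f Q :
  (if fetch cs f c1 < fetch cs f c2 then sat cs s1 f Q else sat cs s2 f Q) ->
  sat cs (SIf c1 c2 s1 s2) f Q.
Proof. by rewrite /sat /=; case: ifP. Qed.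

Lemma sat_let cs r1 r2 (b : bool) s f Q :
  sat (rcons cs (nth 0 cs r1 + nth 0 cs r2 + b)%N) s f Q ->
  sat cs (SLet r1 r2 b s) f Q.
Proof. by []. Qed.

Lemma sat_for (Inv : nat -> (nat -> nat -> nat -> K) -> Prop) cs r s f :
  Inv 0%N f ->
  (forall k g, (k < nth 0%N cs r)%N -> Inv k g -> sat (rcons cs k) s g (Inv k.+1)) ->
  sat cs (SFor r s) f (Inv (nth 0%N cs r)).
Proof.
set n := nth 0%N cs r => inv0 step.
have inv k : (k <= n)%N -> Inv k (iteri k (fun k => den (rcons cs k) s) f).
  by elim: k => // k IH kn; have [] := step k _ kn (IH (ltnW kn)).
by split=> [k kn|]; [have [] := step k _ kn (inv k (ltnW kn))|exact: inv].
Qed.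

Lemma fetch_rcons cs k f c :
  scoped_cell (size cs) c -> fetch (rcons cs k) f c = fetch cs f c.
Proof. by case/andP=> lr lc; rewrite /fetch !nth_rcons lr lc. Qed.

Lemma store_rcons cs k f c x :
  scoped_cell (size cs) c -> store (rcons cs k) f c x = store cs f c x.
Proof. by case/andP=> lr lc; rewrite /store !nth_rcons lr lc. Qed.

Lemma fetch_store cs f c x : fetch cs (store cs f c x) c = x.
Proof. by rewrite /fetch /store !eqxx. Qed.

Lemma eq_fetch cs f g c : (forall i j, f (c_arr c) i j = g (c_arr c) i j) ->
  fetch cs f c = fetch cs g c.
Proof. by move=> E; exact: E. Qed.

Lemma store_other cs f c x a : a != c_arr c -> store cs f c x a = f a.
Proof. by rewrite /store => /negbTE->. Qed.

(** The partial sums must satisfy [P] too, since each of them is written to [c]. The content of the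
    temporary array is left open afterwards. *)
Lemma sat_sum cs r c c1 c2 f Q
    (F := fun k => fetch (rcons cs k) f c1 * fetch (rcons cs k) f c2) :
  scoped_cell (size cs) c -> (2 < size cs)%N ->
  c_arr c != tmp_array -> c_arr c1 \notin [:: tmp_array; c_arr c] ->
  c_arr c2 \notin [:: tmp_array; c_arr c] ->
  (forall k, (k < nth 0%N cs r)%N -> P (F k)) ->
  (forall k, (k <= nth 0%N cs r)%N -> P (\sum_(i < k) F i)) ->
  (forall g, (forall a, a != tmp_array -> forall i j,
      g a i j = store cs f c (\sum_(i < nth 0%N cs r) F i) a i j) -> Q g) ->
  sat cs (sum_src r c c1 c2) f Q.
Proof.
move=> sc s2 ct c1t c2t PF PS HQ.
apply: sat_seq; apply: sat_put; first by have := PS 0%N isT; rewrite big_ord0.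
pose Inv k g := forall a, a != tmp_array -> forall i j,
   g a i j = store cs f c (\sum_(i < k) F i) a i j.
apply: sat_weak HQ; apply: (sat_for Inv).
  by move=> a at_ i j; rewrite big_ord0.
move=> k g kn inv; apply: sat_seq.
have fF c' : c_arr c' \notin [:: tmp_array; c_arr c] ->
    fetch (rcons cs k) g c' = fetch (rcons cs k) f c'.
  rewrite !inE negb_or => /andP[ct' cc].
  by apply: eq_fetch => i j; rewrite inv // store_other.
apply: (sat_arith _ _ _ _ _ _ _ (F k)); first by rewrite /= !fF.
  exact: PF.
have ssc : scoped_cell (size cs) (slot tmp_array) by rewrite /scoped_cell s2.
apply: (sat_arith _ _ _ _ _ _ _ (\sum_(i < k.+1) F i)).
- rewrite /= fetch_store big_ord_recr /=; congr (_ + _).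
  rewrite fetch_rcons // store_rcons //.
  rewrite -[LHS]/(store cs g (slot tmp_array) (F k) (c_arr c) _ _) store_other //.
  by rewrite inv // -[LHS]/(fetch cs (store cs f c _) c) fetch_store.
- exact: PS.
- move=> a at_ i j; rewrite !store_rcons // /store.
  case: ifP => // H; rewrite /= (negbTE at_) /= inv // /store.
  by rewrite H.
Qed.

Lemma sat_fill d cs r a row off o c1 c2 f Q
    (v := fun k => eval_arith o
       (fetch (rcons (rcons cs k) (nth 0%N cs off + k)%N) f c1)
       (fetch (rcons (rcons cs k) (nth 0%N cs off + k)%N) f c2)) :
  d = size cs ->
  (row < size cs)%N -> (off < size cs)%N ->
  c_arr c1 != a -> c_arr c2 != a ->
  (forall k, (k < nth 0%N cs r)%N -> P (v k)) ->
  (forall g, (forall a' i j, g a' i j =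
      if [&& a' == a, i == nth 0%N cs row, nth 0 cs off <= j
           & j < nth 0 cs off + nth 0 cs r]%N
      then v (j - nth 0 cs off)%N else f a' i j) -> Q g) ->
  sat cs (fill_src d r a row off o c1 c2) f Q.
Proof.
move=> -> lrow loff a1 a2 PV HQ.
pose Inv k g := forall a' i j, g a' i j =
      if [&& a' == a, i == nth 0%N cs row, nth 0 cs off <= j
           & j < nth 0 cs off + k]%N
      then v (j - nth 0 cs off)%N else f a' i j.
apply: sat_weak HQ; apply: (sat_for Inv).
  move=> a' i j; case: ifP => // /and4P[_ _]; rewrite addn0; lia.
move=> k g kn inv; apply: sat_let.
have -> : (nth 0 (rcons cs k) off + nth 0 (rcons cs k) (size cs) + false)%N =
  (nth 0%N cs off + k)%N by rewrite !nth_rcons loff ltnn eqxx addn0.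
have fF c' : c_arr c' != a ->
    forall cs', fetch cs' g c' = fetch cs' f c'.
  move=> ca cs'; apply: eq_fetch => i j.
  by rewrite inv (negbTE ca).
apply: (sat_arith _ _ _ _ _ _ _ (v k)); first by rewrite !fF.
  exact: PV.
move=> a' i j; rewrite /store /=.
rewrite !nth_rcons !size_rcons (ltnW _ : row < (size cs).+1)%N ?ltnS //.
rewrite lrow ltnn eqxx inv.
have [->|//] := eqVneq a' a; have [->|//] := eqVneq i _.
rewrite /=; set o' := nth 0%N cs off.
have [->|nj] := eqVneq j (o' + k)%N.
  by rewrite ifT; [congr v; lia|lia].
by congr (if _ then _ else _); lia.
Qed.

End Sat.

(** * The program *)

(* [lev e x] bounds the size of [x]; the levels of a product add up, and the
   other operations raise the level by one. *)
Record size_class {K : realFieldType} (N : nat) (lev : nat -> K -> Prop) := {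
  lev_mono : forall e e' x, (e <= e')%N -> lev e x -> lev e' x;
  lev_nat : forall k, (k <= N)%N -> lev 1%N k%:R;
  levD : forall e x y, lev e x -> lev e y -> lev e.+1 (x + y);
  levB : forall e x y, lev e x -> lev e y -> lev e.+1 (x - y);
  levM : forall e e' x y, lev e x -> lev e' y -> lev (e + e')%N (x * y);
  lev_sum : forall e k (F : nat -> K), (k <= N)%N ->
    (forall i, (i < k)%N -> lev e (F i)) -> lev e.+1 (\sum_(i < k) F i);
  lev_div : forall e x k, (0 < k <= N)%N -> lev e x -> lev e.+1 (x / k%:R) }.

(* Arrays 0 to 6 are the input, 7 is the matrix of the edge, 8 is the current
   matrix of the recursion and 9 its product with the matrix of the edge; 13
   holds the first components of [p + q]. *)
Definition acc_slot := slot 11.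
Definition one_slot := slot 12.
Definition zero_slot := slot 14.
Definition coef_slot := slot 15.
Definition step_slot := slot 16.
Definition counters (m n : nat) : seq nat :=
  [:: m; n; 0; m + n; m + n + 1; m + n + 2; m + n + 3; m + 1; n + 1]%N.

(** The branch tests whether inequality [i] of P has positive slack at [p + q]. Only entries that
    may be non-zero are written; the others keep the initial 0 of array 7. *)
Definition rowS1_src : src :=
  SSeq (sum_src 1 acc_slot (Cell 0 9 10) (Cell 13 2 10))
    (SIf acc_slot (Cell 13 2 1) (SPut (Cell 7 9 9) true)
      (SSeq (fill_src 10 1 7 9 0 Defs.Sub zero_slot (Cell 0 9 10))
        (SPut (Cell 7 9 3) true))).

Definition rowS2_src : src :=
  SLet 0 9 false
    (SIf zero_slot (Cell 13 2 9)
      (SSeq (fill_src 11 0 7 10 2 Defs.Sub zero_slot (Cell 1 11 9))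
        (SSeq (SArith (Cell 7 10 4) Defs.Sub zero_slot (Cell 2 2 9))
          (SPut (Cell 7 10 5) true)))
      (SPut (Cell 7 10 10) true)).

Definition row_direction_src : src :=
  SSeq (fill_src 9 0 7 4 2 Defs.Sub (Cell 6 2 9) (Cell 4 2 9))
    (SSeq (fill_src 9 8 7 4 0 Defs.Sub (Cell 5 2 9) (Cell 3 2 9))
      (SSeq (SArith (Cell 7 4 4) Defs.Sub (Cell 6 2 0) (Cell 4 2 0))
        (SArith (Cell 7 4 5) Defs.Sub (Cell 6 2 7) (Cell 4 2 7)))).

Definition edge_matrix_src : src :=
  SSeq (SPut one_slot true)
  (SSeq (fill_src 9 8 13 2 2 Add (Cell 3 2 9) (Cell 5 2 9))
  (SSeq (SFor 0 rowS1_src)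
  (SSeq (SFor 1 rowS2_src)
  (SSeq (fill_src 9 0 7 3 2 Mul one_slot one_slot)
  (SSeq row_direction_src
    (fill_src 9 1 7 5 0 Mul one_slot one_slot)))))).

(** [step_slot] repeats the round number as a number of the field, because counters cannot enter
    arithmetic. After the last round [coef_slot] holds the determinant. *)
Definition leverrier_src : src :=
  SSeq (SFor 6 (SPut (Cell 8 9 9) true))
    (SFor 6
      (SSeq (SArith step_slot Add step_slot one_slot)
      (SSeq (SFor 6 (SFor 6 (sum_src 6 (Cell 9 10 11) (Cell 7 10 12) (Cell 8 12 11))))
      (SSeq (sum_src 6 coef_slot (Cell 9 10 10) one_slot)
      (SSeq (SArith coef_slot Div coef_slot step_slot)
        (SFor 6 (SSeq (fill_src 11 6 8 10 2 Defs.Sub zero_slot (Cell 9 10 11))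
          (SArith (Cell 8 10 10) Add (Cell 8 10 10) coef_slot)))))))).

(** The six [SLet] extend the initial counters m, n, 0 to [counters m n]: cells are addressed
    through counters only, so every bound and offset needs one. *)
Definition orient_src : src :=
  SLet 0 1 false (SLet 3 2 true (SLet 4 2 true (SLet 5 2 true
    (SLet 0 2 true (SLet 1 2 true (SSeq edge_matrix_src leverrier_src)))))).

Definition orient_prog : cmd :=
  CSeq (compile 3 orient_src)
    (CIf (TNumber zero_slot coef_slot) (CSeq (CZero 0) (CSucc 0)) (CZero 0)).

(** * Correctness of the program relative to a size class *)

Section EdgeMatrix.
Context {K : realFieldType}.
Variables (m n : nat) (f0 : nat -> nat -> nat -> K).

Arguments f0 (_ _ _)%_N.

Definition mid_entry (k : nat) : K := f0 3 0 k + f0 5 0 k.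

(* Slacks are nonnegative on P, so that an inequality of P is tight at both [p]
   and [q] unless its slack at [p + q] is positive. *)
Definition edge_entry (i j : nat) : K :=
  if (i < m)%N then
    if \sum_(k < n) f0 0 i k * mid_entry k < mid_entry n then (i == j)%:R
    else if (j < m)%N then 0 else if (j < m + n)%N then - f0 0 i (j - m)
    else (j == m + n)%N%:R
  else if (i < m + n)%N then
    if 0 < mid_entry (i - m) then
      if (j < m)%N then - f0 1 j (i - m)
      else if j == (m + n + 1)%N then - f0 2 0 (i - m) else (j == m + n + 2)%N%:R
    else (i == j)%:R
  else if i == (m + n)%N then (j < m)%N%:R
  else if i == (m + n + 1)%N then
    if (j < m)%N then f0 6 0 j - f0 4 0 j
    else if (j <= m + n)%N then f0 5 0 (j - m) - f0 3 0 (j - m)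
    else if j == (m + n + 1)%N then f0 6 0 m - f0 4 0 m
    else if j == (m + n + 2)%N then f0 6 0 (m + 1) - f0 4 0 (m + 1) else 0
  else if i == (m + n + 2)%N then (m <= j < m + n)%N%:R
  else 0.

Variable lev : nat -> K -> Prop.
Hypothesis levP : size_class (m + n + 3) lev.
Hypothesis lev_f0 : forall a i j, (a < 7)%N -> lev 1 (f0 a i j).
Variable E : nat.
Hypothesis E4 : (4 <= E)%N.
Notation P := (lev E).

Lemma lev_bool (b : bool) : lev 1 b%:R.
Proof. by apply: (lev_nat _ _ levP); case: b; lia. Qed.

Lemma lev_mid k : lev 2 (mid_entry k).
Proof. by apply: (levD _ _ levP); exact: lev_f0. Qed.

Lemma lev_opp x : lev 1 x -> lev 2 (- x).
Proof. by move=> lx; rewrite -sub0r; apply: (levB _ _ levP) => //;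
  exact: (lev_bool false). Qed.

Lemma lev_diff a b i j i' j' : (a < 7)%N -> (b < 7)%N ->
  lev 2 (f0 a i j - f0 b i' j').
Proof. by move=> *; apply: (levB _ _ levP); exact: lev_f0. Qed.

Lemma lev1_lev2 x : lev 1 x -> lev 2 x.
Proof. by apply: (lev_mono _ _ levP). Qed.

Lemma lev_entry i j : lev 2 (edge_entry i j).
Proof.
by rewrite /edge_entry; repeat case: ifP => ?; first
  [exact: lev_diff | exact: lev_opp (lev_f0 _ _ _ _) | exact: lev1_lev2 (lev_bool _)
  | exact: lev1_lev2 (lev_bool false)].
Qed.

Lemma lev_E e x : (e <= 4)%N -> lev e x -> P x.
Proof. by move=> e4; apply: (lev_mono _ _ levP); apply: leq_trans E4. Qed.

(** Arrays 8 and 16 must still be zero: the recursion takes from them the off-diagonal entries of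
    its initial identity matrix and the start of the round count. *)
Definition base (g : nat -> nat -> nat -> K) : Prop :=
  [/\ forall a i j, (a < 7)%N -> g a i j = f0 a i j, g 12%N 0%N 0%N = 1, g 14%N 0%N
    0%N = 0,
    forall k, (k <= n)%N -> g 13%N 0%N k = mid_entry k
    & forall a i j, a \in [:: 8; 16]%N -> g a i j = 0].

Definition rows_done (r : nat) (g : nat -> nat -> nat -> K) : Prop :=
  base g /\ forall i j, g 7%N i j = if (i < r)%N then edge_entry i j else 0.

Lemma base_frame f g : base f ->
  (forall a i j, a \notin [:: 7; 10; 11]%N -> g a i j = f a i j) -> base g.
Proof.
move=> [b1 b2 b3 b4 b5] fr; split=> [a i j a7|||k kn|a i j a8]; 
  rewrite fr //.
- exact: b1.
- by rewrite !inE; lia.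
- exact: b4.
- exact: b5.
- by move: a8; rewrite !inE; lia.
Qed.

Lemma sat_rowS1 (i : nat) f : (i < m)%N -> rows_done i f ->
  sat P (rcons (counters m n) i) rowS1_src f (rows_done i.+1).
Proof.
move=> im [bf rf]; have [b1 b2 b3 b4 _] := bf.
apply: sat_seq; apply: sat_sum => //=.
- move=> k kn; rewrite /fetch /= b1 // b4 1?ltnW //.
  apply: (lev_E 3%N) => //; apply: (levM _ _ levP 1%N 2%N);
    [exact: lev_f0|exact: lev_mid].
(* The highest level reached while the matrix is built: 1 + 2 for a product, one more for the
   sum. *)
- move=> k kn; apply: (lev_E 4%N) => //.
  rewrite (eq_bigr (fun l : 'I_k => f0 0 i l * mid_entry l)); last first.
    by move=> l _; rewrite /fetch /= b1 // b4; last by have := ltn_ord l; lia.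
  apply: (lev_sum _ _ levP 3%N k (fun l => f0 0 i l * mid_entry l)); first lia.
  by move=> l _; apply: (levM _ _ levP 1%N 2%N); [exact: lev_f0|exact: lev_mid].
move=> g Hg.
rewrite (eq_bigr (fun k : 'I_n => f0 0 i k * mid_entry k)) in Hg; last first.
  by move=> k _; rewrite /fetch /= b1 // b4 // ltnW.
have bg : base g.
  apply: base_frame bf _ => a k l; rewrite !inE !negb_or => /and3P[_ a10 a11].
  by rewrite Hg // store_other.
have g7 k l : g 7%N k l = f 7%N k l by rewrite Hg // store_other.
have {b1 b2 b3 b4} [b1 b2 b3 b4 _] := bg.
apply: sat_if; rewrite {1 2}/fetch /= Hg // /store /= b4 //.
case: ifP => lt.
  apply: sat_put; first exact: (lev_E 1%N) (lev_bool true).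
  split.
    apply: base_frame bg _ => a k l; rewrite !inE !negb_or => /and3P[a7 _ _].
    by rewrite store_other.
  move=> k l; rewrite /store /= g7 rf.
  have [->|ki] := eqVneq k i;
    last by rewrite [in RHS]ltnS [in RHS]leq_eqVlt (negbTE ki).
  rewrite ltnn ltnS leqnn /edge_entry im lt eq_sym.
  by case: eqP.
apply: sat_seq; apply: sat_fill => //=.
  move=> k kn; rewrite /fetch /= b3 b1 // sub0r.
  exact: (lev_E 2%N) (lev_opp _ (lev_f0 _ _ _ _)).
move=> g' Hg'; apply: sat_put; first exact: (lev_E 1%N) (lev_bool true).
split.
  apply: base_frame bg _ => a k l; rewrite !inE !negb_or => /and3P[a7 _ _].
  by rewrite store_other // Hg' (negbTE a7).
move=> k l; rewrite /store /= Hg' /= g7 rf /edge_entry.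
have [->|ki] := eqVneq k i; last by rewrite [in RHS]ltnS [in RHS]leq_eqVlt (negbTE ki).
rewrite ltnn ltnS leqnn /edge_entry im lt /=.
have [->|lmn] := eqVneq l (m + n)%N; first by rewrite !ifF //; lia.
by rewrite /fetch /= b3 b1 // sub0r; case: (ltnP l m).
Qed.

Lemma sat_rowS2 (j : nat) f : (j < n)%N -> rows_done (m + j) f ->
  sat P (rcons (counters m n) j) rowS2_src f (rows_done (m + j).+1).
Proof.
move=> jn [bf rf]; have [b1 b2 b3 b4 _] := bf.
have im : (m + j < m)%N = false by lia.
have imn : (m + j < m + n)%N by lia.
have imj : (m + j - m)%N = j by lia.
apply: sat_let => /=; rewrite addn0.
have rowE k l : (k == m + j)%N = false -> (if (k < m + j)%N then edge_entry k l else
  0) =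
    (if (k < (m + j).+1)%N then edge_entry k l else 0).
  by move=> H; rewrite [in RHS]ltnS [in RHS]leq_eqVlt H.
apply: sat_if; rewrite {1 2}/fetch /= b3 b4; last lia.
case: ifP => lt.
  apply: sat_seq; apply: sat_fill => //=.
    move=> k km; rewrite /fetch /= b3 b1 // sub0r.
    exact: (lev_E 2%N) (lev_opp _ (lev_f0 _ _ _ _)).
  move=> g Hg.
  have bg : base g.
    apply: base_frame bf _ => a k l; rewrite !inE !negb_or => /and3P[a7 _ _].
    by rewrite Hg (negbTE a7).
  have [c1 c2 c3 c4 _] := bg.
  apply: sat_seq; apply: sat_arith; first by rewrite /fetch /= c3 c1.
    by rewrite sub0r; exact: (lev_E 2%N) (lev_opp _ (lev_f0 _ _ _ _)).
  apply: sat_put; first exact: (lev_E 1%N) (lev_bool true).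
  split.
    apply: base_frame bg _ => a k l; rewrite !inE !negb_or => /and3P[a7 _ _].
    by rewrite !store_other.
  move=> k l; rewrite /store /= Hg /= rf.
  have [->|ki] /= := eqVneq k (m + j)%N; last by apply: rowE; apply: negbTE.
  rewrite ltnn ltnS leqnn /edge_entry im imn imj lt /= add0n subn0.
  rewrite /fetch /= b3 b1 // !sub0r.
  have [->|l2] := eqVneq l (m + n + 2)%N; first by rewrite !ifF //; lia.
  by have [->|l1] := eqVneq l (m + n + 1)%N; first by rewrite ifF //; lia.
apply: sat_put; first exact: (lev_E 1%N) (lev_bool true).
split.
  apply: base_frame bf _ => a k l; rewrite !inE !negb_or => /and3P[a7 _ _].
  by rewrite store_other.
move=> k l; rewrite /store /= rf.
have [->|ki] /= := eqVneq k (m + j)%N; last by apply: rowE; apply: negbTE.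
rewrite ltnn ltnS leqnn /edge_entry im imn imj lt eq_sym.
by case: eqP.
Qed.

Lemma sat_edge_matrix f :
  (forall a i j, f a i j = if (a < 7)%N then f0 a i j else 0) ->
  sat P (counters m n) edge_matrix_src f (rows_done (m + n + 3)).
Proof.
move=> ff0.
apply: sat_seq; apply: sat_put; first exact: (lev_E 1%N) (lev_bool true).
apply: sat_seq; apply: sat_fill => //=.
  move=> k kn; rewrite /store /fetch /= !ff0 /=.
  exact: (lev_E 2%N) (lev_mid k).
move=> g Hg; apply: sat_seq; apply: sat_weak.
  apply: (sat_for _ rows_done).
    split; last by move=> i j; rewrite Hg /= /store /= ff0.
    split=> [a i j a7|||k kn|a i j a8].
    - rewrite Hg ifF /store /=; last lia.
      by rewrite ifF ?ff0 ?a7 //; lia.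
    - by rewrite Hg.
    - by rewrite Hg /store /= ff0.
    - by rewrite Hg /= ifT ?subn0 /fetch /store /= ?ff0 //; lia.
    - by move: a8; rewrite Hg !inE => /orP[] /eqP->; rewrite /store /= ff0.
  by move=> k g' km; exact: sat_rowS1.
move=> {g Hg} g rg /=; apply: sat_seq; apply: sat_weak.
  apply: (sat_for _ (fun k => rows_done (m + k))); first by rewrite addn0.
  by move=> k g' kn; rewrite addnS; exact: sat_rowS2.
have nm : (m + n < m)%N = false by lia.
have nm1 : (m + n + 1 < m)%N = false by lia.
have nm2 : (m + n + 2 < m)%N = false by lia.
have nmn1 : (m + n + 1 < m + n)%N = false by lia.
have nmn2 : (m + n + 2 < m + n)%N = false by lia.
have ne1 : (m + n + 1 == m + n)%N = false by lia.
have ne2 : (m + n + 2 == m + n)%N = false by lia.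
have ne21 : (m + n + 2 == m + n + 1)%N = false by lia.
move=> {g rg} g [bg rg] /=; have {bg} [[c1 c2 c3 c4 _] bg] := (bg, bg).
apply: sat_seq; apply: sat_fill => //=.
  by move=> k km; rewrite /fetch /= c2 mul1r; exact: (lev_E 1%N) (lev_bool true).
move=> g1 Hg1.
have r1 : rows_done (m + n + 1) g1.
  split.
    apply: base_frame bg _ => a k l; rewrite !inE !negb_or => /and3P[a7 _ _].
    by rewrite Hg1 (negbTE a7).
  move=> k l; rewrite Hg1 /= rg subn0 add0n /fetch /= c2 mul1r addn1 ltnS.
  have [->|ki] := eqVneq k (m + n)%N; last by rewrite [in RHS]leq_eqVlt (negbTE ki).
  by rewrite ltnn leqnn /edge_entry nm ltnn eqxx /=; case: ltnP.
move: {g Hg1 c1 c2 c3 c4 bg rg} g1 r1 => g [bg rg].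
have {bg} [[c1 c2 c3 c4 _] bg] := (bg, bg).
have rd : sat P (counters m n) row_direction_src g (rows_done (m + n + 2)).
  apply: sat_seq; apply: sat_fill => //=.
    by move=> k km; rewrite /fetch /= !c1 //; apply: (lev_E 2%N) => //; exact: lev_diff.
  move=> g1 Hg1; apply: sat_seq; apply: sat_fill => //=.
    move=> k km; rewrite /fetch /= !Hg1 /= !c1 //.
    by apply: (lev_E 2%N) => //; exact: lev_diff.
  move=> g2 Hg2; apply: sat_seq; apply: sat_arith.
  - by rewrite /fetch /= !Hg2 /= !Hg1 /= !c1.
  - by apply: (lev_E 2%N) => //; exact: lev_diff.
  apply: sat_arith.
  - by rewrite /fetch /store /= !Hg2 /= !Hg1 /= !c1.
  - by apply: (lev_E 2%N) => //; exact: lev_diff.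
  split.
    apply: base_frame bg _ => a k l; rewrite !inE !negb_or => /and3P[a7 _ _].
    by rewrite !store_other // Hg2 (negbTE a7) Hg1 (negbTE a7).
  move=> k l; rewrite /store /= Hg2 /= Hg1 /= rg /fetch /= !Hg1 /= !c1 //.
  rewrite add0n subn0.
  have [->|ki] /= := eqVneq k (m + n + 1)%N; last first.
    by have -> : (k < m + n + 2)%N = (k < m + n + 1)%N by lia.
  rewrite (_ : (m + n + 1 < m + n + 2)%N = true); last lia.
  rewrite /edge_entry nm1 nmn1 ne1 eqxx ltnn.
  have [lm|ml] := ltnP l m; first by rewrite !ifF //; lia.
  rewrite (_ : (l < m + (n + 1)) = (l <= m + n))%N; last lia.
  have [->|l2] := eqVneq l (m + n + 2)%N; first by rewrite ne21 ifF //=; lia.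
  by have [->|l1] /= := eqVneq l (m + n + 1)%N; first by rewrite ifF //=; lia.
apply: sat_seq; apply: sat_weak rd _ => {c1 c2 c3 c4 bg rg} {}g [bg rg].
have [c1 c2 c3 c4 _] := bg.
apply: sat_fill => //=.
  by move=> k km; rewrite /fetch /= c2 mul1r; exact: (lev_E 1%N) (lev_bool true).
move=> g1 Hg1; split.
  apply: base_frame bg _ => a k l; rewrite !inE !negb_or => /and3P[a7 _ _].
  by rewrite Hg1 (negbTE a7).
move=> k l; rewrite Hg1 /= rg /fetch /= c2 mul1r.
have [->|ki] := eqVneq k (m + n + 2)%N; last first.
  by have -> : (k < m + n + 3)%N = (k < m + n + 2)%N by lia.
rewrite ltnn (_ : (m + n + 2 < m + n + 3)%N = true); last lia.
by rewrite /edge_entry nm2 nmn2 ne2 ne21 eqxx /=; case: ifP.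
Qed.


Notation N := (m + n + 3)%N.
Hypothesis EN : (7 * N + 1 <= E)%N.

Definition edge_matrix : 'M[K]_N := \matrix_(i, j) edge_entry i j.
Notation B l := (leverrier edge_matrix l).

(** The 7 per round covers the growth of the level: two for an entry of the edge matrix, and one
    each for the row-by-column sum, the trace, the division and the difference. The last clause is
    guarded because [coef_slot] is not set before the first round. *)
Definition leverrier_inv (l : nat) (g : nat -> nat -> nat -> K) : Prop :=
  [/\ [/\ forall i j : 'I_N, g 7%N i j = edge_entry i j,
      g 12%N 0%N 0%N = 1, g 14%N 0%N 0%N = 0 & g 16%N 0%N 0%N = l%:R],
    forall i j : 'I_N, g 8%N i j = B l i j,
    forall i j : 'I_N, lev (7 * l + 1)%N (B l i j)
    & (0 < l)%N -> g 15%N 0%N 0%N = \tr (edge_matrix *m B l.-1) / l%:R].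

Lemma sat_mulmx l (f : nat -> nat -> nat -> K) :
  (l < N)%N -> (forall i j : 'I_N, f 7%N i j = edge_entry i j) ->
  (forall i j : 'I_N, f 8%N i j = B l i j) ->
  (forall i j : 'I_N, lev (7 * l + 1)%N (B l i j)) ->
  sat P (rcons (counters m n) l)
    (SFor 6 (SFor 6 (sum_src 6 (Cell 9 10 11) (Cell 7 10 12) (Cell 8 12 11)))) f
    (fun g => (forall a i j, a \notin [:: 9; 10]%N -> g a i j = f a i j) /\
       forall i j : 'I_N, g 9%N i j = (edge_matrix *m B l) i j).
Proof.
move=> lN f7 f8 levB8.
(* Entries are finished in lexicographic order, so the end of row [i] is the start of row [i.+1]. *)
pose Inv i j (g : nat -> nat -> nat -> K) :=
  (forall a i j, a \notin [:: 9; 10]%N -> g a i j = f a i j) /\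
  forall i' j' : 'I_N, ((i' < i) || (i' == i :> nat) && (j' < j))%N ->
    g 9%N i' j' = (edge_matrix *m B l) i' j'.
apply: sat_weak.
  apply: (sat_for _ (fun i => Inv i 0%N)) => [|i g iN inv];
    first by split=> // i' j'; lia.
  apply: sat_weak.
    apply: (sat_for _ (Inv i)) => [|j {inv}g jN [fr g9]]; first exact: inv.
    rewrite /= in iN jN.
    have FE k : (k < N)%N -> fetch [:: m; n; 0%N; (m + n)%N; (m + n + 1)%N;
      (m + n + 2)%N;
         N; (m + 1)%N; (n + 1)%N; l; i; j; k] g (Cell 7 10 12) *
       fetch [:: m; n; 0%N; (m + n)%N; (m + n + 1)%N; (m + n + 2)%N;
         N; (m + 1)%N; (n + 1)%N; l; i; j; k] g (Cell 8 12 11) =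
       edge_entry i k * g 8%N k j.
      move=> kN; rewrite /fetch /= fr //.
      by rewrite (f7 (Ordinal iN) (Ordinal kN)).
    have lF k : (k < N)%N -> lev (7 * l + 3)%N (edge_entry i k * g 8%N k j).
      move=> kN; rewrite fr // (f8 (Ordinal kN) (Ordinal jN)).
      rewrite (_ : (7 * l + 3 = 2 + (7 * l + 1))%N); last lia.
      by apply: (levM _ _ levP); [exact: lev_entry|exact: levB8].
    apply: sat_sum => //=.
    - move=> k kN; rewrite FE //.
      by apply: (lev_mono _ _ levP) (lF k kN); lia.
    - move=> k kN; rewrite (eq_bigr (fun k' : 'I_k => edge_entry i k' * g 8%N k' j)).
        apply: (@lev_mono _ _ _ levP (7 * l + 3).+1); first lia.
        apply: (lev_sum _ _ levP _ k (fun k' => edge_entry i k' * g 8%N k' j)) => //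
          k' k'k.
        by apply: lF; apply: leq_trans kN.
      by move=> k' _; apply: FE; apply: leq_trans kN.
    - move=> g' Hg'.
      rewrite (eq_bigr (fun k' : 'I_N => edge_entry i k' * g 8%N k' j)) in Hg';
        last first.
        by move=> k' _; apply: FE.
      split=> [a i' j'|i' j' H].
        rewrite !inE negb_or => /andP[a9 a10].
        by rewrite Hg' // store_other // fr // !inE negb_or a9.
      rewrite Hg' // /store /=.
      case: ifP => [/andP[/eqP Ei /eqP Ej]|ne]; last by apply: g9; lia.
      rewrite mxE; apply: eq_bigr => k _; rewrite mxE Ei; congr (_ * _).
      by rewrite fr // -Ej f8.
  move=> {inv}g [fr g9]; split=> // i' j' H; apply: g9.
  by have := ltn_ord j'; rewrite /=; lia.
move=> g [fr g9]; split=> // i j; apply: g9.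
by rewrite /= ltn_ord.
Qed.

Lemma sat_leverrier f : rows_done N f ->
  sat P (counters m n) leverrier_src f
    (fun g => g 14%N 0%N 0%N = 0 /\ g 15%N 0%N 0%N = \det edge_matrix).
Proof.
move=> [[b1 b2 b3 b4 b5] f7].
have N0 : (0 < N)%N by lia.
apply: sat_seq; apply: sat_weak.
  apply: (sat_for _ (fun k (g : nat -> nat -> nat -> K) =>
    (forall a i j, a != 8%N -> g a i j = f a i j) /\
    forall i j, g 8%N i j = (i == j)%:R * (i < k)%N%:R)).
    by split=> // i j; rewrite b5 // ltn0 mulr0.
  move=> k g kN [fr g8]; apply: sat_put.
    by apply: (lev_E 1%N) => //; apply: (lev_bool true).
  split=> [a i j a8|i j]; first by rewrite store_other // fr.
  rewrite /store /= g8; have [->|ik] := eqVneq i k.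
    by rewrite ltnn ltnS leqnn mulr0 mulr1 eq_sym; case: eqP.
  by rewrite ltnS [in RHS]leq_eqVlt (negbTE ik).
move=> g [fr g8].
apply: sat_weak.
  apply: (sat_for _ leverrier_inv) => [|l {g fr g8}g lN inv].
    split=> [|i j|i j|//].
    - by rewrite !fr // b2 b3 b5 //; split=> // i j; rewrite fr // f7 ltn_ord.
    - by rewrite g8 /= ltn_ord mulr1 mxE.
    - by rewrite mxE; exact: (lev_bool (i == j)).
  have [[g7 g12 g14 g16] gB lB _] := inv; rewrite /= in lN.
  set S := edge_matrix *m B l; set t := \tr S.
  have levS i j : lev (7 * l + 4)%N (S i j).
    rewrite /S mxE; apply: (@lev_mono _ _ _ levP (7 * l + 3).+1); first lia.
    (* [lev_sum] takes summands indexed by all natural numbers, hence the default 0 outside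
       ['I_N]. *)
    pose F k := edge_entry i k *
      (if insub k is Some k' then B l k' j else 0).
    rewrite (eq_bigr (fun k : 'I_N => F k)); last first.
      by move=> k _; rewrite mxE /F valK.
    apply: (lev_sum _ _ levP _ N F) => // k kN; rewrite /F insubT.
    rewrite (_ : (7 * l + 3 = 2 + (7 * l + 1))%N); last lia.
    by apply: (levM _ _ levP); [exact: lev_entry|exact: lB].
  have levT k : (k <= N)%N ->
      lev (7 * l + 5)%N (\sum_(i < k) (if insub (i : nat) is Some i' then S i' i'
        else 0)).
    move=> kN; apply: (@lev_mono _ _ _ levP (7 * l + 4).+1); first lia.
    apply: (lev_sum _ _ levP _ k (fun i => if insub i is Some i' then S i' i' else
      0)) => // i ik.
    by rewrite insubT ?(leq_trans ik) // => iN; exact: levS.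
  have tE : t = \sum_(i < N) (if insub (i : nat) is Some i' then S i' i' else 0).
    by apply: eq_bigr => i _; rewrite valK.
  have levt : lev (7 * l + 5)%N t by rewrite tE; exact: levT.
  have levc : lev (7 * l + 6)%N (t / l.+1%:R).
    apply: (@lev_mono _ _ _ levP (7 * l + 5).+1); first lia.
    exact: (lev_div _ _ levP).
  apply: sat_seq; apply: sat_arith; first by rewrite /fetch /= g16 g12.
    by rewrite -mulrSr; apply: (lev_E 1%N) => //; exact: (lev_nat _ _ levP).
  set g1 := store _ _ _ _.
  have fr1 a i j : a != 16%N -> g1 a i j = g a i j by move=> a16;
    rewrite /g1 store_other.
  have g116 : g1 16%N 0%N 0%N = l.+1%:R by rewrite /g1 /store /= -mulrSr.
  apply: sat_seq; apply: sat_weak.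
    by apply: (sat_mulmx l) => // i j; rewrite fr1.
  move=> g2 [fr2 S2]; apply: sat_seq.
  have FE k (kN : (k < N)%N) cs' : nth 0%N cs' 2 = 0%N -> nth 0%N cs' 10 = k ->
      fetch cs' g2 (Cell 9 10 10) * fetch cs' g2 one_slot =
      if insub k is Some i' then S i' i' else 0.
    move=> cs2 cs10; rewrite /fetch /= cs2 cs10 insubT (S2 (Ordinal kN) (Ordinal kN)).
    by rewrite fr2 // fr1 // g12 mulr1.
  apply: sat_sum => //=.
  - move=> k kN; rewrite (FE k) // insubT.
    by apply: (lev_mono _ _ levP) (levS _ _); lia.
  - move=> k kN; apply: (@lev_mono _ _ _ levP (7 * l + 5)); first lia.
    rewrite (eq_bigr (fun i : 'I_k => if insub (i : nat) is Some i' then S i' i' else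
      0)).
      exact: levT.
    by move=> i _; rewrite (FE i) //; apply: leq_trans kN.
  move=> g3 Hg3.
  have {}Hg3 a i j : a != 10%N -> g3 a i j = store (counters m n) g2 coef_slot t a i j.
    move=> a10; rewrite Hg3 // tE /store; congr (if _ then _ else _).
    by apply: eq_bigr => k _; rewrite (FE k).
  apply: sat_seq; apply: (sat_arith _ _ _ _ _ _ _ _ (t / l.+1%:R)).
  - by rewrite /fetch /= !Hg3 // /store /= fr2 // g116.
  - by apply: (lev_mono _ _ levP) levc; lia.
  set g4 := store _ _ _ _.
  have fr4 a i j : a \notin [:: 9; 10; 15; 16]%N -> g4 a i j = g a i j.
    rewrite !inE !negb_or => /and4P[a9 a10 a15 a16].
    by rewrite /g4 store_other // Hg3 // store_other // fr2 ?fr1 // !inE negb_or a9.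
  have g416 : g4 16%N 0%N 0%N = l.+1%:R.
    by rewrite /g4 store_other // Hg3 // store_other // fr2.
  have g415 : g4 15%N 0%N 0%N = t / l.+1%:R by rewrite /g4 /store.
  have g49 (i j : 'I_N) : g4 9%N i j = S i j.
    by rewrite /g4 store_other // Hg3 // store_other // S2.
  (* An opaque name for [B l.+1], which simplification would unfold. *)
  have [B1 B1E] : {B1 | B1 = B l.+1} by exists (B l.+1).
  have BE (i j : 'I_N) : B1 i j = (t / l.+1%:R) *+ (i == j) - S i j.
    by rewrite B1E /= -/S -/t mxE [X in _ + X]mxE [X in X + _]mxE.
  have levB1 (i j : 'I_N) : lev (7 * l.+1 + 1)%N (B1 i j).
    rewrite BE; apply: (@lev_mono _ _ _ levP (7 * l + 6).+1); first lia.
    apply: (levB _ _ levP); last by apply: (lev_mono _ _ levP) (levS i j); lia.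
    case: (i == j); rewrite ?mulr1n ?mulr0n //;
      apply: (lev_mono _ _ levP 1%N _ _ _ (lev_bool false)); lia.
  apply: sat_weak.
    apply: (sat_for _ (fun i (h : nat -> nat -> nat -> K) =>
      (forall a k j, a != 8%N -> h a k j = g4 a k j) /\
      forall k j : 'I_N, (k < i)%N -> h 8%N k j = B1 k j)) => [|i h iN [frh h8]].
      by [].
    rewrite /= in iN.
    apply: sat_seq; apply: sat_fill => //=.
      move=> k kN; rewrite /fetch /= !frh // fr4 // g14 sub0r.
      rewrite (g49 (Ordinal iN) (Ordinal kN)) -sub0r.
      apply: (@lev_mono _ _ _ levP (7 * l + 4).+1); first lia.
      apply: (levB _ _ levP) => //;
        apply: (lev_mono _ _ levP 1%N _ _ _ (lev_bool false)); lia.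
    move=> h1 Hh1.
    have row (j : 'I_N) : h1 8%N i j = - S (Ordinal iN) j.
      rewrite Hh1 eqxx /= add0n subn0 eqxx ltn_ord /fetch /= !frh // fr4 // g14 sub0r.
      by rewrite (g49 (Ordinal iN) j).
    have row' (k j : 'I_N) : k != i :> nat -> h1 8%N k j = h 8%N k j.
      by move=> ki; rewrite Hh1 (negbTE ki).
    apply: (sat_arith _ _ _ _ _ _ _ _ (B1 (Ordinal iN) (Ordinal iN))).
    - rewrite /fetch /= (row (Ordinal iN)) Hh1 /= frh // g415 addrC.
      by rewrite BE eqxx.
    - by apply: (lev_mono _ _ levP) (levB1 _ _); lia.
    split=> [a k j a8|k j]; first by rewrite store_other // Hh1 (negbTE a8) frh.
    rewrite /store /= ltnS leq_eqVlt.
    have [ki _|ki /= ki'] := eqVneq (k : nat) i; last by rewrite row' // h8.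
    have -> : k = Ordinal iN by apply: val_inj.
    rewrite row !BE eqxx -[_ == j in RHS]val_eqE /= eq_sym.
    case: eqP => [ij|_]; last by rewrite mulr0n sub0r.
    by congr (_ - S _ _); apply: val_inj.
  move=> h [frh h8]; split=> [|i j||_].
  - by split=> [i j|||]; rewrite frh // ?g416 // fr4.
  - by rewrite h8 ?B1E //= ltn_ord.
  - by rewrite -B1E; exact: levB1.
  - by rewrite frh.
move=> {g fr g8}g [[_ _ g14 _] _ _ g15]; split=> //.
rewrite g15 //=; move: edge_matrix; rewrite addn3 => M.
by rewrite (det_leverrier M).
Qed.

End EdgeMatrix.

(** * Running time and sizes of rational numbers *)

Definition edge_det {K : realFieldType} {m n : nat} (A C : 'M[K]_(m, n))
    (beta : 'rV[K]_n) (p q : 'rV[K]_(n + 1) * 'rV[K]_(m + 2)) : K :=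
  \det (edge_matrix m n (Defs.number (input A C beta p q))).

(** Both cost models are instances: they differ only in [w], [W] and [lev]. The final 3 pays for the
    closing test and at most two counter steps writing the answer. *)
Lemma orient_prog_decides {K : realFieldType} (w : K -> nat) (W : nat)
    (m n : nat) (lev : nat -> K -> Prop) (A C : 'M[K]_(m, n))
    (beta : 'rV[K]_n) (p q : 'rV[K]_(n + 1) * 'rV[K]_(m + 2)) :
  size_class (m + n + 3) lev ->
  (forall a i j, (a < 7)%N -> lev 1%N (Defs.number (input A C beta p q) a i j)) ->
  (forall x, lev (7 * (m + n + 3) + 1)%N x -> (w x <= W)%N) -> (0 < W)%N ->
  decides w orient_prog (input A C beta p q)
    (src_time (m + n)%N orient_src * W + 3) (0 < edge_det A C beta p q).
Proof.
move=> levP lev_in wW W0; pose f0 := Defs.number (input A C beta p q).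
have ag : agree [:: m; n; 0%N] f0 (input A C beta p q).
  by split=> // [[|[|[|]]]].
have f0E a i j : f0 a i j = if (a < 7)%N then f0 a i j else 0.
  by case: ltnP => // a7; rewrite /f0 /= nth_default.
have [] : sat (lev (7 * (m + n + 3) + 1)%N) [:: m; n; 0%N] orient_src f0
    (fun g => g 14%N 0%N 0%N = 0 /\ g 15%N 0%N 0%N = \det (edge_matrix m n f0)).
  do 6 apply: sat_let; set cs := rcons _ _.
  have -> : cs = counters m n by rewrite /cs /counters /= !addn0 -!addnA.
  apply: sat_seq; apply: sat_weak.
    by apply: (sat_edge_matrix _ _ f0 lev) => //; lia.
  by move=> g rg; apply: (sat_leverrier _ _ f0 lev) => //; lia.
move=> sf [d14 d15].
have [||t [st [e l [cnt num]]]] :=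
    compile_runs w W _ wW W0 orient_src [:: m; n; 0%N] f0 _ (m + n)%N _ _ ag sf.
- by [].
- by rewrite /= leq_addr leq_addl.
have z2 : counter st 2 = 0%N by exact: cnt.
have tst : eval_test (TNumber zero_slot coef_slot) st = (0 < edge_det A C beta p q).
  by rewrite /= /Defs.get /= z2 num d14 d15.
have : exists t st', [/\ exec w (if eval_test (TNumber zero_slot coef_slot) st
     then CSeq (CZero 0) (CSucc 0) else CZero 0) st t st', (t <= 2)%N
     & counter st' 0 = (0 < edge_det A C beta p q)].
  rewrite tst; case: (0 < _).
    by exists 2%N; eexists; split; [apply: (@ExecSeq _ w _ _ _ _ _ 1 1);
      constructor|by []|].
  by exists 1%N; eexists; split; [constructor|by []|].
move=> [t' [st' [e' l' c']]].
exists (t + t'.+1)%N, st'; split=> //; last lia.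
by apply: ExecSeq e _; apply: ExecIf.
Qed.

(** The reason why [src_time] is generic in the semiring: computed at ['X] it is itself the
    polynomial time bound. *)
Lemma src_time_horner (X : {poly nat}) (x : nat) (s : src) :
  (src_time X s).[x] = src_time X.[x] s.
Proof.
elim: s X => //= [c b|c o c1 c2|s1 IH1 s2 IH2|c1 c2 s1 IH1 s2 IH2|r s IH|r1 r2 b s
  IH] X.
- by rewrite hornerC.
- by rewrite hornerC.
- by rewrite hornerD IH1 IH2.
- by rewrite !hornerD IH1 IH2 hornerC.
- by rewrite hornerD hornerM hornerD IH !hornerMn !hornerC.
- by rewrite hornerD hornerD hornerM !hornerMn IH hornerD hornerD !hornerC.
Qed.

Lemma leq_src_time (x y : nat) (s : src) :
  (x <= y)%N -> (src_time x s <= src_time y s)%N.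
Proof.
elim: s x y => //= [s1 IH1 s2 IH2|c1 c2 s1 IH1 s2 IH2|r s IH|r1 r2 b s IH] x y xy.
- by apply: leq_add; [exact: IH1|exact: IH2].
- by rewrite leq_add2l; apply: leq_add; [exact: IH1|exact: IH2].
- by rewrite leq_add2r leq_mul // leq_add2r IH.
- apply: leq_add; first by rewrite leq_add2r leq_mul2r xy orbT.
  by apply: IH; rewrite leq_add2r; apply: leq_add.
Qed.

(** * Denominators and magnitudes of the rational intermediate results *)

Section RationalSizes.
Variables (N D b : nat).
Hypotheses (D_gt0 : (0 < D)%N) (N_dvd : forall k, (0 < k <= N)%N -> (k %| D)%N)
  (N_le : (N <= 2 ^ b)%N) (b_gt0 : (0 < b)%N).

(** At level [e], [D ^ e] is a common denominator and [2 ^ (b * e)] a bound. Both exponents add up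
    under products; one extra factor [D] absorbs a division by a number up to [N], one extra factor
    [2 ^ b] a sum of at most [N] terms. *)
Definition rat_lev (e : nat) (x : rat) : Prop :=
  x * D%:R ^+ e \is a Num.int /\ `|x| <= (2 ^ b)%:R ^+ e.

Lemma rat_lev_mono e e' x : (e <= e')%N -> rat_lev e x -> rat_lev e' x.
Proof.
move=> le [xi xb]; split.
  by rewrite -(subnKC le) exprD mulrA rpredM // rpredX // rpred_nat.
by apply: le_trans xb _; rewrite ler_weXn2l // ler1n expn_gt0.
Qed.

Lemma rat_lev_size_class : size_class N rat_lev.
Proof.
have B1 : (1 : rat) <= (2 ^ b)%:R by rewrite ler1n expn_gt0.
have B2 : (2 : rat) <= (2 ^ b)%:R by rewrite ler_nat -{1}(expn1 2) leq_exp2l.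
have BX e : 0 <= (2 ^ b)%:R ^+ e :> rat by rewrite exprn_ge0.
have levD e (x y : rat) : rat_lev e x -> rat_lev e y -> rat_lev e.+1 (x + y).
  move=> lx ly; split.
    rewrite mulrDl; apply: rpredD; first by have [] := rat_lev_mono _ _ _ (leqnSn e) lx.
    by have [] := rat_lev_mono _ _ _ (leqnSn e) ly.
  apply: le_trans (ler_normD _ _) _; apply: le_trans (lerD lx.2 ly.2) _.
  by rewrite exprS -mulr2n -[leLHS]mulr_natl ler_wpM2r.
split=> //.
- exact: rat_lev_mono.
- move=> k kN; split; first by rewrite rpredM // ?rpredX // rpred_nat.
  by rewrite expr1 normr_nat ler_nat (leq_trans kN).
- move=> e x y lx [yi yb]; apply: levD => //; split; last by rewrite normrN.
  by rewrite mulNr rpredN.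
- move=> e e' x y [xi xb] [yi yb]; split.
    by rewrite exprD mulrACA rpredM.
  by rewrite exprD normrM ler_pM.
- move=> e k F kN lF; split.
    rewrite mulr_suml; apply: rpred_sum => i _.
    by have [] := rat_lev_mono _ _ _ (leqnSn e) (lF _ (ltn_ord i)).
  apply: le_trans (ler_norm_sum _ _ _) _.
  apply: (@le_trans _ _ (\sum_(i < k) (2 ^ b)%:R ^+ e)).
    by apply: ler_sum => i _; have [] := lF _ (ltn_ord i).
  rewrite sumr_const card_ord -[leLHS]mulr_natl exprS ler_wpM2r // ler_nat.
  exact: leq_trans N_le.
- move=> e x k kN [xi xb]; have /andP[k0 _] := kN; split.
    have /dvdnP[c Dc] := N_dvd _ kN.
    have kne : k%:R != 0 :> rat by rewrite pnatr_eq0 -lt0n.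
    have DE : D%:R = c%:R * k%:R :> rat by rewrite Dc natrM.
    have -> : x / k%:R * D%:R ^+ e.+1 = x * D%:R ^+ e * c%:R.
      by rewrite exprS {1}DE; set y := D%:R ^+ e; field.
    by rewrite rpredM // rpred_nat.
  rewrite normrM normfV normr_nat; apply: (@le_trans _ _ `|x|).
    by rewrite ler_piMr // invf_le1 ?ler1n ?ltr0n.
  by apply: le_trans xb _; rewrite ler_weXn2l.
Qed.

Lemma bit_length_le (k e : nat) : (k <= 2 ^ e)%N -> (bit_length k <= e.+1)%N.
Proof.
move=> ke; rewrite /bit_length ltnS; have [->|k0] := posnP k.
  by rewrite trunc_log0.
rewrite -(leq_exp2l (m := 2)) //; exact: leq_trans (trunc_logP _ _) ke.
Qed.

(** The reduced denominator divides [D ^ e], and the numerator is the value times that denominator;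
    hence [d] enters twice and [b] once. *)
Lemma rat_lev_bits e d x : (D <= 2 ^ d)%N -> rat_lev e x ->
  (bit_size x <= e * (b + 2 * d) + 2)%N.
Proof.
clear N_dvd N_le b_gt0; move=> Dd [xi xb].
have dvd : (`|denq x| %| D ^ e)%N.
  have E : numq x * (D ^ e)%:Z = numq (x * D%:R ^+ e) * denq x.
    apply/eqP; rewrite -(eqr_int rat) !intrM (numqE x) (numqK xi).
    by rewrite mulrAC -pmulrn natrX.
  have : (denq x %| numq x * (D ^ e)%:Z)%Z by rewrite E dvdz_mull.
  rewrite Gauss_dvdzr; first by rewrite dvdzE.
  by rewrite coprimez_sym coprimezE coprime_num_den.
have De : (D ^ e <= 2 ^ (d * e))%N by rewrite expnM; case: (e) => // e1;
  rewrite leq_exp2r.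
have den_le : (`|denq x| <= 2 ^ (d * e))%N.
  by apply: leq_trans De; apply: dvdn_leq; rewrite ?expn_gt0 ?D_gt0.
have num_le : (`|numq x| <= 2 ^ (b * e + d * e))%N.
  rewrite -(ler_nat rat) expnD natrM expnM natrX.
  have -> : `|numq x|%N%:R = `|x| * `|denq x|%N%:R :> rat.
    by rewrite !natr_absz !intr_norm -normrM numqE.
  by rewrite ler_pM // ler_nat.
rewrite /bit_size; have := bit_length_le _ _ den_le; have := bit_length_le _ _ num_le.
lia.
Qed.

End RationalSizes.

(** The bound of [rat_lev_bits] with every parameter estimated in the input size [X]: [N] is at most
    [X + 3], the level [7 * (X + 3) + 1], [b] at most [2 * X + 4], and the exponent bounding [D] is
    [X + (X + 3) * (X + 3)]. *)
Definition number_cost : {poly nat} :=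
  (7%N%:P * ('X + 3%N%:P) + 1%N%:P) *
    (2%N%:P * 'X + 4%N%:P + 2%N%:P * ('X + ('X + 3%N%:P) * ('X + 3%N%:P))) + 2%N%:P.

Definition orient_time : {poly nat} :=
  src_time 'X orient_src * number_cost + 3%N%:P.

Lemma number_costE (x : nat) : number_cost.[x] =
  ((7 * (x + 3) + 1) * (2 * x + 4 + 2 * (x + (x + 3) * (x + 3))) + 2)%N.
Proof. by rewrite /number_cost !(hornerD, hornerM, hornerX, hornerC). Qed.

Lemma orient_timeE (x : nat) :
  orient_time.[x] = (src_time x orient_src * number_cost.[x] + 3)%N.
Proof. by rewrite /orient_time hornerD hornerM hornerC src_time_horner hornerX. Qed.

Lemma decides_le {K : realFieldType} (w : K -> nat) prog s T T' b :
  (T <= T')%N -> decides w prog s T b -> decides w prog s T' b.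
Proof. by move=> le [t [s' [e l c]]]; exists t, s'; split=> //;
  apply: leq_trans le. Qed.

Lemma orient_prog_real {K : realFieldType} (m n : nat) (A C : 'M[K]_(m, n))
    (beta : 'rV[K]_n) (p q : 'rV[K]_(n + 1) * 'rV[K]_(m + 2)) :
  decides (fun=> 1%N) orient_prog (input A C beta p q) orient_time.[(m + n)%N]
    (0 < edge_det A C beta p q).
Proof.
apply: decides_le (orient_prog_decides _ 1 _ _ (fun _ _ => True) _ _ _ _ _ _ _ _ _)
  => //.
by rewrite orient_timeE leq_add2r leq_mul2l number_costE addnS orbT.
Qed.

Definition den_prod {m n : nat} (M : 'M[rat]_(m, n)) : nat :=
  (\prod_i \prod_j `|denq (M i j)|)%N.

Lemma ltn_bit_length (k : nat) : (k < 2 ^ bit_length k)%N.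
Proof. exact: trunc_log_ltn. Qed.

Lemma den_prod_le {m n : nat} (M : 'M[rat]_(m, n)) : (den_prod M <= 2 ^ bits_mx M)%N.
Proof.
rewrite /den_prod /bits_mx expn_sum; apply: leq_prod => i _.
rewrite expn_sum; apply: leq_prod => j _.
apply: leq_trans (ltnW (ltn_bit_length _)) _.
by rewrite leq_exp2l // leq_addl.
Qed.

Lemma den_prod_gt0 {m n : nat} (M : 'M[rat]_(m, n)) : (0 < den_prod M)%N.
Proof.
apply: prodn_gt0 => i; apply: prodn_gt0 => j.
by rewrite absz_gt0 denq_neq0.
Qed.

Lemma rat_lev_array (D b m n : nat) (M : 'M[rat]_(m, n)) i j :
  (den_prod M %| D)%N -> (bits_mx M <= b)%N -> rat_lev D b 1 (array M i j).
Proof.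
move=> MD Mb.
have lev0 : rat_lev D b 1 0 by rewrite /rat_lev mul0r normr0 exprn_ge0.
rewrite /array; case: insubP => // i' _ _; case: insubP => // j' _ _.
set x := M i' j'; split.
  have xD : (`|denq x| %| D)%N.
    apply: dvdn_trans MD; rewrite /den_prod (bigD1 i') //= (bigD1 j') //=.
    by rewrite -mulnA dvdn_mulr.
  have /dvdnP[c ->] := xD.
  rewrite expr1 natrM mulrCA natr_absz normr_denq -numqE.
  by rewrite rpredM ?rpred_nat ?rpred_int.
have xb : (bit_size x <= b)%N.
  apply: leq_trans Mb; rewrite /bits_mx (bigD1 i') //= (bigD1 j') //=.
  by rewrite -addnA leq_addr.
apply: (@le_trans _ _ `|numq x|%N%:R).
  rewrite natr_absz intr_norm numqE normrM ler_peMr // -intr_norm normr_denq.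
  by rewrite ler1z; have := denq_gt0 x; case: (denq x) => // -[].
rewrite ler_nat; apply: leq_trans (ltnW (ltn_bit_length _)) _.
by rewrite leq_exp2l // (leq_trans _ xb) // leq_addr.
Qed.

Lemma orient_prog_rational (m n : nat) (A C : 'M[rat]_(m, n)) (beta : 'rV[rat]_n)
    (p q : 'rV[rat]_(n + 1) * 'rV[rat]_(m + 2)) :
  decides bit_size orient_prog (input A C beta p q)
    orient_time.[input_bits A C beta p q] (0 < edge_det A C beta p q).
Proof.
set L := input_bits A C beta p q; pose N := (m + n + 3)%N.
pose d1 := (den_prod A * den_prod C * den_prod beta * den_prod p.1 * den_prod p.2
  * den_prod q.1 * den_prod q.2)%N.
(* The factorial is divisible by all divisors occurring in the recursion, [d1] by all input
   denominators; [b] has room both for the input and for [N]. *)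
pose D := (N`! * d1)%N; pose b := (L + N)%N.
have NL : (N <= L + 3)%N by rewrite /N /L /input_bits; lia.
have D0 : (0 < D)%N by rewrite /D /d1 !muln_gt0 fact_gt0 !den_prod_gt0.
have Dd : (D <= 2 ^ (L + N * N))%N.
  rewrite addnC expnD leq_mul //.
    apply: (@leq_trans (N ^ N)).
      rewrite fact_prod -[X in (_ <= _ ^ X)%N]subn0 -prod_nat_const_nat.
      rewrite big_add1 /= big_nat [leqRHS]big_nat; apply: leq_prod => i.
      by case/andP.
    by rewrite expnM leq_exp2r; [exact/ltnW/ltn_expl|rewrite /N; lia].
  rewrite /d1 /L /input_bits !expnD -!mulnA.
  rewrite -[leqLHS]mul1n leq_mul ?expn_gt0 //.
  rewrite -[leqLHS]mul1n leq_mul ?expn_gt0 //.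
  by rewrite !leq_mul // den_prod_le.
have dvd a c : (c = d1)%N -> (a %| c)%N -> (a %| D)%N.
  by move=> -> ac; rewrite /D dvdn_mull.
apply: decides_le (orient_prog_decides _ number_cost.[L] _ _ (rat_lev D b) _ _ _ _ _
  _ _ _ _).
- rewrite orient_timeE leq_add2r leq_mul2r leq_src_time ?orbT //.
  by rewrite /L /input_bits; lia.
- apply: rat_lev_size_class => //.
  + by move=> k /andP[k0 kN]; rewrite /D dvdn_mulr // dvdn_fact // k0.
  + by rewrite /b expnD -[leqLHS]mul1n leq_mul ?expn_gt0 // ltnW // ltn_expl.
  + by rewrite /b /N; lia.
- have bit_le k : (k <= L)%N -> (k <= b)%N by rewrite /b; lia.
  case=> [|[|[|[|[|[|[|a]]]]]]] i j // _; apply: rat_lev_array;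
    try (by apply: bit_le; rewrite /L /input_bits -!addnA;
      repeat (first [exact: leqnn | exact: leq_addr | apply: leq_trans (leq_addl _
        _)]));
    by apply: (dvd _ d1) => //; rewrite /d1 -!mulnA;
      repeat (first [exact: dvdnn | exact: dvdn_mulr | apply: dvdn_mull]).
- move=> x H; have {}H : (bit_size x <= (7 * N + 1) * (b + 2 * (L + N * N)) + 2)%N.
    by apply: (rat_lev_bits _ _ D0 _ _ _ Dd H).
  apply: leq_trans H _; rewrite number_costE leq_add2r.
  apply: leq_mul; first by lia.
  by rewrite /b; have := leq_mul NL NL; lia.
- by rewrite number_costE addnS.
Qed.

(** * Faces of a polyhedron *)

(** The step is the inverse of one plus the sum of all ratios [|b i| / a i]. A vanishing [a i]
    contributes 0 by the convention on division, rightly, because [b i] vanishes with it. *)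
Lemma small_step {R : realType} {k : nat} (a b : 'I_k -> R) :
  (forall i, 0 <= a i) -> (forall i, a i = 0 -> b i = 0) ->
  exists2 e : R, 0 < e & forall i, e * `|b i| <= a i.
Proof.
move=> a0 ab; pose r i := `|b i| / a i.
have r0 i : 0 <= r i by rewrite divr_ge0.
have s0 : 0 < 1 + \sum_i r i by rewrite ltr_pwDl // sumr_ge0.
exists (1 + \sum_i r i)^-1; first by rewrite invr_gt0.
move=> i; rewrite mulrC ler_pdivrMr //.
have [/eqP ai|ai] := boolP (a i == 0); first by rewrite ai ab // normr0 mul0r.
have -> : `|b i| = a i * r i by rewrite mulrC divfK.
rewrite ler_wpM2l // (bigD1 i) //= ler_wpDl //.
by rewrite lerDl sumr_ge0.
Qed.

Section Polyhedron.
Context {R : realType} {V : vectType R} {k l : nat}.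
Variables (s : {linear V -> 'rV[R]_k}) (sigma : {linear V -> 'rV[R]_l}).
Implicit Types (I : {set 'I_k}) (v z : V) (F : set V).

(** Slacks and normalisation are arbitrary linear maps on an arbitrary space, so that P, Q' and
    their product are three instances. *)
Definition polyhedron : set V :=
  [set v | (forall i, 0 <= s v 0 i) /\ sigma v = const_mx 1].

Definition tight v : {set 'I_k} := [set i | s v 0 i == 0]%SET.

Definition restrict I v : 'rV[R]_k := \row_i (if i \in I then s v 0 i else 0).

Lemma restrict_linear I : linear (restrict I).
Proof.
move=> a v w; apply/rowP=> i; rewrite !mxE linearP !mxE.
by case: ifP => // _; rewrite mulr0 addr0.
Qed.

HB.instance Definition _ I :=
  GRing.isLinear.Build R V 'rV[R]_k _ (restrict I) (restrict_linear I).

Definition tight_space I : {vspace V} :=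
  (lker (linfun (restrict I)) :&: lker (linfun sigma))%VS.

Lemma tight_spaceP I z :
  reflect ((forall i, i \in I -> s z 0 i = 0) /\ sigma z = 0)
          (z \in tight_space I).
Proof.
rewrite memv_cap !memv_ker !lfunE /=; apply: (iffP andP) => [[/eqP r0 /eqP s0]|[r0 s0]].
  by split=> // i iI; move/rowP/(_ i): r0; rewrite !mxE iI.
split; last by rewrite s0.
by apply/eqP/rowP=> i; rewrite !mxE; case: ifP => // /r0.
Qed.

Lemma polyhedron_step v z : polyhedron v -> z \in tight_space (tight v) ->
  exists2 e : R, 0 < e & polyhedron (v + e *: z) /\ polyhedron (v - e *: z).
Proof.
move=> [v0 v1] /tight_spaceP[z0 z1].
have [i|e e0 le] := small_step (fun i => s v 0 i) (fun i => s z 0 i) v0.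
  by move=> si; apply: z0; rewrite inE si.
have step c : `|c| = e -> polyhedron (v + c *: z).
  move=> ce; split=> [i|]; last by rewrite linearD linearZ /= z1 scaler0 addr0.
  have := le i; rewrite linearD linearZ !mxE -ce -normrM ler_norml.
  by case/andP=> H _; rewrite addrC -lerBlDr sub0r.
exists e => //; split; first by apply: step; rewrite gtr0_norm.
by rewrite -scaleNr; apply: step; rewrite normrN gtr0_norm.
Qed.

(** A linear function that attains its maximum at the midpoint of a segment is constant on the
    segment. *)
Lemma face_step F v h : face polyhedron F -> F v ->
  polyhedron (v + h) -> polyhedron (v - h) -> F (v + h).
Proof.
move=> [_ [f [d [fd ->]]]] [_ fv] p1 p2; split=> //.
have := fd _ p1; have := fd _ p2; rewrite linearB linearD fv /=; lra.
Qed.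

Lemma face_sub F v : face polyhedron F -> F v -> polyhedron v.
Proof. by move=> [_ [f [d [_ ->]]]] []. Qed.

(** The supporting functional of [tight_face I]: on the polyhedron it is at most 0, with equality
    only if all slacks in [I] vanish. *)
Definition tight_sum I v : R^o := - \sum_(i in I) s v 0 i.

Lemma tight_sum_linear I : linear (tight_sum I).
Proof.
move=> a v w; rewrite /tight_sum.
rewrite [RHS](_ : _ = a * (- \sum_(i in I) s v 0 i) - \sum_(i in I) s w 0 i) //.
rewrite mulrN -opprD mulr_sumr -big_split.
by congr (- _); apply: eq_bigr => i _; rewrite linearP !mxE.
Qed.

HB.instance Definition _ I :=
  GRing.isLinear.Build R V R^o _ (tight_sum I) (tight_sum_linear I).

Definition tight_face I : set V :=
  [set v | polyhedron v /\ forall i, i \in I -> s v 0 i = 0].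

Lemma tight_face_face I v : tight_face I v -> face polyhedron (tight_face I).
Proof.
move=> Iv; split; first by exists v.
exists (tight_sum I), 0; split=> [z [z0 _]|]; first by rewrite oppr_le0 sumr_ge0.
apply/seteqP; split=> z [pz H]; split=> //.
  by rewrite /= /tight_sum big1 ?oppr0.
have z0 i : i \in I -> 0 <= s z 0 i by case: pz.
move: H => /eqP; rewrite oppr_eq0 => /eqP sz i iI.
exact: (psumr_eq0P z0 sz).
Qed.

Lemma tight_face_direction v : polyhedron v ->
  direction_space (tight_face (tight v)) (tight_space (tight v)).
Proof.
move=> pv W; split=> [/subvP sub p q [[_ p1] p0] [[_ q1] q0]|H].
  apply: sub; apply/tight_spaceP; split=> [i iI|]; last by rewrite linearB p1 q1 subrr.
  by rewrite linearB !mxE p0 ?q0 // subrr.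
apply/subvP=> z zt; have [e e0 [pe _]] := polyhedron_step v z pv zt.
have tv : tight_face (tight v) v by split=> // i; rewrite inE => /eqP.
have : (v + e *: z) - v \in W.
  apply: H => //; split=> // i iv; have /tight_spaceP[z0 _] := zt.
  by rewrite linearD linearZ !mxE z0 // mulr0 addr0; move: iv; rewrite inE => /eqP.
by rewrite addrAC subrr add0r rpredZeq gt_eqF.
Qed.

Lemma direction_space_unique (S : set V) (U U' : {vspace V}) :
  direction_space S U -> direction_space S U' -> U = U'.
Proof.
move=> d d'; apply/eqP; rewrite eqEsubv; apply/andP; split.
  by apply/d; apply/d'; exact: subvv.
by apply/d'; apply/d; exact: subvv.
Qed.

Section Edge.
Variables (F : set V) (p q : V).
Hypotheses (edgeF : edge polyhedron F) (Fp : F p) (Fq : F q) (pq : p <> q).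

Lemma edge_direction : direction_space F <[q - p]>.
Proof.
have [_ [_ [U dU dim1]]] := edgeF.
have qpU : q - p \in U by apply: (dU U).1; rewrite ?subvv.
suff -> : <[q - p]>%VS = U by [].
apply/eqP; rewrite eqEdim dim1 dim_vline -memvE qpU /=.
by rewrite subr_eq0; case: eqP => // E; case: pq.
Qed.

Lemma edge_line p' q' : F p' -> F q' -> exists t, q' - p' = t *: (q - p).
Proof.
by move=> Fp' Fq'; apply/vlineP; apply: (edge_direction _).1; rewrite ?subvv.
Qed.

Lemma tightD i : (i \in tight (p + q)) = (s p 0 i == 0) && (s q 0 i == 0).
Proof.
have [p0 _] := face_sub F p edgeF.1 Fp; have [q0 _] := face_sub F q edgeF.1 Fq.
by rewrite inE linearD mxE paddr_eq0.
Qed.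

Lemma edge_tight i r : F r -> i \in tight (p + q) -> s r 0 i = 0.
Proof.
move=> Fr; rewrite tightD => /andP[/eqP p0 /eqP q0].
have [t /eqP] := edge_line p r Fp Fr; rewrite subr_eq => /eqP->.
by rewrite linearD linearZ linearB !mxE p0 q0 subrr mulr0 addr0.
Qed.

Lemma half_mid : F (2^-1 *: (p + q)).
Proof.
have := (edgeF.1); move=> [_ [f [d [fd E]]]].
move: Fp Fq; rewrite E => -[[p0 p1] fp] [[q0 q1] fq].
split; last by rewrite linearZ linearD fp fq /= -[_ *: _]/(_ * _); field.
split=> [i|]; first by rewrite linearZ linearD !mxE mulr_ge0 ?invr_ge0 ?addr_ge0 ?ler0n.
by apply/rowP=> i; rewrite linearZ linearD p1 q1 !mxE; field.
Qed.

(** The midpoint of [p] and [q] has the tight set of [p + q]. A small step from it along the tight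
    space is possible both ways, hence stays in the edge by [face_step]. *)
Lemma edge_tight_space : tight_space (tight (p + q)) = <[q - p]>%VS.
Proof.
have pp := face_sub F p edgeF.1 Fp; have pq' := face_sub F q edgeF.1 Fq.
apply/eqP; rewrite eqEsubv; apply/andP; split; last first.
  rewrite -memvE; apply/tight_spaceP; split=> [i|]; last first.
    by rewrite linearB pp.2 pq'.2 subrr.
  by rewrite tightD => /andP[/eqP p0 /eqP q0]; rewrite linearB !mxE p0 q0 subrr.
apply/subvP=> z zt; have Fc := half_mid; set c := 2^-1 *: _ in Fc.
have tc : tight c = tight (p + q).
  by apply/setP=> i; rewrite !inE linearZ mxE mulf_eq0 invr_eq0 pnatr_eq0.
have [|e e0 [p1 p2]] := polyhedron_step c z (face_sub F c edgeF.1 Fc).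
  by rewrite tc.
have Fce := face_step F c _ edgeF.1 Fc p1 p2.
have : (c + e *: z) - c \in <[q - p]>%VS.
  by apply: (edge_direction _).1; rewrite ?subvv.
by rewrite addrAC subrr add0r rpredZeq gt_eqF.
Qed.

End Edge.

Lemma edge_points F : edge polyhedron F -> exists p q, [/\ F p, F q & p <> q].
Proof.
move=> [_ [_ [U dU dim1]]]; apply: contrapT => H.
have : (U <= 0)%VS.
  apply/dU => p q Fp Fq; rewrite memv0 subr_eq0; apply/eqP.
  by apply: contrapT => E; apply: H; exists p, q; split=> // E'; apply: E.
by rewrite subv0 => /eqP U0; rewrite U0 dimv0 in dim1.
Qed.

Lemma tight_edge F p q p' q' : edge polyhedron F -> F p -> F q -> p <> q ->
  F p' -> F q' -> p' <> q' -> tight (p + q) = tight (p' + q').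
Proof.
move=> eF Fp Fq pq Fp' Fq' pq'; apply/setP=> i; apply/idP/idP => H.
  by rewrite (tightD F) // !(edge_tight F p q eF Fp Fq pq i) ?eqxx.
by rewrite (tightD F) // !(edge_tight F p' q' eF Fp' Fq' pq' i) ?eqxx.
Qed.

Lemma vertex_tight_space v : vertex polyhedron v -> tight_space (tight v) = 0%VS.
Proof.
move=> vv; have pv := face_sub _ v vv erefl.
apply/eqP; rewrite -subv0; apply/subvP=> z zt.
have [e e0 [p1 p2]] := polyhedron_step v z pv zt.
have /eqP := face_step _ v _ vv erefl p1 p2.
rewrite eq_sym addrC -subr_eq subrr eq_sym scaler_eq0 gt_eqF //= => /eqP->.
exact: mem0v.
Qed.

(** A slack that vanishes at a proper convex combination vanishes at both ends, so [q - p] lies in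
    the tight space of the vertex, which is 0. *)
Lemma vertex_between p q v t : vertex polyhedron v -> polyhedron p ->
  polyhedron q -> 0 < t < 1 -> v = p + t *: (q - p) -> p = q.
Proof.
move=> vv [p0 p1] [q0 q1] /andP[t0 t1] E.
have : q - p \in tight_space (tight v).
  apply/tight_spaceP; split=> [i|]; last by rewrite linearB p1 q1 subrr.
  rewrite inE E linearD linearZ linearB !mxE => /eqP.
  have := p0 i; have := q0 i; move: (s p 0 i) (s q 0 i) => a b b0 a0 H.
  have Ha : (1 - t) * a = 0 by nra.
  have Hb : t * b = 0 by nra.
  have -> : a = 0 by move/eqP: Ha; rewrite mulf_eq0 subr_eq0 gt_eqF //= => /eqP.
  by move/eqP: Hb; rewrite mulf_eq0 gt_eqF //= => /eqP->; rewrite subrr.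
by rewrite vertex_tight_space // memv0 subr_eq0 => /eqP.
Qed.

End Polyhedron.

Lemma tight_face_relint {R : realType} {N k l : nat}
    (s : {linear 'rV[R]_N -> 'rV[R]_k}) (sigma : {linear 'rV[R]_N -> 'rV[R]_l})
    (v : 'rV[R]_N) :
  polyhedron s sigma v -> relint (tight_face s sigma (tight s v)) v.
Proof.
move=> pv; have [v0 v1] := pv; split.
  by split=> // i; rewrite inE => /eqP.
(* [c] bounds how fast any slack changes with respect to the maximum norm; the radius is chosen
   against the slacks that are positive at [v]. *)
pose c := \sum_i \sum_j `|lin1_mx s i j|.
have c0 : 0 <= c by apply: sumr_ge0 => i _; apply: sumr_ge0.
have [|e e0 He] := small_step (fun i => s v 0 i)
    (fun i => if s v 0 i == 0 then 0 else c + 1) v0.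
  by move=> i ->; rewrite eqxx.
exists e => // z [bz [p [U [[[_ p1] ptight] dU zpU]]]].
have UE : U = tight_space s sigma (tight s v).
  by apply: (direction_space_unique _ _ _ dU); exact: tight_face_direction.
move: zpU; rewrite UE => /tight_spaceP[zt zs].
have ztight i : i \in tight s v -> s z 0 i = 0.
  by move=> iv; rewrite -(subrK p z) linearD mxE zt // ptight // addr0.
split=> //; split=> [i|]; last by rewrite -(subrK p z) linearD zs p1 add0r.
have [iv|iv] := boolP (i \in tight s v); first by rewrite ztight.
have := He i; move: iv; rewrite inE => /negbTE-> /=.
rewrite ger0_norm ?addr_ge0 // => lei.
suff : `|s (v - z) 0 i| <= e * c.
  rewrite linearB !mxE ler_norml => /andP[_]; nra.
rewrite -mul_rV_lin1 mxE.
apply: le_trans (ler_norm_sum _ _ _) _; rewrite mulr_sumr; apply: ler_sum => j _.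
rewrite normrM; apply: ler_pM => //.
  by case: bz => _ /(_ 0 j); rewrite !mxE => /ltW.
by rewrite (bigD1 i) //= lerDl sumr_ge0.
Qed.

(** * The matrix of an edge *)

(* A solution [c] of the homogeneous system without row [i0] is, up to a factor
   that does not depend on row [i0], the vector of its cofactors. *)
Lemma det_replace_row {K : comNzRingType} {N : nat} (i0 : 'I_N) (M M' : 'M[K]_N)
    (c : 'cV[K]_N) :
  (forall i j, i != i0 -> M i j = M' i j) ->
  (forall i, i != i0 -> (M *m c) i 0 = 0) ->
  \det M * (M' *m c) i0 0 = \det M' * (M *m c) i0 0.
Proof.
move=> MM' Mc.
have cof j : cofactor M i0 j = cofactor M' i0 j.
  rewrite /cofactor; congr (_ * \det _); apply/matrixP=> i k; rewrite !mxE.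
  by apply: MM'; rewrite eq_sym neq_lift.
have E j : \det M * c j 0 = (M *m c) i0 0 * cofactor M' i0 j.
  have /colP/(_ j) := congr1 (mulmx^~ c) (mul_adj_mx M).
  rewrite mul_scalar_mx -mulmxA mxE [RHS]mxE => <-.
  rewrite (bigD1 i0) //= big1 ?addr0 => [|i ii0]; last by rewrite Mc ?mulr0.
  by rewrite mxE cof mulrC.
rewrite mxE mulr_sumr (expand_det_row M' i0) mulr_suml.
by apply: eq_bigr => j _; rewrite mulrCA E; ring.
Qed.

Lemma det_swap_rows {K : comNzRingType} {N : nat} (i1 i2 : 'I_N) (M M' : 'M[K]_N) :
  i1 != i2 -> (forall j, M' i1 j = M i2 j) -> (forall j, M' i2 j = M i1 j) ->
  (forall i j, i != i1 -> i != i2 -> M' i j = M i j) -> \det M' = - \det M.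
Proof.
move=> ne E1 E2 E.
have -> : M' = perm_mx (tperm i1 i2) *m M.
  apply/matrixP=> i j; rewrite -row_permE mxE.
  by case: tpermP => [->|->|/eqP ? /eqP ?]; rewrite ?E1 ?E2 ?E.
by rewrite det_mulmx det_perm odd_tperm ne expr1 mulN1r.
Qed.

Lemma det_ones_row {K : comNzRingType} {N : nat} (i0 : 'I_N) :
  \det (\matrix_(i, j) (if i == i0 then 1 else (i == j)%:R) : 'M[K]_N) = 1.
Proof.
rewrite (expand_det_col _ i0) (bigD1 i0) //= big1 ?addr0 => [|i ne]; last first.
  by rewrite mxE (negbTE ne) mul0r.
rewrite mxE eqxx mul1r /cofactor -signr_odd oddD addbb mul1r.
rewrite (_ : row' _ _ = 1%:M) ?det1 //; apply/matrixP=> i j.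
by rewrite !mxE eq_sym (negbTE (neq_lift _ _)) (inj_eq lift_inj).
Qed.

(** * The matrix of gradients in coordinates *)

Section PairMatrix.
Context {K : realFieldType} {m n : nat}.
Variables (A C : 'M[K]_(m, n)) (beta : 'rV[K]_n).
Notation N := (m + n + 3)%N.
Notation pt := ('rV[K]_(n + 1) * 'rV[K]_(m + 2))%type.
Implicit Types (I : {set 'I_(m + n)}) (r : 'rV[K]_N).

(* Coordinates are ordered (x, y, pi1, lambda, pi2). *)
Definition rowsP : 'M[K]_(m + n, N) :=
  row_mx (block_mx 0 (- A) 0 1%:M) (col_mx (\matrix_(i < m, c < 3) (c == 0)%:R) 0).

Definition rowsQ : 'M[K]_(m + n, N) :=
  row_mx (block_mx 1%:M 0 (- C^T) 0)
    (col_mx 0 (\matrix_(j < n, c < 3) (if c == 1 then - beta 0 j else (c == 2%:R)%:R))).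

Definition row_sumx : 'rV[K]_N := row_mx (row_mx (const_mx 1) 0) 0.
Definition row_sumy : 'rV[K]_N := row_mx (row_mx 0 (const_mx 1)) 0.

(** The row [r] stands between the two sums so that, on an end edge, the lower right block in the
    coordinates pi1, lambda, pi2 becomes triangular once the sums have been exchanged with two
    gradients. *)
Definition pair_matrix I r : 'M[K]_N :=
  col_mx (\matrix_(k < m + n, j < N) if k \in I then rowsP k j else rowsQ k j)
    (\matrix_(c < 3, j < N) if c == 0 then row_sumx 0 j else
                        if c == 1 then r 0 j else row_sumy 0 j).

Definition free_row : 'I_N := rshift (m + n) (1 : 'I_3).

Definition pt_coord (z : pt) : 'cV[K]_N :=
  col_mx (col_mx (lsubmx z.2)^T (lsubmx z.1)^T)
    (\col_(c < 3) if c == 0 then rsubmx z.1 0 0 else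
            if c == 1 then rsubmx z.2 0 0 else rsubmx z.2 0 1).

Lemma ord3P (P : 'I_3 -> Prop) : P 0 -> P 1 -> P 2%:R -> forall c, P c.
Proof.
move=> P0 P1 P2 [[|[|[|c]]] lc] //.
- by rewrite (_ : Ordinal lc = 0) //; apply: val_inj.
- by rewrite (_ : Ordinal lc = 1) //; apply: val_inj.
- by rewrite (_ : Ordinal lc = 2%:R) //; apply: val_inj.
Qed.

Lemma sum3 (F : 'I_3 -> K) : \sum_c F c = F 0 + F 1 + F 2%:R.
Proof.
rewrite !big_ord_recl big_ord0 addr0 addrA; congr (F _ + F _ + F _); exact: val_inj.
Qed.

Lemma pt_coord_linear : linear pt_coord.
Proof.
move=> a z w; apply/colP=> i.
have -> : (a *: pt_coord z + pt_coord w) i 0 = a * pt_coord z i 0 + pt_coord w i 0.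
  by rewrite [LHS]mxE [X in X + _]mxE.
case: (split_ordP i) => [i'|c] ->; last first.
  by rewrite !col_mxEd !mxE; move: c; apply: ord3P.
rewrite !col_mxEu; case: (split_ordP i') => i'' ->;
  by rewrite ?col_mxEu ?col_mxEd !mxE.
Qed.

HB.instance Definition _ :=
  GRing.isLinear.Build K pt 'cV[K]_N _ pt_coord pt_coord_linear.

Lemma pt_coord_eq0 z : pt_coord z = 0 -> z = 0.
Proof.
move=> /matrixP E; case: z E => v w E.
have Ex i : w 0 (lshift 2 i) = 0.
  by have := E (lshift _ (lshift _ i)) 0; rewrite !col_mxEu !mxE.
have Ey j : v 0 (lshift 1 j) = 0.
  by have := E (lshift _ (rshift _ j)) 0; rewrite /pt_coord col_mxEu col_mxEd !mxE.
have E0 : v 0 (rshift n 0) = 0 by have := E (rshift _ 0) 0;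
  rewrite /pt_coord col_mxEd !mxE.
have E1 : w 0 (rshift m 0) = 0 by have := E (rshift _ 1) 0;
  rewrite /pt_coord col_mxEd !mxE.
have E2 : w 0 (rshift m 1) = 0.
  by have := E (rshift _ 2%:R) 0; rewrite /pt_coord col_mxEd !mxE.
congr (_, _); apply/rowP=> i; rewrite mxE; case: (split_ordP i) => i' ->.
- exact: Ey.
- by rewrite ord1.
- exact: Ex.
- by case: i' => [[|[|?]] li] //; [rewrite -[RHS]E1|rewrite -[RHS]E2];
    congr (w _ _); apply: val_inj.
Qed.

Lemma pt_coord_surj (c : 'cV[K]_N) : exists z, pt_coord z = c.
Proof.
exists (row_mx (dsubmx (usubmx c))^T (const_mx (dsubmx c 0 0)),
        row_mx (usubmx (usubmx c))^T (row_mx (const_mx (dsubmx c 1 0)) (const_mx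
          (dsubmx c 2%:R 0)) : 'rV_(1 + 1))).
rewrite /pt_coord /= !row_mxKl !row_mxKr !trmxK vsubmxK -[RHS]vsubmxK; congr col_mx.
apply/colP; apply: ord3P; rewrite [LHS]mxE /=; first by rewrite mxE.
- have -> : (0 : 'I_2) = lshift 1 (0 : 'I_1) by exact: val_inj.
  by apply: etrans (row_mxEl _ _ _ _) _; rewrite !mxE.
- have -> : (1 : 'I_2) = rshift 1 (0 : 'I_1) by exact: val_inj.
  by apply: etrans (row_mxEr _ _ _ _) _; rewrite !mxE.
Qed.

Lemma pt_coord_dot_gt0 z : z != 0 -> 0 < ((pt_coord z)^T *m pt_coord z) 0 0.
Proof.
move=> z0; rewrite mxE lt_neqAle sumr_ge0 ?andbT => [|i _]; last first.
  by rewrite mxE -expr2 sqr_ge0.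
apply: contra z0 => /eqP E; apply/eqP/pt_coord_eq0/colP=> i.
have sq j : true -> 0 <= (pt_coord z)^T 0 j * pt_coord z j 0.
  by rewrite mxE -expr2 sqr_ge0.
have /(_ i isT) := psumr_eq0P sq (esym E); rewrite mxE => /eqP.
by rewrite mulf_eq0 orbb => /eqP ->; rewrite mxE.
Qed.

Lemma pair_matrix_other I r r' i j :
  i != free_row -> pair_matrix I r i j = pair_matrix I r' i j.
Proof.
case: (split_ordP i) => [i'|c] -> ne; first by rewrite !col_mxEu !mxE.
rewrite !col_mxEd !mxE; move: c ne; apply: ord3P => //=.
by rewrite eqxx.
Qed.

Lemma pair_matrix_free I r j : pair_matrix I r free_row j = r 0 j.
Proof. by rewrite col_mxEd mxE. Qed.

Lemma pair_matrix_free_mul I r (c : 'cV_N) :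
  (pair_matrix I r *m c) free_row 0 = (r *m c) 0 0.
Proof. by rewrite mxE [RHS]mxE; apply: eq_bigr => j _; rewrite pair_matrix_free. Qed.

Lemma det_pair_matrixZ I a r :
  \det (pair_matrix I (a *: r)) = a * \det (pair_matrix I r).
Proof.
rewrite -[RHS]addr0 -[X in _ + X](mul0r (\det (pair_matrix I r))).
apply: (determinant_multilinear (i0 := free_row)).
- have rowE r0 : row free_row (pair_matrix I r0) = r0.
    by apply/rowP=> j; rewrite mxE pair_matrix_free.
  by rewrite !rowE scale0r addr0.
- by apply/matrixP=> i j; rewrite mxE [RHS]mxE; apply: pair_matrix_other;
  rewrite eq_sym neq_lift.
- by apply/matrixP=> i j; rewrite mxE [RHS]mxE; apply: pair_matrix_other;
  rewrite eq_sym neq_lift.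
Qed.

(** Both matrices consist of the same rows: the gradients of inequality [k] in P and in Q' trade the
    places [k] and [free_row]. *)
Lemma det_pair_matrix_swap I k : k \in I ->
  \det (pair_matrix (I :\ k) (row k rowsP)) = - \det (pair_matrix I (row k rowsQ)).
Proof.
move=> kI; apply: (det_swap_rows (lshift 3 k) free_row).
- by rewrite eq_lrshift.
- by move=> j; rewrite pair_matrix_free col_mxEu [LHS]mxE !inE eqxx [RHS]mxE.
- by move=> j; rewrite pair_matrix_free col_mxEu [RHS]mxE kI [LHS]mxE.
move=> i j; case: (split_ordP i) => [i'|c] -> ne ne'; last first.
  by rewrite (pair_matrix_other _ _ (row k rowsQ)) // !col_mxEd [LHS]mxE [RHS]mxE.
rewrite !col_mxEu [LHS]mxE [RHS]mxE !inE (_ : i' != k) //.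
Qed.


(* Exchanging two pairs of rows makes the matrix block triangular. *)
Lemma det_pair_matrix_end I (i0 : 'I_m) (j0 : 'I_n) :
  (forall i, (lshift n i \in I) = (i == i0)) ->
  (forall j, (rshift m j \in I) = (j != j0)) ->
  \det (pair_matrix I (delta_mx 0 free_row)) = 1.
Proof.
move=> I1 I2; set M := pair_matrix _ _.
pose a1 : 'I_N := lshift 3 (lshift n i0); pose a2 : 'I_N := lshift 3 (rshift m j0).
pose b1 : 'I_N := rshift (m + n) (0 : 'I_3);
  pose b2 : 'I_N := rshift (m + n) (2%:R : 'I_3).
pose s := (tperm a1 b1 * tperm a2 b2)%g.
have inj3 : injective (@rshift (m + n) 3) by exact: rshift_inj.
have [n1 n2 n3] : [/\ a1 != b1, a1 != b2 & a2 != b1] by rewrite !eq_lrshift.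
have [n4 n5 n6] : [/\ a2 != b2, a1 != a2 & b1 != b2].
  by rewrite eq_lrshift (inj_eq (@lshift_inj _ _)) eq_lrshift (inj_eq inj3).
have [m1 m2 m3] : [/\ b1 != a1, b2 != a1 & b1 != a2] by rewrite ![b1 == _]eq_sym [b2
  == _]eq_sym.
have [m4 m5 m6] : [/\ b2 != a2, a2 != a1 & b2 != b1].
  by split; rewrite eq_sym.
have s_a1 : s a1 = b1 by rewrite permM tpermL tpermD.
have s_a2 : s a2 = b2 by rewrite permM [tperm a1 b1 a2]tpermD ?tpermL.
have s_b1 : s b1 = a1 by rewrite permM tpermR tpermD.
have s_b2 : s b2 = a2 by rewrite permM [tperm a1 b1 b2]tpermD ?tpermR.
have s_l c : a1 != c -> b1 != c -> a2 != c -> b2 != c -> s c = c.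
  by move=> *; rewrite permM !tpermD.
have s_x i : i != i0 -> s (lshift 3 (lshift n i)) = lshift 3 (lshift n i).
  move=> ne; apply: s_l; rewrite eq_sym ?eq_lrshift //;
    by rewrite (inj_eq (@lshift_inj _ _)) ?eq_lrshift // (inj_eq (@lshift_inj _ _)).
have s_y j : j != j0 -> s (lshift 3 (rshift m j)) = lshift 3 (rshift m j).
  move=> ne; apply: s_l; rewrite ?[b1 == _]eq_sym ?[b2 == _]eq_sym ?eq_lrshift //;
    rewrite (inj_eq (@lshift_inj _ _)) ?eq_lrshift // (inj_eq (@rshift_inj _ _)).
  by rewrite eq_sym.
have s_f : s free_row = free_row by apply: s_l; rewrite ?eq_lrshift ?(inj_eq inj3).
pose H := row_perm s M.
have -> : \det M = \det H.
  rewrite /H row_permE det_mulmx det_perm odd_permM !odd_tperm.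
  by rewrite n1 n4 expr0 mul1r.
have HE a b : H a b = M (s a) b by rewrite mxE.
have Mx i : i != i0 -> forall b, M (lshift 3 (lshift n i)) b = rowsQ (lshift n i) b.
  by move=> ne b; rewrite /M col_mxEu mxE I1 (negbTE ne).
have My j : j != j0 -> forall b, M (lshift 3 (rshift m j)) b = rowsP (rshift m j) b.
  by move=> ne b; rewrite /M col_mxEu mxE I2 ne.
have Ma1 b : M a1 b = rowsP (lshift n i0) b by rewrite /M col_mxEu mxE I1 eqxx.
have Ma2 b : M a2 b = rowsQ (rshift m j0) b by rewrite /M col_mxEu mxE I2 eqxx.
have Mb1 b : M b1 b = row_sumx 0 b by rewrite /M col_mxEd mxE.
have Mb2 b : M b2 b = row_sumy 0 b by rewrite /M col_mxEd mxE.
have Ml b : M free_row b = (delta_mx 0 free_row : 'rV[K]_N) 0 b by rewrite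
  pair_matrix_free.
have ur : ursubmx (H : 'M_(m + n + 3)) = 0.
  apply/matrixP=> a c; rewrite [LHS]mxE [LHS]mxE [LHS]mxE [RHS]mxE;
    case: (split_ordP a) => [i|j] ->.
    have [->|ne] := eqVneq i i0.
      by rewrite -/a1 s_a1 Mb1 row_mxEr mxE.
    by rewrite s_x // Mx // row_mxEr col_mxEu mxE.
  have [->|ne] := eqVneq j j0.
    by rewrite -/a2 s_a2 Mb2 row_mxEr mxE.
  by rewrite s_y // My // row_mxEr col_mxEd mxE.
pose ones k (k0 : 'I_k) := \matrix_(i < k, j < k) (if i == k0 then 1 else (i == j)%:R
  : K).
have ul : ulsubmx (H : 'M_(m + n + 3)) = block_mx (ones m i0) 0 0 (ones n j0).
  apply/matrixP=> a b; rewrite [LHS]mxE [LHS]mxE [LHS]mxE.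
  case: (split_ordP a) => [i|j] ->.
    have [->|ne] := eqVneq i i0.
      rewrite -/a1 s_a1 Mb1 row_mxEl; case: (split_ordP b) => b' ->.
        by rewrite row_mxEl block_mxEul !mxE eqxx.
      by rewrite row_mxEr block_mxEur !mxE.
    rewrite s_x // Mx // row_mxEl; case: (split_ordP b) => b' ->.
      by rewrite !block_mxEul !mxE (negbTE ne).
    by rewrite !block_mxEur !mxE.
  have [->|ne] := eqVneq j j0.
    rewrite -/a2 s_a2 Mb2 row_mxEl; case: (split_ordP b) => b' ->.
      by rewrite row_mxEl block_mxEdl !mxE.
    by rewrite row_mxEr block_mxEdr !mxE eqxx.
  rewrite s_y // My // row_mxEl; case: (split_ordP b) => b' ->.
    by rewrite !block_mxEdl !mxE.
  by rewrite !block_mxEdr !mxE (negbTE ne).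
(* The rows are those of [i0] in P, of lambda, and of [j0] in Q'; the only entry off the diagonal,
   [- beta 0 j0], lies below it. *)
have dr c c' : drsubmx (H : 'M_(m + n + 3)) c c' =
    if c == 0 then (c' == 0)%:R else if c == 1 then (c' == 1)%:R else
    if c' == 1 then - beta 0 j0 else (c' == 2%:R)%:R.
  rewrite [LHS]mxE [LHS]mxE [LHS]mxE; move: c; apply: ord3P => /=.
  - by rewrite -/b1 s_b1 Ma1 row_mxEr col_mxEu mxE.
  - by rewrite -/free_row s_f Ml mxE eqxx /= (inj_eq inj3).
  - by rewrite -/b2 s_b2 Ma2 row_mxEr col_mxEd mxE.
rewrite -[H](submxK (H : 'M_(m + n + 3))) ur det_lblock ul det_ublock !det_ones_row
  !mul1r.
rewrite det_trig; last first.
  by apply/is_trig_mxP; apply: ord3P => c'; rewrite dr; move: c'; apply: ord3P.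
by rewrite big_ord_recl big_ord_recl big_ord_recl big_ord0 !dr /= !mulr1.
Qed.

Lemma arrayE {m' n' : nat} (M : 'M[K]_(m', n')) (i : 'I_m') (j : 'I_n') :
  array M i j = M i j.
Proof. by rewrite /array !valK. Qed.

Variables (p q : pt).

(** Tightness as the program decides it: the machine only has strict comparisons, and slacks are
    nonnegative, so tight means not positive. *)
Definition tight_test (k : 'I_(m + n)) : bool :=
  match split k with
  | inl i => ~~ (\sum_j A i j * (lsubmx p.1 0 j + lsubmx q.1 0 j)
                 < rsubmx p.1 0 0 + rsubmx q.1 0 0)
  | inr j => ~~ (0 < lsubmx p.1 0 j + lsubmx q.1 0 j)
  end.

Lemma edge_matrixE : edge_matrix m n (Defs.number (input A C beta p q)) =
  pair_matrix [set k | tight_test k]%SET (pt_coord (q - p))^T.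
Proof.
have fA (i : 'I_m) (j : 'I_n) : array A i j = A i j by exact: arrayE.
have fC (i : 'I_m) (j : 'I_n) : array C i j = C i j by exact: arrayE.
have fb (j : 'I_n) : array beta 0%N j = beta 0 j by exact: (arrayE beta 0 j).
have fy (v : 'rV[K]_(n + 1)) (j : 'I_n) : array v 0%N j = lsubmx v 0 j.
  by rewrite mxE; exact: (arrayE v 0 (lshift 1 j)).
have f1 (v : 'rV[K]_(n + 1)) : array v 0%N n = rsubmx v 0 0.
  by rewrite mxE -(arrayE v 0 (rshift n 0)) /= addn0.
have fx (w : 'rV[K]_(m + 2)) (i : 'I_m) : array w 0%N i = lsubmx w 0 i.
  by rewrite mxE; exact: (arrayE w 0 (lshift 2 i)).
have f2 (w : 'rV[K]_(m + 2)) : array w 0%N m = rsubmx w 0 0.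
  by rewrite mxE -(arrayE w 0 (rshift m 0)) /= addn0.
have f3 (w : 'rV[K]_(m + 2)) : array w 0%N (m + 1)%N = rsubmx w 0 1.
  by rewrite mxE -(arrayE w 0 (rshift m 1)).
have v0 : (0 : 'I_3) = 0%N :> nat by [].
have v1 : (1 : 'I_3) = 1%N :> nat by [].
have v2 : (2%:R : 'I_3) = 2%N :> nat by [].
apply/matrixP=> a b; rewrite mxE /edge_entry /mid_entry /=.
have [im jn] : (forall i : 'I_m, (i < m)%N) /\ (forall j : 'I_n, (j < n)%N) by split.
have [nm1 nm2] : (m + n + 1 < m)%N = false /\ (m + n + 2 < m)%N = false by lia.
have [nmn1 nmn2] : (m + n + 1 < m + n)%N = false /\ (m + n + 2 < m + n)%N = false by
  lia.
have [ne1 ne2] : (m + n + 1 == m + n)%N = false /\ (m + n + 2 == m + n)%N = false by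
  lia.
have [nle1 nle2] : (m + n + 1 <= m + n)%N = false /\ (m + n + 2 <= m + n)%N = false
  by lia.
have ne12 : (m + n + 2 == m + n + 1)%N = false by lia.
have nmn : (m + n < m)%N = false by lia.
case: (split_ordP a) => [k|c] ->; last first.
  rewrite col_mxEd mxE [nat_of_ord _]/=; move: c; apply: ord3P; rewrite ?v0 ?v1 ?v2 /=.
  - rewrite addn0 eqxx (_ : (m + n < m)%N = false); last lia.
    case: (split_ordP b) => [b'|c] ->; last first.
      by rewrite row_mxEr mxE /= (_ : (m + n + c < m)%N = false) //; lia.
    rewrite row_mxEl; case: (split_ordP b') => b'' ->.
      by rewrite row_mxEl mxE.
    by rewrite row_mxEr mxE /= 1?ltnNge ?leq_addr.
  - rewrite ?nm1 ?nmn1 ?ne1 ?eqxx.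
    have -> : (pt_coord (q - p))^T 0 b = pt_coord q b 0 - pt_coord p b 0.
      by rewrite mxE linearB [LHS]mxE [X in _ + X]mxE.
    case: (split_ordP b) => [b'|c] ->.
      rewrite !col_mxEu; case: (split_ordP b') => b'' ->.
        by rewrite !col_mxEu !mxE /= ?im !fx !mxE.
      rewrite !col_mxEd !mxE /= 1?ltnNge ?leq_addr /= leq_add2l ltnW //.
      by rewrite addKn !fy !mxE.
    rewrite !col_mxEd !mxE /=; move: c; apply: ord3P; rewrite ?v0 ?v1 ?v2 /=.
    + by rewrite addn0 ?nmn ?leqnn addKn !f1 !mxE.
    + by rewrite ?nm1 ?nle1 ?eqxx !f2 !mxE.
    + by rewrite ?nm2 ?nle2 ?ne12 ?eqxx !f3 !mxE.
  - rewrite ?nm2 ?nmn2 ?ne2 ?ne12 ?eqxx.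
    case: (split_ordP b) => [b'|c] ->; last first.
      by rewrite row_mxEr mxE /= andbF.
    rewrite row_mxEl; case: (split_ordP b') => b'' ->.
      by rewrite row_mxEl mxE /= (leqNgt m) ltn_ord.
    by rewrite row_mxEr mxE /= ?leq_addr ?ltn_add2l ?jn.
rewrite col_mxEu mxE inE /tight_test.
case: (split_ordP k) => [i|j] {k} ->.
  rewrite /= ?im !f1.
  rewrite (eq_bigr (fun j => A i j * (lsubmx p.1 0 j + lsubmx q.1 0 j))); last first.
    by move=> j _; rewrite fA !fy.
  case: ifP => lt /=.
    case: (split_ordP b) => [b'|c] ->; last first.
      by rewrite row_mxEr col_mxEu mxE /= ltn_eqF // (leq_trans (im i)) // -addnA
        leq_addr.
    rewrite row_mxEl; case: (split_ordP b') => b'' ->.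
      by rewrite block_mxEul mxE.
    by rewrite block_mxEur mxE /= ltn_eqF // (leq_trans (im i)) // leq_addr.
  case: (split_ordP b) => [b'|c] ->; last first.
    rewrite row_mxEr col_mxEu mxE /= (_ : (m + n + c < m)%N = false); last lia.
    by rewrite -[X in _ == X]addn0 eqn_add2l.
  rewrite row_mxEl; case: (split_ordP b') => b'' ->.
    by rewrite block_mxEul mxE /= ?im.
  by rewrite block_mxEur mxE /= 1?ltnNge ?leq_addr /= ?ltn_add2l ?jn addKn fA.
rewrite /= addKn !fy fb.
case: ifP => lt /=.
  case: (split_ordP b) => [b'|c] ->; last first.
    rewrite row_mxEr col_mxEd mxE /= (_ : (m + n + c < m)%N = false); last lia.
    by rewrite -!addnA !eqn_add2l; move: c; apply: ord3P; rewrite ?v0 ?v1 ?v2.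
  rewrite row_mxEl; case: (split_ordP b') => b'' ->.
    by rewrite block_mxEdl !mxE /= ?im fC.
  rewrite block_mxEdr !mxE /= 1?ltnNge ?leq_addr /=.
  have [-> ->] : (m + b'' == m + n + 1)%N = false /\ (m + b'' == m + n + 2)%N = false.
    by have := jn b''; lia.
  by [].
case: (split_ordP b) => [b'|c] ->; last first.
  rewrite row_mxEr col_mxEd mxE /= (_ : (m + j == m + n + c)%N = false) //.
  by have := jn j; lia.
rewrite row_mxEl; case: (split_ordP b') => b'' ->.
  rewrite block_mxEdl mxE /= (_ : (m + j == b'')%N = false) //.
  by have := im b''; lia.
by rewrite block_mxEdr mxE /= eqn_add2l.
Qed.

End PairMatrix.

(** * The polyhedra of the game *)

Lemma mx_linear_entry {K : pzRingType} {p q : nat} (a : K) (M M' : 'M[K]_(p, q)) i j :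
  (a *: M + M') i j = a * M i j + M' i j.
Proof. by rewrite !mxE. Qed.

Section Game.
Context {R : realType} {m n : nat}.
Variables (A C : 'M[R]_(m, n)) (beta : 'rV[R]_n).
Notation N := (m + n + 3)%N.
Notation pt := ('rV[R]_(n + 1) * 'rV[R]_(m + 2))%type.
Implicit Types (u p q z : pt) (F : set pt).

Definition sum_y (v : 'rV[R]_(n + 1)) : 'rV[R]_1 := const_mx (\sum_j y_of v 0 j).
Definition sum_x (w : 'rV[R]_(m + 2)) : 'rV[R]_1 := const_mx (\sum_i x_of w 0 i).
Definition slackPQ u : 'rV[R]_((m + n) + (m + n)) :=
  row_mx (slackP A u.1) (slackQ C beta u.2).
Definition sumPQ u : 'rV[R]_(1 + 1) := row_mx (sum_y u.1) (sum_x u.2).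

Lemma slackP_lshift (v : 'rV[R]_(n + 1)) i : slackP A v 0 (lshift n i) =
  pi1_of v - \sum_j A i j * y_of v 0 j.
Proof. by rewrite row_mxEl mxE. Qed.

Lemma slackP_rshift (v : 'rV[R]_(n + 1)) j : slackP A v 0 (rshift m j) = y_of v 0 j.
Proof. by rewrite row_mxEr. Qed.

Lemma slackQ_lshift (w : 'rV[R]_(m + 2)) i :
  slackQ C beta w 0 (lshift n i) = x_of w 0 i.
Proof. by rewrite row_mxEl. Qed.

Lemma slackQ_rshift (w : 'rV[R]_(m + 2)) j : slackQ C beta w 0 (rshift m j) =
  pi2_of w - (\sum_i x_of w 0 i * C i j + beta 0 j * lambda_of w).
Proof. by rewrite row_mxEr mxE. Qed.

Lemma slackP_linear : linear (slackP A).
Proof.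
move=> a v w; apply/rowP=> k; rewrite mx_linear_entry.
case: (split_ordP k) => i ->; rewrite ?slackP_lshift ?slackP_rshift; last first.
  by rewrite !mxE.
rewrite /pi1_of !mxE mulrBr mulr_sumr addrACA -opprD -big_split; congr (_ - _).
by apply: eq_bigr => j _; rewrite !mxE mulrDr mulrCA.
Qed.

Lemma slackQ_linear : linear (slackQ C beta).
Proof.
move=> a v w; apply/rowP=> k; rewrite mx_linear_entry.
case: (split_ordP k) => i ->; rewrite ?slackQ_lshift ?slackQ_rshift.
  by rewrite !mxE.
rewrite /pi2_of /lambda_of !mxE.
rewrite (eq_bigr (fun j => a * (x_of v 0 j * C j i) + x_of w 0 j * C j i)).
  by rewrite big_split /= -mulr_sumr; ring.
by move=> j _; rewrite !mxE mulrDl mulrA.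
Qed.

Lemma sum_y_linear : linear sum_y.
Proof.
move=> a v w; apply/rowP=> k; rewrite !mxE mulr_sumr -big_split.
by apply: eq_bigr => j _; rewrite !mxE.
Qed.

Lemma sum_x_linear : linear sum_x.
Proof.
move=> a v w; apply/rowP=> k; rewrite !mxE mulr_sumr -big_split.
by apply: eq_bigr => j _; rewrite !mxE.
Qed.

HB.instance Definition _ := GRing.isLinear.Build R _ _ _ (slackP A) slackP_linear.
HB.instance Definition _ := GRing.isLinear.Build R _ _ _ (slackQ C beta) slackQ_linear.
HB.instance Definition _ := GRing.isLinear.Build R _ _ _ sum_y sum_y_linear.
HB.instance Definition _ := GRing.isLinear.Build R _ _ _ sum_x sum_x_linear.

Lemma slackPQ_linear : linear slackPQ.
Proof. by move=> a v w; rewrite /slackPQ !linearP scale_row_mx add_row_mx. Qed.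

Lemma sumPQ_linear : linear sumPQ.
Proof. by move=> a v w; rewrite /sumPQ !linearP scale_row_mx add_row_mx. Qed.

HB.instance Definition _ := GRing.isLinear.Build R _ _ _ slackPQ slackPQ_linear.
HB.instance Definition _ := GRing.isLinear.Build R _ _ _ sumPQ sumPQ_linear.

Lemma const_mx1_eq (a : R) : (const_mx a = const_mx 1 :> 'rV_1) <-> a = 1.
Proof. by split=> [/rowP/(_ 0)|->//]; rewrite !mxE. Qed.

Lemma polyPE : Defs.polyP A = polyhedron (slackP A) sum_y.
Proof. by apply/seteqP; split=> v [v0 /const_mx1_eq v1]. Qed.

Lemma polyQE : polyQ C beta = polyhedron (slackQ C beta) sum_x.
Proof. by apply/seteqP; split=> v [v0 /const_mx1_eq v1]. Qed.

Definition polyhedronPQ : set pt := polyhedron slackPQ sumPQ.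

Lemma polyPQE : Defs.polyP A `*` polyQ C beta = polyhedronPQ.
Proof.
rewrite polyPE polyQE; apply/seteqP; split=> [u [[u0 u1] [w0 w1]]|u [u0 u1]].
  split=> [k|]; last by move: u1 w1 => /= u1 w1; rewrite /= /sumPQ u1 w1 row_mx_const.
  by case: (split_ordP k) => i ->; rewrite ?row_mxEl ?row_mxEr.
have := u1; rewrite /sumPQ /= -row_mx_const => /eq_row_mx[u2 u3].
split; split=> // k.
  by have := u0 (lshift _ k); rewrite row_mxEl.
by have := u0 (rshift _ k); rewrite row_mxEr.
Qed.

Definition tight_facePQ T : set pt := tight_face slackPQ sumPQ T.
Definition tightPQ u : {set 'I_((m + n) + (m + n))} := tight slackPQ u.
Definition tight_spacePQ u : {vspace pt} := tight_space slackPQ sumPQ (tightPQ u).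

Lemma labelPZ (a : R) v : a != 0 -> labelP A (a *: v) = labelP A v.
Proof.
by move=> a0; apply/setP=> k; rewrite !inE linearZ mxE /= mulf_eq0 (negbTE a0).
Qed.

Lemma labelQZ (a : R) w : a != 0 -> labelQ C beta (a *: w) = labelQ C beta w.
Proof.
by move=> a0; apply/setP=> k; rewrite !inE linearZ mxE /= mulf_eq0 (negbTE a0).
Qed.

Lemma tightPQ_lshift u k : (lshift (m + n) k \in tightPQ u) = (k \in labelP A u.1).
Proof. by rewrite !inE row_mxEl. Qed.

Lemma tightPQ_rshift u k : (rshift (m + n) k \in tightPQ u) = (k \in labelQ C beta u.2).
Proof. by rewrite !inE row_mxEr. Qed.

Lemma mem_tight_spacePQ u z : (z \in tight_spacePQ u) =
  (z.1 \in tight_space (slackP A) sum_y (labelP A u.1)) &&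
  (z.2 \in tight_space (slackQ C beta) sum_x (labelQ C beta u.2)).
Proof.
apply/tight_spaceP/andP => [[H1 H2]|[/tight_spaceP[H1 H2] /tight_spaceP[H3 H4]]].
  have := H2; rewrite /sumPQ /= -[0](@row_mx0 _ 1 1 1) => /eq_row_mx[? ?].
  split; apply/tight_spaceP; split=> // k kI.
    by have := H1 (lshift _ k); rewrite tightPQ_lshift row_mxEl; exact.
  by have := H1 (rshift _ k); rewrite tightPQ_rshift row_mxEr; exact.
split; last by move: H2 H4 => /= H2 H4; rewrite /= /sumPQ H2 H4 row_mx0.
move=> k; case: (split_ordP k) => i ->.
  by rewrite tightPQ_lshift row_mxEl; exact: H1.
by rewrite tightPQ_rshift row_mxEr; exact: H3.
Qed.

Lemma rowsP_pt_coord z : rowsP A *m pt_coord z = (slackP A z.1)^T.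
Proof.
rewrite /rowsP /pt_coord mul_row_col mul_block_col mul_col_mx !mul0mx !add0r mul1mx.
rewrite add_col_mx addr0; apply/colP=> k; rewrite [RHS]mxE.
case: (split_ordP k) => i ->; rewrite ?col_mxEu ?col_mxEd ?slackP_lshift ?slackP_rshift.
  rewrite mxE [X in _ + X]mxE sum3 !mxE /= mul1r !mul0r !addr0 addrC /pi1_of mxE.
  rewrite -sumrN; congr (_ + _).
  by apply: eq_bigr => j _; rewrite !mxE mulNr.
by rewrite !mxE.
Qed.

Lemma rowsQ_pt_coord z : rowsQ C beta *m pt_coord z = (slackQ C beta z.2)^T.
Proof.
rewrite /rowsQ /pt_coord mul_row_col mul_block_col mul_col_mx !mul0mx !addr0 mul1mx.
rewrite add_col_mx addr0; apply/colP=> k; rewrite [RHS]mxE.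
case: (split_ordP k) => i ->; rewrite ?col_mxEu ?col_mxEd ?slackQ_lshift ?slackQ_rshift.
  by rewrite !mxE.
rewrite mxE [X in _ + X]mxE sum3 !mxE /= mul0r add0r mul1r.
rewrite /pi2_of /lambda_of mxE [in RHS]mxE opprD -sumrN.
rewrite (eq_bigr (fun j => - (x_of z.2 0 j * C j i))); first by ring.
by move=> j _; rewrite !mxE mulNr mulrC.
Qed.

Lemma pair_matrix_slack (I : {set 'I_(m + n)}) r z k :
  (pair_matrix A C beta I r *m pt_coord z) (lshift 3 k) 0 =
  if k \in I then slackP A z.1 0 k else slackQ C beta z.2 0 k.
Proof.
have /colP/(_ k) := rowsP_pt_coord z; have /colP/(_ k) := rowsQ_pt_coord z.
rewrite [LHS]mxE [RHS]mxE => EQ; rewrite [LHS]mxE [RHS]mxE => EP.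
rewrite mxE; case: ifP => kI; [rewrite -EP|rewrite -EQ];
  by apply: eq_bigr => j _; rewrite col_mxEu [X in X * _]mxE kI.
Qed.

Lemma pair_matrix_sum_x (I : {set 'I_(m + n)}) r z :
  (pair_matrix A C beta I r *m pt_coord z) (rshift (m + n) 0) 0 = \sum_i x_of z.2 0 i.
Proof.
rewrite mxE big_split_ord /= [X in _ + X]big1 ?addr0 => [|c _]; last first.
  by rewrite col_mxEd [X in X * _]mxE /= row_mxEr mxE mul0r.
rewrite big_split_ord /= [X in _ + X]big1 ?addr0 => [|j _]; last first.
  by rewrite col_mxEd [X in X * _]mxE /= row_mxEl row_mxEr mxE mul0r.
apply: eq_bigr => i _.
by rewrite col_mxEd [X in X * _]mxE /= row_mxEl row_mxEl mxE mul1r /pt_coord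
  !col_mxEu mxE.
Qed.

Lemma pair_matrix_sum_y (I : {set 'I_(m + n)}) r z :
  (pair_matrix A C beta I r *m pt_coord z) (rshift (m + n) 2%:R) 0 = \sum_j y_of z.1
    0 j.
Proof.
rewrite mxE big_split_ord /= [X in _ + X]big1 ?addr0 => [|c _]; last first.
  by rewrite col_mxEd [X in X * _]mxE /= row_mxEr mxE mul0r.
rewrite big_split_ord /= [X in X + _]big1 ?add0r => [|i _]; last first.
  by rewrite col_mxEd [X in X * _]mxE /= row_mxEl row_mxEl mxE mul0r.
apply: eq_bigr => j _.
by rewrite col_mxEd [X in X * _]mxE /= row_mxEl row_mxEr mxE mul1r /pt_coord
  !col_mxEu col_mxEd mxE.
Qed.

(* The direction space of an edge with the tight sets [I] of P and [~: I] of Q'. *)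
Definition in_kernel (I : {set 'I_(m + n)}) z : Prop :=
  [/\ forall k, k \in I -> slackP A z.1 0 k = 0,
      forall k, k \notin I -> slackQ C beta z.2 0 k = 0,
      \sum_j y_of z.1 0 j = 0 & \sum_i x_of z.2 0 i = 0].

Lemma in_kernelP (I : {set 'I_(m + n)}) r z : in_kernel I z <->
  forall i, i != free_row -> (pair_matrix A C beta I r *m pt_coord z) i 0 = 0.
Proof.
split=> [[H1 H2 H3 H4] i|H].
  case: (split_ordP i) => [k|c] -> ne.
    by rewrite pair_matrix_slack; case: ifPn => [/H1|/H2].
  move: c ne; apply: ord3P => [_|/eqP//|_]; first by rewrite pair_matrix_sum_x.
  by rewrite pair_matrix_sum_y.
split=> [k kI|k kI||].
- by have := H (lshift 3 k); rewrite pair_matrix_slack kI; apply; rewrite eq_lrshift.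
- by have := H (lshift 3 k); rewrite pair_matrix_slack (negbTE kI); apply;
  rewrite eq_lrshift.
- by rewrite -(pair_matrix_sum_y I r); apply: H; rewrite (inj_eq (@rshift_inj _ _)).
- by rewrite -(pair_matrix_sum_x I r); apply: H; rewrite (inj_eq (@rshift_inj _ _)).
Qed.

Lemma det_cross (I : {set 'I_(m + n)}) r r' z : in_kernel I z ->
  \det (pair_matrix A C beta I r) * (r' *m pt_coord z) 0 0 =
  \det (pair_matrix A C beta I r') * (r *m pt_coord z) 0 0.
Proof.
move=> zk; rewrite -!(pair_matrix_free_mul A C beta I).
apply: det_replace_row; last exact/in_kernelP.
by move=> i j ne; apply: pair_matrix_other.
Qed.

Definition kernel_det (I : {set 'I_(m + n)}) z : R :=
  \det (pair_matrix A C beta I (pt_coord z)^T).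

(** [det_cross] for the rows [z] and [r]: both are positive on [z], the first one as a sum of
    squares. The direction row may thus be traded for any more convenient row. *)
Lemma sg_kernel_det (I : {set 'I_(m + n)}) r z : in_kernel I z ->
  0 < (r *m pt_coord z) 0 0 ->
  Num.sg (kernel_det I z) = Num.sg (\det (pair_matrix A C beta I r)).
Proof.
move=> zk rz; have z0 : z != 0.
  by apply: contraTneq rz => ->; rewrite linear0 mulmx0 mxE ltxx.
have := congr1 Num.sg (det_cross I (pt_coord z)^T r z zk).
by rewrite !sgrM (gtr0_sg rz) (gtr0_sg (pt_coord_dot_gt0 _ z0)) !mulr1.
Qed.

Lemma kernel_detZ (I : {set 'I_(m + n)}) a z :
  kernel_det I (a *: z) = a * kernel_det I z.
Proof. by rewrite /kernel_det !linearZ det_pair_matrixZ. Qed.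

End Game.

(** A line that is a product of subspaces is parallel to one of the factors: if the first component
    of [d] is non-zero, a point [(0, z)] of the line can only be 0. *)
Lemma dim_prod_line {K : fieldType} {V W : vectType K} (U1 : {vspace V})
    (U2 : {vspace W}) (d : V * W) : d != 0 ->
  (forall z : V * W, (z \in <[d]>%VS) = (z.1 \in U1) && (z.2 \in U2)) ->
  (\dim U1 + \dim U2 = 1)%N.
Proof.
case: d => d1 d2 d0 E.
have /andP[/= u1 u2] : (d1 \in U1) && (d2 \in U2) by rewrite -(E (d1, d2)) memv_line.
have line1 z : z \in U1 -> exists t, z = t *: d1 /\ 0 = t *: d2.
  move=> zU; have : (z, 0) \in <[(d1, d2)]>%VS by rewrite E /= zU mem0v.
  by move/vlineP => [t [-> ->]]; exists t.
have line2 z : z \in U2 -> exists t, 0 = t *: d1 /\ z = t *: d2.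
  move=> zU; have : (0, z) \in <[(d1, d2)]>%VS by rewrite E /= zU mem0v.
  by move/vlineP => [t [-> ->]]; exists t.
have [d10|d10] := eqVneq d1 0.
  have d20 : d2 != 0 by apply: contra d0 => /eqP->; rewrite d10.
  have -> : U1 = 0%VS.
    apply/eqP; rewrite -subv0; apply/subvP=> z /line1[t [-> _]].
    by rewrite d10 scaler0 mem0v.
  have -> : U2 = <[d2]>%VS.
    apply/eqP; rewrite eqEsubv -memvE u2 andbT; apply/subvP=> z /line2[t [_ ->]].
    by rewrite memvZ ?memv_line.
  by rewrite dimv0 dim_vline d20.
have -> : U2 = 0%VS.
  apply/eqP; rewrite -subv0; apply/subvP=> z /line2[t [/esym/eqP t0 ->]].
  by move: t0; rewrite scaler_eq0 (negbTE d10) orbF => /eqP->; rewrite scale0r mem0v.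
have -> : U1 = <[d1]>%VS.
  apply/eqP; rewrite eqEsubv -memvE u1 andbT; apply/subvP=> z /line1[t [-> _]].
  by rewrite memvZ ?memv_line.
by rewrite dimv0 dim_vline d10.
Qed.

(** * Edges under non-degeneracy *)

Section Nondegenerate.
Context {R : realType} {m n : nat}.
Variables (A C : 'M[R]_(m, n)) (beta : 'rV[R]_n).
Hypotheses (ndP : nondegenerateP A) (ndQ : nondegenerateQ C beta).
Notation N := (m + n + 3)%N.
Notation pt := ('rV[R]_(n + 1) * 'rV[R]_(m + 2))%type.
Notation tsP v := (tight_space (slackP A) sum_y (labelP A v)).
Notation tsQ w := (tight_space (slackQ C beta) sum_x (labelQ C beta w)).
Notation tsPQ := (tight_spacePQ A C beta).
Notation PQ := (polyhedronPQ A C beta).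
Implicit Types (u p q z : pt) (F : set pt).

(** Each point is relatively interior to the face cut out by its own tight inequalities, and the
    direction space of that face is the tight space. *)
Lemma card_labelP v : Defs.polyP A v -> (#|labelP A v| + \dim (tsP v) = n)%N.
Proof.
rewrite polyPE => pv.
have fv : tight_face (slackP A) sum_y (labelP A v) v by split=> // k;
  rewrite inE => /eqP.
apply: (ndP (tight_face (slackP A) sum_y (labelP A v))).
- by rewrite polyPE; exact: tight_face_face fv.
- by split; [exists v|exists (tsP v) => //; exact: tight_face_direction].
- exact: tight_face_relint.
Qed.

Lemma card_labelQ w : polyQ C beta w -> (#|labelQ C beta w| + \dim (tsQ w) = m + 1)%N.
Proof.
rewrite polyQE => pw.
have fw : tight_face (slackQ C beta) sum_x (labelQ C beta w) w.
  by split=> // k; rewrite inE => /eqP.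
apply: (ndQ (tight_face (slackQ C beta) sum_x (labelQ C beta w))).
- by rewrite polyQE; exact: tight_face_face fw.
- by split; [exists w|exists (tsQ w) => //; exact: tight_face_direction].
- exact: tight_face_relint.
Qed.

Lemma edgeN_edge F : edgeN A C beta F -> edge PQ F.
Proof. by case; rewrite polyPQE. Qed.

Lemma edgeN_sub F u : edgeN A C beta F -> F u -> PQ u.
Proof. by move=> /edgeN_edge[fF _] Fu; exact: (face_sub _ _ _ _ fF). Qed.

Lemma vertexN_vertex u : vertexN A C beta u -> vertex PQ u.
Proof. by case; rewrite polyPQE. Qed.

Section Edge.
Variables (F : set pt) (p q : pt).
Hypotheses (eF : edgeN A C beta F) (Fp : F p) (Fq : F q) (pq : p <> q).

Lemma tsPQ_edge : tsPQ (p + q) = <[q - p]>%VS.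
Proof. exact: (edge_tight_space _ _ _ _ _ (edgeN_edge _ eF)). Qed.

(** At the midpoint the tight spaces in P and Q' have total dimension 1, so non-degeneracy leaves
    [m + n] labels counted with multiplicity; since they cover all [m + n] numbers, they do so
    without overlap. *)
Lemma edge_labels :
  labelQ C beta (p.2 + q.2) = (~: labelP A (p.1 + q.1))%SET.
Proof.
pose c := 2^-1 *: (p + q).
have Fc : F c by exact: (half_mid _ _ _ _ _ (edgeN_edge _ eF)).
have h0 : (2^-1 : R) != 0 by rewrite invr_eq0 pnatr_eq0.
have lP : labelP A (p.1 + q.1) = labelP A c.1 by rewrite -(labelPZ A _ _ h0).
have lQ : labelQ C beta (p.2 + q.2) = labelQ C beta c.2 by rewrite -(labelQZ C beta _
  _ h0).
clearbody c.
have [Pc Qc] : (Defs.polyP A `*` polyQ C beta) c by rewrite polyPQE;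
  exact: edgeN_sub Fc.
have [_ _ cover] := eF.2 _ Fc.
have dims : (\dim (tsP c.1) + \dim (tsQ c.2) = 1)%N.
  apply: (dim_prod_line _ _ (q - p)).
    by rewrite subr_eq0; apply/eqP => E; apply: pq.
  by move=> z; rewrite -lP -lQ -tsPQ_edge mem_tight_spacePQ.
rewrite lP lQ; have dP := card_labelP _ Pc; have dQ := card_labelQ _ Qc.
have card : (#|labelP A c.1 :&: labelQ C beta c.2| = 0)%N.
  have := cardsUI (labelP A c.1) (labelQ C beta c.2).
  rewrite cover cardsT card_ord => E; have := congr2 addn dP dQ.
  by rewrite addnACA dims -E; clear; move: (#|_|) => x; lia.
apply/setP=> k; rewrite !inE.
have /setP/(_ k) := cover; have /setP/(_ k) := cards0_eq card; rewrite !inE.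
by case: (_ == 0) => //=; case: (_ == 0).
Qed.

Lemma edge_kernel z : in_kernel A C beta (labelP A (p.1 + q.1)) z <->
  exists t, z = t *: (q - p).
Proof.
have -> : in_kernel A C beta (labelP A (p.1 + q.1)) z <-> z \in tsPQ (p + q).
  rewrite mem_tight_spacePQ;
    split=> [[H1 H2 H3 H4]|/andP[/tight_spaceP[H1 H3] /tight_spaceP[H2 H4]]].
    apply/andP; split; apply/tight_spaceP; split=> //.
    - by rewrite /= /sum_y H3; apply/rowP=> i; rewrite !mxE.
    - by move=> k; rewrite edge_labels inE; exact: H2.
    - by rewrite /= /sum_x H4; apply/rowP=> i; rewrite !mxE.
  split=> // [k kI||].
  - by apply: H2; rewrite edge_labels inE.
  - by have /rowP/(_ 0) := H3; rewrite !mxE.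
  - by have /rowP/(_ 0) := H4; rewrite !mxE.
by rewrite tsPQ_edge; split=> /vlineP.
Qed.

Lemma edge_slack u k : F u -> (if k \in labelP A (p.1 + q.1)
  then slackP A u.1 0 k else slackQ C beta u.2 0 k) = 0.
Proof.
move=> Fu; have et := edge_tight _ _ _ _ _ (edgeN_edge _ eF) Fp Fq pq.
case: ifP => kI.
  by have := et (lshift _ k) u Fu; rewrite tightPQ_lshift row_mxEl; apply.
have := et (rshift _ k) u Fu; rewrite tightPQ_rshift row_mxEr; apply.
by rewrite edge_labels inE kI.
Qed.

End Edge.

Definition orient_det p q : R := kernel_det A C beta (labelP A (p.1 + q.1)) (q - p).

Lemma edge_det_orient p q : PQ p -> PQ q -> edge_det A C beta p q = orient_det p q.
Proof.
rewrite -polyPQE => -[[/= p0 _] _] [[/= q0 _] _].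
rewrite /edge_det edge_matrixE /orient_det /kernel_det.
congr (\det (pair_matrix _ _ _ _ _)); apply/setP=> k; rewrite !inE /tight_test.
have -> : slackP A (p.1 + q.1) 0 k = slackP A p.1 0 k + slackP A q.1 0 k.
  by rewrite linearD mxE.
rewrite [RHS]eq_le (addr_ge0 (p0 k) (q0 k)) andbT.
case: (split_ordP k) => i ->; rewrite ?slackP_lshift ?slackP_rshift -leNgt //.
rewrite addrACA -opprD subr_le0 -big_split; congr (_ <= _).
by apply: eq_bigr => j _; rewrite mulrDr.
Qed.

Section EdgeOrientation.
Variables (F : set pt) (p q : pt).
Hypotheses (eF : edgeN A C beta F) (Fp : F p) (Fq : F q) (pq : p <> q).

(** A vector in the kernel is a multiple of [q - p] because of the other rows, and orthogonal to
    [q - p] because of the free row. *)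
Lemma orient_det_neq0 : orient_det p q != 0.
Proof.
set I := labelP A (p.1 + q.1); rewrite /orient_det -/I /kernel_det -det_tr.
apply/det0P => -[v v0 vM].
have [z zv] := pt_coord_surj v^T.
have zM : pair_matrix A C beta I (pt_coord (q - p))^T *m pt_coord z = 0.
  by rewrite zv -[pair_matrix _ _ _ _ _]trmxK -trmx_mul vM trmx0.
have /(edge_kernel _ _ _ eF Fp Fq pq)[t zt] : in_kernel A C beta I z.
  by apply/(in_kernelP A C beta I (pt_coord (q - p))^T) => i _; rewrite zM mxE.
have : ((pt_coord (q - p))^T *m pt_coord z) 0 0 = 0.
  apply: etrans (esym (pair_matrix_free_mul A C beta I _ _)) _.
  by have /colP/(_ free_row) := zM; rewrite [RHS]mxE.
rewrite zt linearZ -scalemxAr mxE => /eqP.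
have qp0 : q - p != 0 by rewrite subr_eq0; apply/eqP => E; apply: pq.
rewrite mulf_eq0 (gt_eqF (pt_coord_dot_gt0 _ qp0)) orbF => /eqP t0.
move: v0; rewrite -[v]trmxK -zv zt t0 scale0r linear0 trmx0.
by rewrite eqxx.
Qed.

Lemma orient_det_edge p' q' t : F p' -> F q' -> p' <> q' ->
  q' - p' = t *: (q - p) -> orient_det p' q' = t * orient_det p q.
Proof.
move=> Fp' Fq' pq' E; rewrite /orient_det E kernel_detZ;
  congr (_ * kernel_det _ _ _ _ _).
have T : tightPQ A C beta (p + q) = tightPQ A C beta (p' + q').
  exact: (tight_edge _ _ _ _ _ _ _ (edgeN_edge _ eF)).
by apply/setP=> k; rewrite -(tightPQ_lshift A C beta (p' + q')) -T tightPQ_lshift.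
Qed.

End EdgeOrientation.

End Nondegenerate.

(** * Orientation of the edges *)

Lemma path_turn {T : eqType} (a e : rel T) :
  (forall u v w, a u v -> a v w -> u != w -> e u v -> e v w) ->
  forall s u v, path a u (v :: s) -> uniq (u :: v :: s) -> e u v ->
  path e u (v :: s).
Proof.
move=> turn; elim=> [|w s IH] u v /=; first by move=> _ _ ->.
case/and3P=> auv avw ps /andP[uvw uniq_s] euv; rewrite euv /=.
apply: IH => //=; first by rewrite avw.
by apply: turn euv => //; apply: contra uvw => /eqP->; rewrite !inE eqxx orbT.
Qed.

Lemma cycle_turn {T : eqType} (a e : rel T) :
  (forall u v w, a u v -> a v w -> u != w -> e u v -> e v w) ->
  forall s u v w, cycle a (u :: v :: w :: s) -> uniq (u :: v :: w :: s) ->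
  e u v -> cycle e (u :: v :: w :: s).
Proof.
move=> turn s u v w cyc uniq_s euv.
have [auv avw] : a u v /\ a v w by move: cyc => /= /and3P[-> ->].
have uw : u != w.
  by move: uniq_s => /= /andP[]; rewrite !inE !negb_or => /and3P[].
(* The walk starts at [v], so that the closing vertex [u] occurs only once in it. *)
rewrite /= euv /=; apply: (path_turn a e turn (rcons s u) v w).
- by move: cyc => /= /and3P[_ -> ->].
- by rewrite -!rcons_cons rcons_uniq; move: uniq_s => /= /andP[-> ->].
- exact: turn euv.
Qed.

Section Orientation.
Context {R : realType} {m n : nat}.
Variables (A C : 'M[R]_(m, n)) (beta : 'rV[R]_n).
Hypotheses (ndP : nondegenerateP A) (ndQ : nondegenerateQ C beta).
Notation N := (m + n + 3)%N.
Notation pt := ('rV[R]_(n + 1) * 'rV[R]_(m + 2))%type.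
Notation PQ := (polyhedronPQ A C beta).
Notation od := (orient_det A C beta).
Implicit Types (u p q z : pt) (F : set pt).

Lemma orient_detC p q : od p q = - od q p.
Proof. by rewrite /orient_det addrC -opprB -scaleN1r kernel_detZ mulN1r. Qed.

Lemma vertexN_card u : vertexN A C beta u ->
  #|labelP A u.1| = n /\ #|labelQ C beta u.2| = (m + 1)%N.
Proof.
move=> vu; have [_ [/= Pu Qu _]] := vu.
have ts0 : tight_spacePQ A C beta u = 0%VS.
  exact: (vertex_tight_space _ _ _ (vertexN_vertex _ _ _ _ vu)).
have := card_labelP _ ndP _ Pu; have := card_labelQ _ _ ndQ _ Qu.
have -> : tight_space (slackP A) sum_y (labelP A u.1) = 0%VS.
  apply/eqP; rewrite -subv0; apply/subvP=> z zt.
  have : (z, 0) \in tight_spacePQ A C beta u by rewrite mem_tight_spacePQ zt mem0v.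
  by rewrite ts0 !memv0 => /eqP[->].
have -> : tight_space (slackQ C beta) sum_x (labelQ C beta u.2) = 0%VS.
  apply/eqP; rewrite -subv0; apply/subvP=> z zt.
  have : (0, z) \in tight_spacePQ A C beta u by rewrite mem_tight_spacePQ zt mem0v.
  by rewrite ts0 !memv0 => /eqP[->].
by rewrite !dimv0 !addn0.
Qed.

Lemma vertexN_duplicate_label u : vertexN A C beta u ->
  exists k, labelP A u.1 :&: labelQ C beta u.2 = [set k]%SET.
Proof.
move=> vu; have [cP cQ] := vertexN_card _ vu; have [_ [_ _ cover]] := vu.
apply/cards1P; have := cardsUI (labelP A u.1) (labelQ C beta u.2).
rewrite cover cardsT card_ord cP cQ => E; apply/eqP; lia.
Qed.

(** Labels can only be lost when passing from [u] to the edge. They overlap in [k] alone at [u] and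
    form a partition on the edge, so exactly one copy of [k] is lost. *)
Lemma vertex_edge_relaxes u p F k : vertexN A C beta u -> edgeN A C beta F ->
  F u -> F p -> p <> u -> labelP A u.1 :&: labelQ C beta u.2 = [set k]%SET ->
  [/\ in_kernel A C beta (labelP A (u.1 + p.1)) (p - u),
      slackP A u.1 0 k = 0, slackQ C beta u.2 0 k = 0 &
      (labelP A (u.1 + p.1) = labelP A u.1 /\ 0 < slackQ C beta p.2 0 k) \/
      (labelP A (u.1 + p.1) = labelP A u.1 :\ k /\ 0 < slackP A p.1 0 k)%SET].
Proof.
move=> vu eF Fu Fp pu dbl; have up : u <> p by move=> E; apply: pu.
have [_ [_ _ cover]] := vu; set I := labelP A (u.1 + p.1).
have kk : k \in labelP A u.1 :&: labelQ C beta u.2 by rewrite dbl inE.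
have [kP kQ] : slackP A u.1 0 k = 0 /\ slackQ C beta u.2 0 k = 0.
  by move: kk; rewrite !inE => /andP[/eqP-> /eqP->].
have Ik l : l \in I -> l \in labelP A u.1.
  move=> lI; have := edge_slack _ _ _ ndP ndQ _ _ _ eF Fu Fp up u l Fu.
  by rewrite -/I lI inE => ->.
have Jk l : l \notin I -> l \in labelQ C beta u.2.
  move=> lI; have := edge_slack _ _ _ ndP ndQ _ _ _ eF Fu Fp up u l Fu.
  by rewrite -/I (negbTE lI) inE => ->.
have IE l : l != k -> (l \in I) = (l \in labelP A u.1).
  move=> lk; apply/idP/idP; first exact: Ik.
  move=> lP; apply: contraNT lk => /Jk lQ.
  by have := finset.in_setI l (labelP A u.1) (labelQ C beta u.2);
    rewrite dbl lP lQ inE => ->.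
have pPQ := edgeN_sub _ _ _ _ _ eF Fp.
have [[p0 _] [q0 _]] : (Defs.polyP A `*` polyQ C beta) p by rewrite polyPQE.
have labels := edge_labels _ _ _ ndP ndQ _ _ _ eF Fu Fp up.
split=> //.
  by apply/(edge_kernel _ _ _ ndP ndQ _ _ _ eF Fu Fp up); exists 1; rewrite scale1r.
have [kI|kI] := boolP (k \in I); [left|right]; split.
- apply/setP=> l; have [->|lk] := eqVneq l k; last exact: IE.
  by rewrite kI (Ik _ kI).
- rewrite lt_neqAle q0 andbT eq_sym; apply/negP => /eqP pk.
  have : k \in labelQ C beta (u.2 + p.2) by rewrite inE linearD mxE kQ pk addr0.
  by rewrite labels inE kI.
- apply/setP=> l; have [->|lk] := eqVneq l k;
  first by rewrite (negbTE kI) finset.in_setD1 eqxx.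
  by rewrite finset.in_setD1 lk IE.
- rewrite lt_neqAle p0 andbT eq_sym; apply/negP => /eqP pk.
  by move/negP: kI; apply; rewrite /I inE linearD mxE kP pk addr0.
Qed.

Lemma row_rowsP k z : (row k (rowsP A) *m pt_coord z) 0 0 = slackP A z.1 0 k.
Proof. by rewrite -row_mul rowsP_pt_coord !mxE. Qed.

Lemma row_rowsQ k z : (row k (rowsQ C beta) *m pt_coord z) 0 0 = slackQ C beta z.2 0 k.
Proof. by rewrite -row_mul rowsQ_pt_coord !mxE. Qed.

Lemma orient_turn u p q F F' : vertexN A C beta u -> edgeN A C beta F ->
  edgeN A C beta F' -> F u -> F p -> F' u -> F' q -> p <> u -> q <> u ->
  (forall t, 0 < t -> q - u <> t *: (p - u)) -> (0 < od p u) = (0 < od u q).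
Proof.
move=> vu eF eF' Fu Fp F'u F'q pu qu ray.
have [k dbl] := vertexN_duplicate_label _ vu.
have [kp kP kQ tp] := vertex_edge_relaxes _ _ _ _ vu eF Fu Fp pu dbl.
have [kq _ _ tq] := vertex_edge_relaxes _ _ _ _ vu eF' F'u F'q qu dbl.
have up : u <> p by move=> E; apply: pu.
have sP z : slackP A (z - u).1 0 k = slackP A z.1 0 k.
  by rewrite -[(z - u).1]/(z.1 - u.1) linearB mxE [X in _ + X]mxE kP subr0.
have sQ z : slackQ C beta (z - u).2 0 k = slackQ C beta z.2 0 k.
  by rewrite -[(z - u).2]/(z.2 - u.2) linearB mxE [X in _ + X]mxE kQ subr0.
have kdbl : k \in labelP A u.1 by rewrite inE kP.
suff : Num.sg (od u p) = - Num.sg (od u q).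
  by move=> E; rewrite (orient_detC p) oppr_gt0 -sgr_lt0 E oppr_lt0 sgr_gt0.
have sg1 z I : in_kernel A C beta I (z - u) -> 0 < slackQ C beta z.2 0 k ->
    Num.sg (kernel_det A C beta I (z - u)) =
    Num.sg (\det (pair_matrix A C beta I (row k (rowsQ C beta)))).
  by move=> kz zk; apply: sg_kernel_det => //; rewrite row_rowsQ sQ.
have sg2 z I : in_kernel A C beta I (z - u) -> 0 < slackP A z.1 0 k ->
    Num.sg (kernel_det A C beta I (z - u)) =
    Num.sg (\det (pair_matrix A C beta I (row k (rowsP A)))).
  by move=> kz zk; apply: sg_kernel_det => //; rewrite row_rowsP sP.
rewrite /orient_det.
case: tp tq => [[Ep lp]|[Ep lp]] [[Eq lq]|[Eq lq]].
(* Both edges relax [k] in Q': the kernels agree, and since both slacks are positive [q] lies on the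
   ray from [u] through [p], which [ray] forbids. *)
- move: kq; rewrite Eq -Ep => /(edge_kernel _ _ _ ndP ndQ _ _ _ eF Fu Fp up)[t E].
  case: (ray t) => //; have := sQ q; rewrite E -[(t *: _).2]/(t *: (p - u).2).
  rewrite linearZ mxE /= sQ => E'; move: lq; rewrite -E'.
  by rewrite pmulr_lgt0.
(* One edge relaxes [k] in Q', the other in P. Each direction row is replaced by the gradient of the
   inequality relaxed; the matrices then differ by an exchange of rows. *)
- apply: (etrans (sg1 p _ kp lp)); rewrite Ep.
  apply/esym/(etrans (congr1 -%R (sg2 q _ kq lq))); rewrite Eq.
  by rewrite det_pair_matrix_swap // sgrN opprK.
- apply: (etrans (sg2 p _ kp lp)); rewrite Ep.
  apply/esym/(etrans (congr1 -%R (sg1 q _ kq lq))); rewrite Eq.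
  by rewrite det_pair_matrix_swap // sgrN.
- move: kq; rewrite Eq -Ep => /(edge_kernel _ _ _ ndP ndQ _ _ _ eF Fu Fp up)[t E].
  case: (ray t) => //; have := sP q; rewrite E -[(t *: _).1]/(t *: (p - u).1).
  rewrite linearZ mxE /= sP => E'; move: lq; rewrite -E'.
  by rewrite pmulr_lgt0.
Qed.

Lemma vertexPQ_between p q v t : vertex PQ v -> PQ p -> PQ q -> 0 < t < 1 ->
  v = p + t *: (q - p) -> p = q.
Proof. exact: vertex_between. Qed.

(** Of two distinct points on a ray from [u], the nearer one is interior to the segment from [u] to
    the farther one. *)
Lemma vertexN_ray u p q t : PQ u -> vertexN A C beta p -> vertexN A C beta q ->
  p <> u -> q <> u -> p <> q -> 0 < t -> q - u <> t *: (p - u).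
Proof.
move=> PQu vp vq pu qu pq t0 E.
have [[PQp vp'] [PQq vq']] : (PQ p /\ vertex PQ p) /\ (PQ q /\ vertex PQ q).
  have := vertexN_vertex _ _ _ _ vp; have := vertexN_vertex _ _ _ _ vq.
  by move=> vq' vp'; split; split=> //;
    [exact: (face_sub _ _ _ _ vp' erefl)|exact: (face_sub _ _ _ _ vq' erefl)].
have [t1|t1|t1] := ltgtP t 1.
- have H := vertexPQ_between u p q t vq' PQu PQp.
  by case: pu; rewrite H ?t0 // -E addrC subrK.
- have H := vertexPQ_between u q p t^-1 vp' PQu PQq.
  case: qu; rewrite H ?invr_gt0 ?t0 ?invf_lt1 //.
  by rewrite E scalerA mulVf ?gt_eqF // scale1r addrC subrK.
- by apply: pq; apply: (addIr (- u)); rewrite E t1 scale1r.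
Qed.

Lemma adjN_sym u v : adjN A C beta u v -> adjN A C beta v u.
Proof.
move=> /asboolP[vu vv uv [F [eF Fu Fv]]]; apply/asboolP; split=> //.
  by move=> E; apply: uv.
by exists F.
Qed.

Lemma adjN_turn u v w : adjN A C beta u v -> adjN A C beta v w -> u != w ->
  (0 < od u v) = (0 < od v w).
Proof.
move=> /asboolP[vu vv uv [F [eF Fu Fv]]] /asboolP[_ vw vw' [F' [eF' F'v F'w]]] uw.
apply: (orient_turn v u w F F') => //; first by move=> E; apply: vw'.
move=> t; apply: vertexN_ray => //.
- exact: edgeN_sub Fv.
- by move=> E; apply: vw'.
- exact/eqP.
Qed.

(** Which pair is chosen is immaterial, since on one edge [od] scales with the difference of the
    points. The default 0 is never taken on an edge of N. *)
Definition orient F : pt :=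
  xget 0 [set d | exists p q, [/\ F p, F q, 0 < od p q & d = q - p]].

Lemma orientP F : edgeN A C beta F ->
  exists p q, [/\ F p, F q, 0 < od p q & orient F = q - p].
Proof.
move=> eF; apply: (xgetPex 0 (P := [set d | exists p q, [/\ F p, F q, 0 < od p q & d
  = q - p]])).
have [p [q [Fp Fq pq]]] := edge_points _ _ _ (edgeN_edge _ _ _ _ eF).
have := orient_det_neq0 _ _ _ ndP ndQ _ _ _ eF Fp Fq pq.
rewrite neq_lt => /orP[lt|gt]; last by exists (q - p), p, q.
by exists (p - q), q, p; split=> //; rewrite orient_detC oppr_gt0.
Qed.

Lemma od_neq p q : 0 < od p q -> p <> q.
Proof.
move=> gt E; move: gt; rewrite E /orient_det subrr.
by have := kernel_detZ A C beta (labelP A (q.1 + q.1)) 0 0;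
  rewrite scaler0 mul0r => ->; rewrite ltxx.
Qed.

Lemma orient_orientation F : edgeN A C beta F -> orientation_of F (orient F).
Proof.
move=> eF; have [p [q [Fp Fq gt ->]]] := orientP _ eF; split; last by exists p, q.
by rewrite subr_eq0; apply/eqP => E; apply: (od_neq _ _ gt).
Qed.

Lemma leads_orient F p q : edgeN A C beta F -> F p -> F q -> p <> q ->
  leads (orient F) p q <-> 0 < od p q.
Proof.
move=> eF Fp Fq pq; have [p0 [q0 [Fp0 Fq0 gt ->]]] := orientP _ eF.
have pq0 := od_neq _ _ gt.
have [t E] := edge_line _ _ _ _ _ (edgeN_edge _ _ _ _ eF) Fp0 Fq0 pq0 p q Fp Fq.
rewrite (orient_det_edge _ _ _ _ _ _ eF Fp0 Fq0 pq0 p q t) // pmulr_lgt0 //.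
split=> [[s s0 E']|t0]; last by exists t.
suff -> : t = s by [].
have d0 : q0 - p0 != 0 by rewrite subr_eq0; apply/eqP => E0; apply: pq0.
apply/eqP; rewrite -subr_eq0; have /eqP : (t - s) *: (q0 - p0) = 0.
  by rewrite scalerBl -E -E' subrr.
by rewrite scaler_eq0 (negbTE d0) orbF.
Qed.

Lemma arcN_od u v : adjN A C beta u v -> arcN A C beta orient u v = (0 < od u v).
Proof.
move=> /asboolP[_ _ uv [F [eF Fu Fv]]]; apply/asboolP/idP.
  by move=> [F' [eF' F'u F'v]] /leads_orient; apply.
by move=> gt; exists F; split=> //; apply/leads_orient.
Qed.

Lemma arcN_turn u v w : adjN A C beta u v -> adjN A C beta v w -> u != w ->
  arcN A C beta orient u v -> arcN A C beta orient v w.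
Proof.
move=> uv vw uw uv_arc; apply: etrans (arcN_od v w vw) _.
exact: etrans (esym (adjN_turn u v w uv vw uw)) (etrans (esym (arcN_od u v uv)) uv_arc).
Qed.

Lemma arcN_turn_rev u v w : adjN A C beta u v -> adjN A C beta v w -> u != w ->
  arcN A C beta orient v u -> arcN A C beta orient w v.
Proof.
move=> uv vw uw vu_arc; have vu := adjN_sym _ _ uv; have wv := adjN_sym _ _ vw.
rewrite eq_sym in uw; apply: etrans (arcN_od w v wv) _.
exact: etrans (adjN_turn w v u wv vu uw) (etrans (esym (arcN_od v u vu)) vu_arc).
Qed.

Lemma cycle_directed c : cycleN A C beta c -> directed_cycleN A C beta orient c.
Proof.
case: c => [|u [|v [|w s]]] [] // _ /andP[cyc uniq_c].
have auv : adjN A C beta u v by move: cyc => /= /andP[].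
have [_ _ uv [F [eF Fu Fv]]] := asboolW auv.
have := orient_det_neq0 _ _ _ ndP ndQ _ _ _ eF Fu Fv uv.
rewrite neq_lt => /orP[lt|gt]; [right|left].
  rewrite rev_cycle; apply: (cycle_turn _ _ arcN_turn_rev) => //.
  apply: etrans (arcN_od v u (adjN_sym _ _ auv)) _.
  by rewrite orient_detC oppr_gt0.
apply: (cycle_turn _ _ arcN_turn) => //.
exact: etrans (arcN_od u v auv) gt.
Qed.

End Orientation.

(** * The two unbounded edges of the path *)

Section EndEdge.
Context {R : realType} {m n : nat}.
Variables (A C : 'M[R]_(m, n)) (beta : 'rV[R]_n).
Hypotheses (ndP : nondegenerateP A) (ndQ : nondegenerateQ C beta).
Notation N := (m + n + 3)%N.
Notation pt := ('rV[R]_(n + 1) * 'rV[R]_(m + 2))%type.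
Notation PQ := (polyhedronPQ A C beta).
Notation od := (orient_det A C beta).
Variables (i0 : 'I_m) (j0 : 'I_n) (sgn : R).
Hypotheses (sgn2 : sgn * sgn = 1)
  (beta_extreme : forall j, sgn * (beta 0 j0 - beta 0 j) <= 0).
Let v0 := unit_point j0 (A i0 j0).
Let F0 : set pt := [set v0] `*` EE A C beta v0.
Variable u : pt.
Hypotheses (vu : vertexN A C beta u) (F0u : F0 u).
Implicit Types p q z : pt.

(** Lambda grows by 1 and pi2 just enough to keep inequality [j0] of Q' tight. The sign [sgn] treats
    both ends at once: it is 1 where beta is minimal, and the edge extends from [u] against this
    direction, and -1 where beta is maximal, and the edge extends along it. *)
Definition ray_dir : pt := (0, row_mx 0 (\row_(c < 2) if c == 0 then 1 else beta 0 j0)).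
Notation I0 := (labelP A v0).

Lemma slackP_unit_y j : slackP A v0 0 (rshift m j) = (j == j0)%:R.
Proof. by rewrite slackP_rshift /y_of row_mxKl mxE eqxx. Qed.

Lemma slackP_unit_i0 : slackP A v0 0 (lshift n i0) = 0.
Proof.
rewrite slackP_lshift /pi1_of /y_of row_mxKr row_mxKl mxE (bigD1 j0) //= big1.
  by rewrite !mxE !eqxx mulr1 addr0 subrr.
by move=> j ne; rewrite mxE eqxx (negbTE ne) mulr0.
Qed.

(** The [n] inequalities listed are tight, and a vertex of N has exactly [n] labels in P. *)
Lemma labelP_unit : I0 = (lshift n i0 |: (@rshift m n @: [set~ j0]))%SET.
Proof.
apply/esym/eqP; rewrite eqEcard; apply/andP; split.
  apply/fintype.subsetP => k; rewrite !inE => /orP[/eqP->|/imsetP[j]].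
    by rewrite slackP_unit_i0.
  by rewrite !inE => ne ->; rewrite slackP_unit_y (negbTE ne).
have [cP _] := vertexN_card _ _ _ ndP ndQ _ vu.
have -> : #|I0| = n by case: F0u => <- _.
rewrite cardsU1 card_imset; last exact: rshift_inj.
rewrite cardsC1 card_ord; case: imsetP => [[j _ /eqP]|_]; first by rewrite eq_lrshift.
by have := ltn_ord j0; rewrite /=; lia.
Qed.

Lemma mem_unit_l i : (lshift n i \in I0) = (i == i0).
Proof.
rewrite labelP_unit in_setU1 (inj_eq (@lshift_inj _ _)).
by case: imsetP => [[j _ /eqP]|_]; [rewrite eq_lrshift|rewrite orbF].
Qed.

Lemma mem_unit_r j : (rshift m j \in I0) = (j != j0).
Proof. by rewrite inE slackP_unit_y; case: (j == j0); rewrite ?oner_eq0 ?eqxx. Qed.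

Lemma slackQ_ray_l i : slackQ C beta ray_dir.2 0 (lshift n i) = 0.
Proof. by rewrite slackQ_lshift /x_of row_mxKl mxE. Qed.

Lemma slackQ_ray_r j : slackQ C beta ray_dir.2 0 (rshift m j) = beta 0 j0 - beta 0 j.
Proof.
rewrite slackQ_rshift /pi2_of /lambda_of /x_of row_mxKr row_mxKl !mxE /= big1.
  by rewrite add0r mulr1.
by move=> i _; rewrite mxE mul0r.
Qed.

Lemma slackQ_ray k : k \notin I0 -> slackQ C beta ray_dir.2 0 k = 0.
Proof.
case: (split_ordP k) => i ->; first by rewrite slackQ_ray_l.
by rewrite mem_unit_r negbK slackQ_ray_r => /eqP->; rewrite subrr.
Qed.

Lemma sum_x_ray : \sum_i x_of ray_dir.2 0 i = 0.
Proof. by rewrite big1 // => i _; rewrite /x_of row_mxKl mxE. Qed.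

Lemma ray_kernel : in_kernel A C beta I0 ray_dir.
Proof.
split=> [k _|k|| ]; [by rewrite linear0 mxE|exact: slackQ_ray| |exact: sum_x_ray].
by rewrite big1 // => j _; rewrite !mxE.
Qed.

Lemma ray_lambda z : ((delta_mx 0 free_row : 'rV[R]_N) *m pt_coord z) 0 0 = lambda_of
  z.2.
Proof. by rewrite -rowE mxE /pt_coord col_mxEd mxE. Qed.

Lemma ray_lambda1 : lambda_of ray_dir.2 = 1.
Proof. by rewrite /lambda_of row_mxKr mxE. Qed.

Lemma ray_dir_neq0 : ray_dir != 0.
Proof.
apply/negP => /eqP E; have := ray_lambda1; rewrite E /lambda_of !mxE => /eqP.
by rewrite eq_sym oner_eq0.
Qed.

Lemma det_ray : \det (pair_matrix A C beta I0 (delta_mx 0 free_row)) = 1.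
Proof. exact: det_pair_matrix_end mem_unit_l mem_unit_r. Qed.

Lemma ray_det_gt0 : 0 < kernel_det A C beta I0 ray_dir.
Proof.
rewrite -sgr_gt0 (sg_kernel_det _ _ _ _ (delta_mx 0 free_row) _ ray_kernel).
  by rewrite det_ray sgr1.
by rewrite ray_lambda ray_lambda1.
Qed.

(** With the unit row of lambda the matrix is invertible, and it annihilates the difference of the
    two sides. *)
Lemma ray_kernel_line z : in_kernel A C beta I0 z -> z = lambda_of z.2 *: ray_dir.
Proof.
move=> [z1 z2 z3 z4]; have [r1 r2 r3 r4] := ray_kernel.
apply/eqP; rewrite -subr_eq0; apply/eqP; set y := z - _.
have yE : pt_coord y = pt_coord z - lambda_of z.2 *: pt_coord ray_dir.
  by rewrite linearB linearZ.
have yk : pair_matrix A C beta I0 (delta_mx 0 free_row) *m pt_coord y = 0.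
  apply/colP=> i; rewrite [RHS]mxE.
  have [->|ne] := eqVneq i free_row.
    apply: etrans (pair_matrix_free_mul A C beta _ _ _) _.
    rewrite ray_lambda /lambda_of mxE [in LHS]mxE -/(lambda_of z.2).
    by have := ray_lambda1; rewrite /lambda_of !mxE => ->; rewrite mulr1 subrr.
  have kz : in_kernel A C beta I0 z by [].
  have Ez := (in_kernelP _ _ _ _ (delta_mx 0 free_row) z).1 kz i ne.
  have Er := (in_kernelP _ _ _ _ (delta_mx 0 free_row) ray_dir).1 ray_kernel i ne.
  rewrite yE mulmxBr -scalemxAr mxE [X in _ + X]mxE [X in - X]mxE.
  by rewrite Ez Er mulr0 subr0.
apply: pt_coord_eq0.
have unit : pair_matrix A C beta I0 (delta_mx 0 free_row) \in unitmx.
  by rewrite unitmxE det_ray unitr1.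
by rewrite -[pt_coord y](mulKmx unit) yk mulmx0.
Qed.

Definition tight_end p : Prop :=
  (forall k, k \in I0 -> slackP A p.1 0 k = 0) /\
  (forall k, k \notin I0 -> slackQ C beta p.2 0 k = 0).

Lemma end_edge_sub p : F0 p -> PQ p.
Proof. by move=> [/= p1 [Pp Qp _]]; rewrite -polyPQE; split=> //=; rewrite p1. Qed.

Lemma end_edge_tight p : F0 p -> tight_end p.
Proof.
move=> [/= p1 [_ _ cover]]; split=> k kI.
  by move: kI; rewrite p1 inE => /eqP.
have /setP/(_ k) := cover; rewrite [RHS]inE finset.in_setU (negbTE kI) /=.
by rewrite inE => /eqP.
Qed.

Lemma tight_end_kernel p q : PQ p -> PQ q -> tight_end p -> tight_end q ->
  in_kernel A C beta I0 (q - p).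
Proof.
rewrite -polyPQE => -[[_ p1] [_ p2]] [[_ q1] [_ q2]] [tP tQ] [tP' tQ'].
split=> [k kI|k kI||].
- rewrite -[(q - p).1]/(q.1 - p.1) linearB mxE [X in _ + X]mxE.
  by rewrite tP // tP' // subrr.
- rewrite -[(q - p).2]/(q.2 - p.2) linearB mxE [X in _ + X]mxE.
  by rewrite tQ // tQ' // subrr.
- rewrite -[RHS](subrr 1) -{1}q1 -p1 -sumrB; apply: eq_bigr => i _.
  by rewrite !mxE.
- rewrite -[RHS](subrr 1) -{1}q2 -p2 -sumrB; apply: eq_bigr => i _.
  by rewrite !mxE.
Qed.

Lemma tight_end_line p q : PQ p -> PQ q -> tight_end p -> tight_end q ->
  exists t, q = p + t *: ray_dir.
Proof.
move=> Pp Pq Tp Tq; exists (lambda_of (q - p).2).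
rewrite -(ray_kernel_line _ (tight_end_kernel p q Pp Pq Tp Tq)).
by rewrite addrC subrK.
Qed.

Lemma end_edge_line p q : F0 p -> F0 q -> exists t, q = p + t *: ray_dir.
Proof.
by move=> Fp Fq; apply: tight_end_line;
  [exact: end_edge_sub|exact: end_edge_sub|exact: end_edge_tight|exact: end_edge_tight].
Qed.

(** In this direction no slack of Q' decreases, by extremality of [beta 0 j0]; the edge is therefore
    unbounded on this side of [u]. *)
Lemma end_edge_ray t : 0 <= t -> F0 (u - (t * sgn) *: ray_dir).
Proof.
move=> t0; have [/= u1 [Pu [Qu Su] cover]] := F0u.
have uE : (u - (t * sgn) *: ray_dir).1 = u.1 by rewrite /= scaler0 subr0.
have sE k : slackQ C beta (u - (t * sgn) *: ray_dir).2 0 k =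
    slackQ C beta u.2 0 k - t * (sgn * slackQ C beta ray_dir.2 0 k).
  rewrite -[(u - _).2]/(u.2 - (t * sgn) *: ray_dir.2) linearB linearZ mxE.
  by rewrite [X in _ + X]mxE [X in - X]mxE mulrA.
split; first by rewrite /= scaler0 subr0.
split=> //=.
  split=> [k|].
    rewrite sE; apply: addr_ge0; first exact: Qu.
    rewrite oppr_ge0; apply: mulr_ge0_le0 => //.
    case: (split_ordP k) => i ->.
      by rewrite slackQ_ray_l mulr0.
    by rewrite slackQ_ray_r.
  rewrite -[RHS]Su; transitivity (\sum_i (x_of u.2 0 i - (t * sgn) * x_of ray_dir.2 0
    i)).
    by apply: eq_bigr => i _; rewrite !mxE.
  by rewrite sumrB -mulr_sumr sum_x_ray mulr0 subr0.
apply/setP=> k; rewrite [RHS]inE finset.in_setU.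
have [//|kI /=] := boolP (k \in I0).
rewrite inE sE slackQ_ray // !mulr0 subr0.
have /setP/(_ k) := cover; rewrite [RHS]inE finset.in_setU (negbTE kI) /=.
by rewrite inE.
Qed.

Lemma end_edgeN : edgeN A C beta F0.
Proof.
split; last by move=> [v w] [/= -> ].
rewrite polyPQE; split.
  pose T := ([set lshift (m + n) k | k in I0] :|: [set rshift (m + n) k | k in ~:
    I0])%SET.
  have TP z : (forall i, i \in T -> slackPQ A C beta z 0 i = 0) <-> tight_end z.
    split=> [H|[H1 H2] i].
      split=> k kI.
        have := H (lshift _ k); rewrite row_mxEl; apply.
        by rewrite finset.in_setU imset_f.
      have := H (rshift _ k); rewrite row_mxEr; apply.
      by rewrite finset.in_setU [X in _ || X]imset_f ?orbT // inE.
    rewrite finset.in_setU => /orP[] /imsetP[k kI ->].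
      by rewrite row_mxEl; exact: H1.
    by rewrite row_mxEr; apply: H2; rewrite inE in kI.
  have Fu : tight_facePQ A C beta T u.
    by split; [exact: end_edge_sub|apply/TP; exact: end_edge_tight].
  rewrite (_ : F0 = tight_facePQ A C beta T).
    exact: (tight_face_face _ _ _ _ Fu).
  apply/seteqP; split=> z.
    by move=> Fz; split; [exact: end_edge_sub|apply/TP; exact: end_edge_tight].
  move=> [PQz /TP tz].
  have [t zE] := tight_end_line u z (end_edge_sub _ F0u) PQz (end_edge_tight _ F0u) tz.
  have z1 : z.1 = v0 by rewrite zE /= scaler0 addr0; case: F0u.
  have [Pz Qz] : (Defs.polyP A `*` polyQ C beta) z by rewrite polyPQE.
  split=> //; split=> //=; first by rewrite -z1.
  apply/setP=> k; rewrite [RHS]inE finset.in_setU.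
  have [//|kI /=] := boolP (k \in I0).
  by rewrite inE (tz.2 _ kI) eqxx.
split; first by exists u.
exists <[ray_dir]>%VS; last by rewrite dim_vline ray_dir_neq0.
move=> W; split=> [/subvP sub p q Fp Fq|H].
  apply: sub; apply/vlineP; have [t ->] := end_edge_line p q Fp Fq.
  by exists t; rewrite addrAC subrr add0r.
(* A second point of the edge is [u - sgn *: ray_dir], and [sgn] is non-zero because its square is
   1. *)
rewrite -memvE; have := H _ _ (end_edge_ray 1 ler01) F0u.
rewrite opprB addrC subrK mul1r rpredZeq => /orP[/eqP s0|//].
by move: sgn2; rewrite s0 mulr0 => /eqP; rewrite eq_sym oner_eq0.
Qed.


Lemma end_edge_orient p : F0 p -> p <> u -> 0 < sgn * od p u.
Proof.
move=> Fp pu; have [t E] := end_edge_line u p F0u Fp.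
have upE : u - p = - t *: ray_dir by rewrite E opprD addNKr scaleNr.
have odE : od p u = - t * kernel_det A C beta I0 ray_dir.
  rewrite /orient_det upE kernel_detZ; congr (_ * kernel_det _ _ _ _ _).
  have -> : p.1 + u.1 = 2%:R *: v0.
    by case: Fp F0u => /= -> _ [/= -> _]; rewrite scaler_nat mulr2n.
  by apply: labelPZ; rewrite pnatr_eq0.
rewrite odE mulrA mulrN; apply: mulr_gt0; last exact: ray_det_gt0.
(* Otherwise [p] lies beyond [u], its mirror image in [u] lies on the unbounded side, and the vertex
   [u] is the midpoint of two points of the edge. *)
rewrite oppr_gt0 ltNge; apply/negP => st.
have := end_edge_ray (t * sgn); rewrite mulrC => /(_ st).
rewrite mulrAC sgn2 mul1r => Fq.
set r := t *: ray_dir in E Fq; set q := u - r in Fq.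
have half : 2^-1 *: (r + r) = r.
  by rewrite -mulr2n -[r *+ 2]scaler_nat scalerA mulVf ?scale1r // pnatr_eq0.
have pq : p - q = r + r by rewrite E /q opprB [r - u]addrC addrACA subrr add0r.
have qp : q = p.
  apply: (vertexPQ_between A C beta q p u 2^-1).
  - exact: vertexN_vertex.
  - exact: end_edge_sub.
  - exact: end_edge_sub.
  - by rewrite invr_gt0 ltr0n invf_lt1 ?ltr0n // ltr1n.
  - by rewrite pq half /q subrK.
by case: pu; rewrite E -half -pq qp subrr scaler0 addr0.
Qed.

End EndEdge.

(** * Rational data and the theorem *)

Lemma array_ratr {R : realType} {m n : nat} (M : 'M[rat]_(m, n)) i j :
  array (map_mx ratr M : 'M[R]_(m, n)) i j = ratr (array M i j).
Proof.
rewrite /array; case: insub => [i'|]; last by rewrite rmorph0.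
by case: insub => [j'|]; rewrite ?rmorph0 // mxE.
Qed.

(** The entries depend on the data through ring operations and comparisons only, all of which [ratr]
    respects. *)
Lemma edge_entry_ratr {R : realType} (m n : nat) (f : nat -> nat -> nat -> rat)
    (f' : nat -> nat -> nat -> R) i j :
  (forall a k l, f' a k l = ratr (f a k l)) ->
  edge_entry m n f' i j = ratr (edge_entry m n f i j).
Proof.
move=> E; have mE k : mid_entry f' k = ratr (mid_entry f k).
  by rewrite /mid_entry !E rmorphD.
have sE : \sum_(k < n) f' 0%N i k * mid_entry f' k =
    ratr (\sum_(k < n) f 0%N i k * mid_entry f k).
  by rewrite rmorph_sum; apply: eq_bigr => k _; rewrite E mE rmorphM.
rewrite /edge_entry sE !mE ltr_rat ltr0q !E.
by repeat case: ifP => _; rewrite ?rmorphN ?rmorphB ?rmorph_nat ?rmorph0.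
Qed.

Lemma edge_det_ratr {R : realType} {m n : nat} (A C : 'M[rat]_(m, n))
    (beta : 'rV[rat]_n) p q :
  edge_det (map_mx ratr A : 'M[R]_(m, n)) (map_mx ratr C) (map_mx ratr beta)
    (ratr_pt p) (ratr_pt q) = ratr (edge_det A C beta p q).
Proof.
rewrite /edge_det -det_map_mx; congr (\det _); apply/matrixP=> i j; rewrite !mxE.
apply: edge_entry_ratr => a k l.
case: a => [|[|[|[|[|[|[|a]]]]]]]; try exact: array_ratr.
by rewrite /= !nth_nil rmorph0.
Qed.

Theorem lemma10 (R : realType) :
  exists (prog : cmd) (T : {poly nat}),
  forall (m n : nat) (A C : 'M[R]_(m, n)) (beta : 'rV[R]_n)
         (js je : 'I_n) (is_ ie : 'I_m),
    A <> 0 -> C <> 0 -> beta <> 0 ->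
    nondegenerateP A -> nondegenerateQ C beta ->
    (forall j, beta 0 js <= beta 0 j) ->
    (forall j, beta 0 j <= beta 0 je) ->
    js <> je ->
    (forall i, A i js <= A is_ js) ->
    (forall i, A i je <= A ie je) ->
    let vs := unit_point js (A is_ js) in
    let ve := unit_point je (A ie je) in
    let Fs := [set vs] `*` EE A C beta vs in
    let Fe := [set ve] `*` EE A C beta ve in
    exists orient : set ('rV[R]_(n + 1) * 'rV[R]_(m + 2)) ->
                    'rV[R]_(n + 1) * 'rV[R]_(m + 2),
      [/\ forall F, edgeN A C beta F -> orientation_of F (orient F),
          computes_orientation prog T A C beta orient,
          forall c, cycleN A C beta c -> directed_cycleN A C beta orient c &
          forall u us, pathN A C beta Fs Fe u us ->
            directed_pathN A C beta orient Fs Fe u us].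
Proof.
exists orient_prog, orient_time.
move=> m n A C beta js je is_ ie _ _ _ ndP ndQ bs be _ _ _ vs ve Fs Fe.
have leadsE F p q : edgeN A C beta F -> F p -> F q -> p <> q ->
    `[< leads (orient A C beta F) p q >] = (0 < edge_det A C beta p q).
  move=> eF Fp Fq pq; rewrite edge_det_orient; try exact: edgeN_sub eF _.
  by apply/asboolP/idP => /(leads_orient _ _ _ ndP ndQ _ _ _ eF Fp Fq pq).
exists (orient A C beta); split.
- by move=> F; exact: orient_orientation.
- split=> [F p q eF Fp Fq pq|A' C' beta' p q F AE CE bE eF Fp Fq pq].
    by rewrite (leadsE F) //; exact: orient_prog_real.
  rewrite (leadsE F) //; last first.
    move=> E; apply: pq; move: E; rewrite /ratr_pt => -[] /map_mx_inj E1 /map_mx_inj E2.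
    by case: (p) (q) E1 E2 => ? ? [? ?] /= -> ->.
  rewrite AE CE bE edge_det_ratr ltr0q; exact: orient_prog_rational.
- by move=> c; exact: cycle_directed.
move=> u us [vu pu uniq_u Fsu Feu].
have vl : vertexN A C beta (last u us).
  elim: us (u) vu pu {uniq_u Fsu Feu} => //= v us IH w vw /andP[wv pv].
  by apply: IH pv; have [_ vv _ _] := asboolW wv.
have bs' j : 1 * (beta 0 js - beta 0 j) <= 0 by rewrite mul1r subr_le0.
have be' j : -1 * (beta 0 je - beta 0 j) <= 0 by rewrite mulN1r oppr_le0 subr_ge0.
have eFs : edgeN A C beta Fs := end_edgeN A C beta ndP ndQ is_ js 1 (mulr1 1) bs' u
  vu Fsu.
have sgn2 : (-1 : R) * -1 = 1 by rewrite mulrNN mulr1.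
have eFe : edgeN A C beta Fe := end_edgeN A C beta ndP ndQ ie je (-1) sgn2 be' _ vl Feu.
have into_u p : Fs p -> p <> u -> 0 < orient_det A C beta p u.
  move=> Fp pu'; rewrite -[orient_det _ _ _ _ _]mul1r.
  exact: (end_edge_orient A C beta ndP ndQ is_ js 1 (mulr1 1) bs' u vu Fsu).
split.
- split=> // p Fp pu'; apply/leads_orient => //; exact: into_u.
- case: us pu uniq_u {Feu vl eFe} => [//|v us] pu uniq_u.
  have auv : adjN A C beta u v by move: pu => /= /andP[].
  have [_ vv uv [F [eF Fu Fv]]] := asboolW auv.
  apply: (path_turn _ _ (arcN_turn A C beta ndP ndQ)) => //.
  apply: etrans (arcN_od A C beta ndP ndQ u v auv) _.
  pose r := ray_dir beta js : 'rV[R]_(n + 1) * 'rV[R]_(m + 2).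
  have r0 : r != 0 by exact: ray_dir_neq0.
  have ray t : 0 <= t -> Fs (u - t *: r).
    by move=> t0; rewrite -[t]mulr1; exact: end_edge_ray.
  (* The unbounded edge offers no second vertex to start from, so the point [u - r] plays the part
     of the predecessor of [u]. *)
  have Fp : Fs (u - r) by have := ray 1 ler01; rewrite scale1r.
  have pne : u - r <> u.
    by move=> /eqP; rewrite subr_eq addrC -subr_eq subrr eq_sym (negbTE r0).
  have vu' : v <> u by move=> E; apply: uv.
  have noray t : 0 < t -> v - u <> t *: (u - r - u).
    move=> t0 E.
    have vE : v = u - t *: r.
      by rewrite -[v](subrK u) E [u - r - u]addrAC subrr add0r scalerN addrC.
    (* If [v] were on the unbounded edge, it would be the midpoint of [u] and the point twice as far
       away. *)
    have uq : u = u - (t + t) *: r.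
      apply: (vertexPQ_between A C beta _ _ v 2^-1).
      - exact: vertexN_vertex.
      - by apply: (end_edge_sub _ _ _ is_ js); exact: Fsu.
      - by apply: (end_edge_sub _ _ _ is_ js); apply: ray; rewrite addr_ge0 // ltW.
      - by rewrite invr_gt0 ltr0n invf_lt1 ?ltr0n // ltr1n.
      rewrite vE [u - _ - u]addrAC subrr add0r scalerN scalerA.
      by congr (u - _ *: r); field.
    move/(congr1 (fun x => u - x)): uq;
      rewrite subrr opprB addrCA subrr addr0 => /esym/eqP.
    by rewrite scaler_eq0 (negbTE r0) orbF gt_eqF // addr_gt0.
  apply: etrans (esym (orient_turn A C beta ndP ndQ u (u - r) v Fs F _ _ _ _ _ _ _ _
    _ _)) _ => //.
  exact: into_u.
split=> // p Fp pl; apply/leads_orient => //; first by move=> E; apply: pl.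
have := end_edge_orient A C beta ndP ndQ ie je (-1) sgn2 be' _ vl Feu p Fp pl.
by rewrite (orient_detC A C beta p) mulrNN mul1r.
Qed.
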